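(* Let $n\ge1$, $\hbar>0$, $m>0$, and let $u$, with $u(\cdot,t)\in\mathcal{S}(\mathbb{R}^n)$, be the solution of the free Schrödinger equation $$i\hbar\frac{\partial u}{\partial t}(x,t)=-\frac{\hbar^2}{2m}\Delta u(x,t).$$ Suppose that at time $t=0$ and at time $t=T$ the solution satisfies, for all $x\in\mathbb{R}^n$, $$|u(x,0)|\le Ke^{-\alpha|x|^2}\quad\text{and}\quad|u(x,T)|\le Ke^{-\beta|x|^2}$$ for some constants $\alpha,\beta,K>0$. If $\alpha\beta\left(\frac{2\hbar T}{m}\right)^2>1$, then $u\equiv0$.
   Context: $\mathcal{S}(\mathbb{R}^n)$ is the Schwartz space and $\Delta$ is the Laplacian in $x\in\mathbb{R}^n$. *)

(* Defs.v *)
From mathcomp Require Export all_boot all_order all_algebra.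
From mathcomp Require Export all_classical all_reals all_analysis.
From mathcomp Require Export complex.
Export numFieldNormedType.Exports.

Set Implicit Arguments.
Unset Strict Implicit.
Unset Printing Implicit Defensive.

Import Order.TTheory GRing.Theory Num.Theory.

Local Open Scope ring_scope.
Local Open Scope complex_scope.

(* The library norm on 'rV[R]_n is the sup norm, hence this definition. *)
Definition enorm (R : realType) (n : nat) (x : 'rV[R]_n) : R :=
  Num.sqrt (\sum_(i < n) x 0 i ^+ 2).

(* R[i] is a normed module over itself but not over R, so real derivatives of
   complex-valued functions are taken on real and imaginary parts. *)
Definition derivableC (R : realType) (V : normedModType R)
    (f : V -> R[i]) (x v : V) : Prop :=
  derivable (fun y => complex.Re (f y)) x v /\
  derivable (fun y => complex.Im (f y)) x v.

Definition deriveC (R : realType) (V : normedModType R)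
    (f : V -> R[i]) (x v : V) : R[i] :=
  'D_v (fun y => complex.Re (f y)) x +i* 'D_v (fun y => complex.Im (f y)) x.

Definition continuousC (R : realType) (V : normedModType R)
    (f : V -> R[i]) : Prop :=
  continuous (fun y => complex.Re (f y)) /\
  continuous (fun y => complex.Im (f y)).

Section Schwartz.
Context (R : realType) (n : nat).
Implicit Types (f : 'rV[R]_n -> R[i]) (j : 'I_n) (s : seq 'I_n).

Definition pderiv j f : 'rV[R]_n -> R[i] :=
  fun x => deriveC f x (delta_mx 0 j).

Definition pderivs s f : 'rV[R]_n -> R[i] := foldr pderiv f s.

Definition smooth f : Prop :=
  forall s, continuousC (pderivs s f) /\
    forall j x, derivableC (pderivs s f) x (delta_mx 0 j).

Definition monomial (a : 'I_n -> nat) (x : 'rV[R]_n) : R :=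
  \prod_(i < n) x 0 i ^+ a i.

Definition schwartz f : Prop :=
  smooth f /\
  forall (a : 'I_n -> nat) s, exists M : R, forall x,
    `|(monomial a x)%:C * pderivs s f x| <= M%:C.

Definition laplacian f (x : 'rV[R]_n) : R[i] :=
  \sum_(j < n) pderiv j (pderiv j f) x.

End Schwartz.

Definition free_schrodinger (R : realType) (n : nat) (hbar m : R)
    (u : 'rV[R]_n -> R -> R[i]) : Prop :=
  forall (x : 'rV[R]_n) (t : R),
    derivableC (u x) t 1 /\
    (0 +i* 1) * hbar%:C * deriveC (u x) t 1 =
      - ((hbar ^+ 2 / (2 * m))%:C * laplacian (u ^~ t) x).

(* Main.v *)
Require Import Defs.
From mathcomp Require Import zify ring lra measurable_realfun.

(** Write F_t for the Fourier transform of u(., t). The equation turns into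
    F_t(xi) = exp (- i c t |xi|^2) F_0(xi) with c = hbar / (2 m). No uniformity
    in t is assumed of u, so differentiating under the integral sign is only
    possible near times where the Schwartz bounds are locally uniform. The other
    times form a closed set, and a Baire argument on it (along closed sets of
    times with a common bound) shows that it is empty.

    The Gaussian bounds make z |-> F_0(z omega) and z |-> F_T(z omega) entire of
    order 2, bounded by exp (A (Im z)^2) and exp (B (Im z)^2) with A, B slightly
    above |omega|^2 / (4 alpha) and |omega|^2 / (4 beta), and
    F_T(z omega) = exp (- i k z^2) F_0(z omega) with k = c T |omega|^2. The
    hypothesis says A B < k^2. As F_T is bounded by exp (B (Im z)^2), F_0 decays
    like exp ((B sin^2 phi - k sin (2 phi)) r^2) on the rays of argument phi in
    (0, pi / 2); at tan phi = k / B this beats the growth exp (A cos^2 phi r^2)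
    on the orthogonal ray, so Phragmén–Lindelöf in sectors of opening just below
    pi / 2 gives F_0 = 0. Working in the variable w = log z turns sectors into strips and
    avoids the point z = 0. *)

Set Implicit Arguments.
Unset Strict Implicit.
Unset Printing Implicit Defensive.

Import Order.TTheory GRing.Theory Num.Theory.
Import Normc.

Local Open Scope ring_scope.
Local Open Scope complex_scope.
Local Open Scope classical_set_scope.

(** * Complex numbers and the complex exponential *)

Arguments normc : simpl never.

Section ComplexBasics.
Context {R : realType}.
Implicit Types (x y : R) (z w : R[i]) (u v : nat -> R[i]).
Local Notation Re := complex.Re.
Local Notation Im := complex.Im.

(** A bound on the transforms alone, uniform for t in an interval, controls the suprema of u(., t)
    and of its Laplacian through inversion, but gives no decay in x uniform in t; so even near good
    times the Fourier integral itself cannot be differentiated in t. Multiplying the integrand by a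
    wide Gaussian restores domination. On the Fourier side this averages over frequencies near xi,
    and as the Laplacian has symbol -|xi|^2, the time derivative of the phase-corrected average is
    of the order of the averaging width, which then tends to 0. The Baire argument closes because
    propagation preserves |F_t(xi)|. The strictness of A B < k^2 is spent twice: on the small loss
    in A and B, which keeps the Gaussian integrals convergent with constants independent of the
    frequency, and on a negative combined exponent for two orthogonal rays. As the opening of the
    sector between them tends to pi / 2, the interpolated exponent inside tends to minus
    infinity. *)

Lemma cReD z w : Re (z + w) = Re z + Re w. Proof. by case: z w => ? ? []. Qed.
Lemma cImD z w : Im (z + w) = Im z + Im w. Proof. by case: z w => ? ? []. Qed.
Lemma cReN z : Re (- z) = - Re z. Proof. by case: z. Qed.
Lemma cImN z : Im (- z) = - Im z. Proof. by case: z. Qed.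
Lemma cReM z w : Re (z * w) = Re z * Re w - Im z * Im w.
Proof. by case: z w => ? ? []. Qed.
Lemma cImM z w : Im (z * w) = Re z * Im w + Im z * Re w.
Proof. by case: z w => ? ? []. Qed.

Lemma complex_ext z w : Re z = Re w -> Im z = Im w -> z = w.
Proof. by case: z w => ? ? [? ?] /= -> ->. Qed.

Lemma normcE2 z : normc z = Num.sqrt (Re z ^+ 2 + Im z ^+ 2).
Proof. by case: z. Qed.

Lemma normc_sqr z : normc z ^+ 2 = Re z ^+ 2 + Im z ^+ 2.
Proof. by rewrite normcE2 sqr_sqrtr // addr_ge0 // sqr_ge0. Qed.

Lemma normc_ge0 z : 0 <= normc z. Proof. by rewrite normcE2 sqrtr_ge0. Qed.

Lemma normc_eq0 z : (normc z == 0) = (z == 0).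
Proof. by apply/eqP/eqP => [/eq0_normc|->]//; rewrite normc0. Qed.

Lemma normcR x : normc x%:C = `|x|.
Proof. by rewrite normcE2 /= expr0n addr0 sqrtr_sqr. Qed.

Lemma normci : normc ('i : R[i]) = 1.
Proof. by rewrite normcE2 /= expr0n expr1n add0r sqrtr1. Qed.

Lemma normc_normE z : `|z| = (normc z)%:C. Proof. by case: z. Qed.

Lemma Re_le_normc z : `|Re z| <= normc z.
Proof. by rewrite -lecR -normc_normE normc_ge_Re. Qed.

Lemma Im_le_normc z : `|Im z| <= normc z.
Proof.
rewrite normcE2 -sqrtr_sqr ler_sqrt ?addr_ge0 ?sqr_ge0 //.
by rewrite lerDr sqr_ge0.
Qed.

Lemma normc_le z : normc z <= `|Re z| + `|Im z|.
Proof.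
rewrite [z in X in X <= _]complexE (le_trans (le_normcD _ _)) // normcR lerD2l.
by rewrite normcM normci mul1r normcR.
Qed.

Lemma normcX z n : normc (z ^+ n) = normc z ^+ n.
Proof. by elim: n => [|n IH]; rewrite ?expr0 ?normc1 // !exprS normcM IH. Qed.

Lemma normc_prod (I : Type) (s : seq I) (F : I -> R[i]) :
  normc (\prod_(i <- s) F i) = \prod_(i <- s) normc (F i).
Proof.
elim: s => [|i s IH]; first by rewrite !big_nil normc1.
by rewrite !big_cons normcM IH.
Qed.

Lemma normcB z w : normc (z - w) = normc (w - z).
Proof. by rewrite -normcN opprB. Qed.

(* The norm topology of [R[i]] is avoided: limits are taken componentwise. *)
Definition cvgC u z : Prop :=
  ((fun k => Re (u k)) @ \oo --> Re z) /\ ((fun k => Im (u k)) @ \oo --> Im z).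

Lemma cvgC_cst z : cvgC (fun=> z) z.
Proof. by split; exact: cvg_cst. Qed.

Lemma cvgCD u v z w : cvgC u z -> cvgC v w -> cvgC (fun k => u k + v k) (z + w).
Proof.
move=> [u1 u2] [v1 v2]; split.
- by under eq_fun do rewrite cReD; rewrite cReD; exact: cvgD.
- by under eq_fun do rewrite cImD; rewrite cImD; exact: cvgD.
Qed.

Lemma cvgCM u v z w : cvgC u z -> cvgC v w -> cvgC (fun k => u k * v k) (z * w).
Proof.
move=> [u1 u2] [v1 v2]; split.
- by under eq_fun do rewrite cReM; rewrite cReM; apply: cvgB; exact: cvgM.
- by under eq_fun do rewrite cImM; rewrite cImM; apply: cvgD; exact: cvgM.
Qed.

Lemma cvgCN u z : cvgC u z -> cvgC (fun k => - u k) (- z).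
Proof.
move=> [u1 u2]; split.
- by under eq_fun do rewrite cReN; rewrite cReN; exact: cvgN.
- by under eq_fun do rewrite cImN; rewrite cImN; exact: cvgN.
Qed.

Lemma cvgCR (f : nat -> R) x : (f @ \oo --> x) -> cvgC (fun k => (f k)%:C) x%:C.
Proof. by move=> fx; split => //=; exact: cvg_cst. Qed.

Lemma cvgC_prod (I : Type) (s : seq I) (F : I -> nat -> R[i]) (G : I -> R[i]) :
  (forall i, cvgC (F i) (G i)) ->
  cvgC (fun k => \prod_(i <- s) F i k) (\prod_(i <- s) G i).
Proof.
move=> FG; elim: s => [|i s IH].
  by under eq_fun do rewrite big_nil; rewrite big_nil; exact: cvgC_cst.
by under eq_fun do rewrite big_cons; rewrite big_cons; exact: cvgCM.
Qed.

Lemma cvgC_normc u z : cvgC u z -> (fun k => normc (u k)) @ \oo --> normc z.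
Proof.
move=> [u1 u2]; under eq_fun do rewrite normcE2; rewrite normcE2.
apply: (@cvg_comp _ _ _ (fun k => Re (u k) ^+ 2 + Im (u k) ^+ 2) Num.sqrt);
  last exact: sqrt_continuous.
by apply: cvgD; rewrite !expr2; under eq_fun do rewrite expr2; exact: cvgM.
Qed.

Lemma cvgC_le u z M : cvgC u z -> (forall k, normc (u k) <= M) -> normc z <= M.
Proof.
move=> /cvgC_normc uz uM; have := uz => /cvg_lim <- //.
apply: limr_le; first by apply/cvg_ex; exists (normc z).
by near=> k.
Unshelve. all: by end_near. Qed.

Lemma cvgC_unique u z w : cvgC u z -> cvgC u w -> z = w.
Proof.
move=> [u1 u2] [v1 v2]; apply: complex_ext.
- exact: (cvg_unique _ u1 v1).
- exact: (cvg_unique _ u2 v2).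
Qed.

Definition cexp z : R[i] :=
  (expR (Re z) * cos (Im z)) +i* (expR (Re z) * sin (Im z)).

Lemma cexpE z : cexp z = (expR (Re z) * cos (Im z)) +i* (expR (Re z) * sin (Im z)).
Proof. by []. Qed.

Lemma cexpD z w : cexp (z + w) = cexp z * cexp w.
Proof.
rewrite !cexpE cReD cImD expRD cosD sinD; apply: complex_ext => /=; ring.
Qed.

Lemma cexp0 : cexp 0 = 1.
Proof. by rewrite cexpE /= expR0 cos0 sin0 mulr1 mulr0. Qed.

Lemma normc_cexp z : normc (cexp z) = expR (Re z).
Proof.
rewrite cexpE normcE2 /= !exprMn -mulrDr cos2Dsin2 mulr1 sqrtr_sqr.
by rewrite ger0_norm // expR_ge0.
Qed.

Lemma cexpR x : cexp x%:C = (expR x)%:C.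
Proof. by rewrite cexpE /= cos0 sin0 mulr1 mulr0. Qed.

Lemma cvgC_cexp u z : cvgC u z -> cvgC (fun k => cexp (u k)) (cexp z).
Proof.
move=> [u1 u2]; have e : expR (Re (u k)) @[k --> \oo] --> expR (Re z).
  by apply: continuous_cvg => //; exact: continuous_expR.
split.
- under eq_fun do rewrite cexpE; rewrite cexpE; apply: cvgM => //.
  by apply: (cvg_comp _ _ u2); exact: continuous_cos.
- under eq_fun do rewrite cexpE; rewrite cexpE; apply: cvgM => //.
  by apply: (cvg_comp _ _ u2); exact: continuous_sin.
Qed.

(** * Derivatives of complex-valued functions of one real variable *)

Definition isD (f : R -> R[i]) (x : R) (d : R[i]) : Prop :=
  is_derive x 1 (fun t => Re (f t)) (Re d) /\
  is_derive x 1 (fun t => Im (f t)) (Im d).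

Lemma isD_cst z x : isD (fun=> z) x 0.
Proof. by split; exact: is_derive_cst. Qed.

Lemma isDR (f : R -> R) x d : is_derive x 1 f d -> isD (fun t => (f t)%:C) x d%:C.
Proof. by move=> fd; split => //=; exact: is_derive_cst. Qed.

Lemma isDD f g x d e : isD f x d -> isD g x e -> isD (fun t => f t + g t) x (d + e).
Proof.
move=> [f1 f2] [g1 g2]; split.
- by rewrite cReD; under eq_fun do rewrite cReD; exact: is_deriveD.
- by rewrite cImD; under eq_fun do rewrite cImD; exact: is_deriveD.
Qed.

Lemma isDM f g x d e : isD f x d -> isD g x e ->
  isD (fun t => f t * g t) x (d * g x + f x * e).
Proof.
move=> [f1 f2] [g1 g2]; split.
- under eq_fun do rewrite cReM.
  rewrite cReD !cReM; apply: is_derive_eq => /=.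
  by rewrite /GRing.scale /=; ring.
- under eq_fun do rewrite cImM.
  rewrite cImD !cImM; apply: is_derive_eq => /=.
  by rewrite /GRing.scale /=; ring.
Qed.

Lemma isDZ z f x d : isD f x d -> isD (fun t => z * f t) x (z * d).
Proof. by move=> fd; have := isDM (isD_cst z x) fd; rewrite mul0r add0r. Qed.

Lemma isD_cexp f x d : isD f x d -> isD (fun t => cexp (f t)) x (d * cexp (f x)).
Proof.
move=> [f1 f2]; rewrite cexpE; split.
- under eq_fun do rewrite cexpE.
  rewrite cReM /=; apply: is_derive_eq => /=.
  by rewrite /GRing.scale /=; ring.
- under eq_fun do rewrite cexpE.
  rewrite cImM /=; apply: is_derive_eq => /=.
  by rewrite /GRing.scale /=; ring.
Qed.

End ComplexBasics.

(** * Integration over the real line *)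

Section RealIntegral.
Context {R : realType}.
Local Notation mu := (@lebesgue_measure R).
Implicit Types (f g h : R -> R) (a b C s : R).

(** The single decay rate of the whole development: bounded by 1, with integral pi, and giving a
    majorant in several variables by taking products over coordinates. *)
Definition wgt s : R := (1 + s ^+ 2)^-1.

Lemma oneDsqr_gt0 s : 0 < 1 + s ^+ 2.
Proof. by rewrite ltr_pwDl // sqr_ge0. Qed.

Lemma wgt_gt0 s : 0 < wgt s. Proof. by rewrite invr_gt0 oneDsqr_gt0. Qed.
Lemma wgt_ge0 s : 0 <= wgt s. Proof. exact: ltW (wgt_gt0 s). Qed.
Lemma wgt_le1 s : wgt s <= 1.
Proof. by rewrite invf_le1 ?oneDsqr_gt0 // lerDl sqr_ge0. Qed.
Lemma wgtM s : wgt s * (1 + s ^+ 2) = 1.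
Proof. by rewrite mulVf // gt_eqF // oneDsqr_gt0. Qed.

Lemma continuous_wgt : continuous wgt.
Proof. exact: continuous_oneDsqrV. Qed.

Lemma integral_wgt : (\int[mu]_s (wgt s)%:E = pi%:E)%E.
Proof.
rewrite ge0_symfun_integralT //.
- rewrite (_ : [set x | _] = `[0, +oo[%classic); last first.
    by apply/seteqP; split => x/=; rewrite in_itv/= andbT.
  have := integral0y_oneDsqr R; rewrite /oneDsqr /wgt => ->.
  by rewrite -EFinM; congr EFin; field.
- by move=> s; exact: wgt_ge0.
- exact: continuous_wgt.
- by move=> s /=; rewrite /wgt sqrrN.
Qed.

Lemma measurable_wgt : measurable_fun setT wgt.
Proof. exact: continuous_measurable_fun continuous_wgt. Qed.

Lemma integrable_wgtM C : mu.-integrable setT (EFin \o (fun s => C * wgt s)).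
Proof.
have -> : EFin \o (fun s => C * wgt s) = (fun s => (C%:E * (wgt s)%:E)%E) by [].
apply: integrableZl => //; apply/integrableP; split.
  by apply/measurable_EFinP; exact: measurable_wgt.
under eq_integral do rewrite gee0_abs ?lee_fin ?wgt_ge0 //.
by rewrite integral_wgt ltry.
Qed.

Definition rdom C f : Prop :=
  measurable_fun setT f /\ forall s, `|f s| <= C * wgt s.

Lemma rdom_ge0 C f : rdom C f -> 0 <= C.
Proof.
move=> [_ /(_ 0)]; rewrite /wgt expr0n addr0 invr1 mulr1.
exact: le_trans (normr_ge0 _).
Qed.

Lemma rdom_integrable C f : rdom C f -> mu.-integrable setT (EFin \o f).
Proof.
move=> [mf fC]; apply: le_integrable (integrable_wgtM C) => //.
  exact/measurable_EFinP.
by move=> s _ /=; rewrite lee_fin (le_trans (fC s)) // ler_norm.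
Qed.

Definition RI f : R := \int[mu]_s f s.

Lemma EFin_RI C f : rdom C f -> ((RI f)%:E = \int[mu]_s (f s)%:E)%E.
Proof.
move=> /rdom_integrable fi; rewrite /RI /Rintegral fineK //.
exact: integrable_fin_num.
Qed.

Lemma RI_wgt : RI wgt = pi.
Proof. by rewrite /RI /Rintegral integral_wgt. Qed.

Lemma rdom_wgt : rdom 1 wgt.
Proof.
split; first exact: measurable_wgt.
by move=> s; rewrite mul1r ger0_norm // wgt_ge0.
Qed.

Lemma rdomD C C' f g : rdom C f -> rdom C' g -> rdom (C + C') (fun s => f s + g s).
Proof.
move=> [mf fC] [mg gC]; split; first exact: measurable_funD.
by move=> s; rewrite (le_trans (ler_normD _ _)) // mulrDl lerD.
Qed.

Lemma rdomZ c C f : rdom C f -> rdom (`|c| * C) (fun s => c * f s).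
Proof.
move=> [mf fC]; split; first exact: measurable_funM.
by move=> s; rewrite normrM -mulrA ler_wpM2l.
Qed.

Lemma RID C C' f g : rdom C f -> rdom C' g ->
  RI (fun s => f s + g s) = RI f + RI g.
Proof. by move=> /rdom_integrable fi /rdom_integrable gi; exact: RintegralD. Qed.

Lemma RIZ c C f : rdom C f -> RI (fun s => c * f s) = c * RI f.
Proof. by move=> /rdom_integrable fi; exact: RintegralZl. Qed.

Lemma RI_bound C f : rdom C f -> `|RI f| <= C * pi.
Proof.
move=> fC; have fi := rdom_integrable fC; have [mf fB] := fC.
rewrite (le_trans (le_normr_Rintegral _ fi)) // -RI_wgt -(RIZ C rdom_wgt).
apply: le_Rintegral => //.
- apply: le_integrable (integrable_wgtM C) => //.
    by apply/measurable_EFinP; exact: measurableT_comp.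
  by move=> s _ /=; rewrite lee_fin normr_id (le_trans (fB s)) // ler_norm.
- exact: integrable_wgtM.
Qed.

Lemma RI_dct C (F : nat -> R -> R) f :
  (forall k, rdom C (F k)) -> (forall s, F ^~ s @ \oo --> f s) ->
  (fun k => RI (F k)) @ \oo --> RI f.
Proof.
move=> FC Ff.
have mf : measurable_fun setT f.
  by apply: (@measurable_fun_cvg _ _ R setT F) => // k; exact: (FC k).1.
have fC : rdom C f.
  split=> // s; have := Ff s => /cvg_norm /cvg_lim <- //.
  apply: limr_le; first by apply/cvg_ex; exists `|f s|; exact: cvg_norm.
  by near=> k; exact: (FC k).2.
have [] := @dominated_convergence _ _ R mu setT measurableT
  (fun k s => (F k s)%:E) (EFin \o f) (EFin \o (fun s => C * wgt s)).
- by move=> k; apply/measurable_EFinP; exact: (FC k).1.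
- exact/measurable_EFinP.
- by apply: aeW => s _; apply: cvg_EFin; [near=> k|exact: Ff].
- exact: integrable_wgtM.
- by apply: aeW => s k _ /=; rewrite lee_fin; exact: (FC k).2.
move=> _ _; rewrite /= -(EFin_RI fC).
under eq_fun do rewrite -(EFin_RI (FC _)).
by move=> /fine_cvg.
Unshelve. all: by end_near. Qed.

(** Truncation to growing symmetric intervals turns the integral into boundary values of [F], which
    tend to 0 because [F] itself is dominated by the weight. This is the source of every integration
    by parts below. *)
Lemma RI_derive0 C C' f F : continuous f -> rdom C f ->
  (forall s, is_derive s 1 F (f s)) -> (forall s, `|F s| <= C' * wgt s) ->
  RI f = 0.
Proof.
move=> cf fC dF FC.
have cF : continuous F.
  by move=> s; apply: differentiable_continuous; apply/derivable1_diffP.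
pose G k := f \_ `[- k.+1%:R, k.+1%:R].
have GC k : rdom C (G k).
  split.
    apply/(measurable_restrictT _ _).1 => //.
    by apply: measurable_funTS; exact: fC.1.
  move=> s; rewrite /G patchE; case: ifP => _; first exact: fC.2.
  by rewrite normr0 mulr_ge0 ?(rdom_ge0 fC) ?wgt_ge0.
have GE k : RI (G k) = F k.+1%:R - F (- k.+1%:R).
  rewrite /G /RI -Rintegral_mkcond /Rintegral.
  rewrite (@continuous_FTC2 _ f F) //.
  - by rewrite gtrN // ltr0n.
  - exact: continuous_subspaceT.
  - split=> //.
    + by apply: cvg_at_right_filter; exact: cF.
    + by apply: cvg_at_left_filter; exact: cF.
  - by move=> s _; rewrite derive1E derive_val.
have Gf : (fun k => RI (G k)) @ \oo --> RI f.
  apply: (RI_dct GC) => s; apply: cvg_near_cst.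
  near=> k; rewrite /G patchE mem_set //= in_itv /= -ler_norml.
  near: k; have [N _ HN] := nbhs_infty_ger `|s|.
  by exists N => // i /= Ni; rewrite (le_trans (HN i Ni)) // ler_nat leqnSn.
have G0 : (fun k => RI (G k)) @ \oo --> 0.
  have C0 : 0 <= C'.
    by rewrite -(pmulr_lge0 _ (wgt_gt0 0)) (le_trans _ (FC 0)).
  have b0 (c : R) : (fun k => c * harmonic k) @ \oo --> (0 : R).
    by rewrite -[X in _ --> X](mulr0 c); apply: cvgMr; exact: cvg_harmonic.
  apply: (squeeze_cvgr _ (b0 (- (2 * C'))) (b0 (2 * C'))).
  near=> k; rewrite mulNr -ler_norml GE (le_trans (ler_normB _ _)) //.
  have wk : wgt k.+1%:R <= harmonic k.
    rewrite /wgt /harmonic /= lef_pV2 ?posrE ?ltr0n ?oneDsqr_gt0 //.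
    by rewrite -natrX -[1]/(1%:R) -natrD ler_nat expnS expn1; lia.
  have := FC k.+1%:R; have := FC (- k.+1%:R).
  rewrite (_ : wgt (- _) = wgt k.+1%:R); last by rewrite /wgt sqrrN.
  move=> h1 h2.
  rewrite (le_trans (lerD h2 h1)) // -mulrDr -mulrA mulrCA ler_wpM2l //.
  by rewrite mulr_natl mulr2n lerD.
exact: (cvg_unique _ Gf G0).
Unshelve. all: by end_near. Qed.

(** With [t = a + b * s], the constant comes from [(t - a) ^+ 2 <= 2 * (1 + a ^+ 2) * (1 + t ^+ 2)];
    weight majorants thus survive affine substitutions. *)
Lemma wgt_affine a b s : 0 < b ->
  wgt (a + b * s) <= (1 + 2 * (1 + a ^+ 2) / b ^+ 2) * wgt s.
Proof.
move=> b0; rewrite /wgt ler_pdivlMr ?oneDsqr_gt0 // mulrC.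
rewrite ler_pdivrMr ?oneDsqr_gt0 //.
set t := a + b * s; have -> : s = (t - a) / b by rewrite /t; field; lra.
have ib : 0 < (b ^+ 2)^-1 by rewrite invr_gt0 exprn_gt0.
have e : (t - a) ^+ 2 <= 2 * (1 + a ^+ 2) * (1 + t ^+ 2).
  have := sqr_ge0 (t + a); have := sqr_ge0 (t * a).
  by rewrite !expr2; nra.
rewrite expr_div_n mulrDl mul1r lerD ?lerDl ?sqr_ge0 //.
apply: le_trans (ler_wpM2r (ltW ib) e) _.
rewrite le_eqVlt; apply/orP; left; apply/eqP; rewrite -!mulrA.
by congr (_ * (_ * _)); rewrite mulrC.
Qed.

Lemma rdom_affine C f a b : 0 < b -> continuous f -> rdom C f ->
  rdom (C * (1 + 2 * (1 + a ^+ 2) / b ^+ 2)) (fun s => f (a + b * s)).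
Proof.
move=> b0 cf fC; split; last first.
  move=> s; rewrite (le_trans (fC.2 _)) // -mulrA ler_wpM2l ?(rdom_ge0 fC) //.
  exact: wgt_affine.
apply: continuous_measurable_fun => s; apply: continuous_comp; last exact: cf.
by apply: cvgD; [exact: cvg_cst|apply: cvgMr; exact: cvg_id].
Qed.

(** The substitution rule at hand is for nonnegative integrands, so it is applied to [f + C * wgt]
    and to [C * wgt], and the results are subtracted. *)
Lemma RI_affine C f a b : 0 < b -> continuous f -> rdom C f ->
  RI (fun s => f (a + b * s)) = b^-1 * RI f.
Proof.
move=> b0 cf fC.
have pos D g : (forall s, 0 <= g s) -> continuous g -> rdom D g ->
    RI (fun s => g (a + b * s)) = b^-1 * RI g.
  move=> g0 cg gD.
  have dF : (fun s : R => a + b * s)^`()%classic = cst b.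
    apply/funext => s; rewrite derive1E; apply: derive_val.
    apply: is_derive_eq. by rewrite /GRing.scale /= add0r mul1r mulr1.
  have := @increasing_ge0_integration_by_substitutionT R (fun s => a + b * s) g.
  rewrite dF => H.
  rewrite /RI /Rintegral H //; first last.
  - apply/cvgryPge => A; near=> s; rewrite -lerBlDl mulrC -ler_pdivrMr //.
  - apply/cvgrNyPle => A; near=> s; rewrite -lerBrDl mulrC -ler_pdivlMr //.
  - exact: is_cvg_cst.
  - exact: is_cvg_cst.
  - by move=> s; exact: cvg_cst.
  - by move=> x y xy; rewrite ltrD2l ltr_pM2l.
  rewrite -/(RI _) /=.
  have -> : (\int[mu]_s (((g \o (fun s => a + b * s)) * cst b) s)%:E =
     (b * RI (fun s => g (a + b * s)))%:E)%E.
    have := rdom_affine a b0 cg gD => gD'.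
    rewrite -(RIZ b gD') (EFin_RI (rdomZ b gD')).
    by apply: eq_integral => s _ /=; rewrite mulrC.
  by rewrite /= mulKf // gt_eqF.
have wC : rdom C (fun s => C * wgt s).
  have := rdomZ C rdom_wgt; rewrite mulr1 ger0_norm //; exact: rdom_ge0 fC.
have cw : continuous (fun s => C * wgt s).
  by move=> s; apply: cvgMr; exact: continuous_wgt.
have pw := pos _ _ (fun s => mulr_ge0 (rdom_ge0 fC) (wgt_ge0 s)) cw wC.
have pf := pos _ (fun s => f s + C * wgt s) _ _ (rdomD fC wC).
have {pf} := pf _ _; rewrite (RID (rdom_affine a b0 cf fC) (rdom_affine a b0 cw wC)).
rewrite pw (RID fC wC) mulrDr => H; apply: (addIr (b^-1 * RI (fun s => C * wgt s))).
apply: H.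
- by move=> s; rewrite -lerBlDr sub0r; have := fC.2 s; rewrite ler_norml => /andP[].
- by move=> s; apply: cvgD; [exact: cf|exact: cw].
Unshelve. all: by end_near. Qed.

(** Fubini asks for joint measurability. Rounding [s] down to the grid of step [1 / (k + 1)] makes
    preimages countable unions of measurable rectangles, and continuity in [s] gives pointwise
    convergence as the grid is refined. *)
Lemma measurable_separately_continuous (g : R -> R -> R) :
  (forall s, continuous (g s)) -> (forall r, continuous (g ^~ r)) ->
  measurable_fun setT (fun p : R * R => g p.1 p.2).
Proof.
move=> cg1 cg2.
pose q (k : nat) (s : R) : R := (Num.floor (k.+1%:R * s))%:~R / k.+1%:R.
apply: (@measurable_fun_cvg _ _ R setT (fun k p => g (q k p.1) p.2)).
- move=> k _ Y mY; rewrite setTI.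
  have -> : (fun p : R * R => g (q k p.1) p.2) @^-1` Y =
     \bigcup_(z in [set: int]) (([set s | Num.floor (k.+1%:R * s) = z] `*`
        [set r | Y (g (z%:~R / k.+1%:R) r)]) : set (R * R)).
    apply/seteqP; split => [[s r] /= Yg|[s r] [z _] [/= <-]] //.
    by exists (Num.floor (k.+1%:R * s)).
  apply: countable_bigcupT_measurable => [|z]; first exact: countableP.
  apply: measurableX.
    have -> : [set s : R | Num.floor (k.+1%:R * s) = z] =
        [set` `[z%:~R / k.+1%:R, (z + 1)%:~R / k.+1%:R[%R].
      apply/seteqP; split => s /=; rewrite in_itv /=.
        move=> <-; rewrite ler_pdivrMr ?ltr0n // ltr_pdivlMr ?ltr0n //.
        by rewrite mulrC floor_itv.
      rewrite ler_pdivrMr ?ltr0n // ltr_pdivlMr ?ltr0n // mulrC => h.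
      exact: floor_def.
    exact: measurable_itv.
  rewrite -[X in measurable X]setTI.
  exact: (continuous_measurable_fun (cg1 _)).
- move=> [s r] _ /=.
  apply: (@cvg_comp _ _ _ (fun k => q k s) (fun t => g t r)); last exact: cg2.
  have l0 : (fun k => s - harmonic k) @ \oo --> s.
    rewrite -[X in _ --> X](subr0 s); apply: cvgB; first exact: cvg_cst.
    exact: cvg_harmonic.
  apply: (squeeze_cvgr _ l0 (cvg_cst s)).
  near=> k; have k0 : 0 < k.+1%:R :> R by rewrite ltr0n.
  have := floor_itv (k.+1%:R * s) => /andP[h1 h2].
  rewrite /q /harmonic /= ler_pdivlMr // ler_pdivrMr // mulrBl mulVf ?gt_eqF //.
  by rewrite [s * _]mulrC h1 andbT lerBlDr; rewrite intrD in h2; exact: ltW.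
Unshelve. all: by end_near. Qed.

Lemma RI_swap C (g : R -> R -> R) :
  (forall s, continuous (g s)) -> (forall r, continuous (g ^~ r)) ->
  (forall s r, `|g s r| <= C * (wgt s * wgt r)) ->
  RI (fun s => RI (g s)) = RI (fun r => RI (g ^~ r)).
Proof.
move=> cg1 cg2 gC.
have d1 s : rdom (C * wgt s) (g s).
  by split; [exact: continuous_measurable_fun|move=> r; rewrite -mulrA].
have d2 r : rdom (C * wgt r) (g ^~ r).
  split; first exact: continuous_measurable_fun.
  by move=> s; rewrite (le_trans (gC s r)) // [wgt s * _]mulrC mulrA.
have mg := measurable_separately_continuous cg1 cg2.
have ig : (mu \x mu)%E.-integrable setT (fun p : R * R => (g p.1 p.2)%:E).
  apply/integrable12ltyP; first exact/measurable_EFinP.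
  apply: (@le_lt_trans _ _ (\int[mu]_s ((C * pi) * wgt s)%:E)%E).
    apply: ge0_le_integral => //.
    - by move=> s _; apply: integral_ge0 => r _; rewrite lee_fin.
    - apply: (@measurable_fun_fubini_tonelli_F _ _ _ _ R mu
        (fun p : R * R => `|(g p.1 p.2)%:E|%E)) => //.
      by apply: measurableT_comp => //; exact/measurable_EFinP.
    - by apply/measurable_EFinP; exact: (rdomZ _ rdom_wgt).1.
    - move=> s _.
      have dn : rdom (C * wgt s) (fun r => `|g s r|).
        split; first by apply: measurableT_comp => //; exact: (d1 s).1.
        by move=> r; rewrite normr_id; exact: (d1 s).2.
      rewrite /= -(EFin_RI dn) lee_fin (le_trans (ler_norm _)) //.
      by rewrite (le_trans (RI_bound dn)) // mulrAC.
  by rewrite -(EFin_RI (rdomZ (C * pi) rdom_wgt)) ltry.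
have := Fubini ig => /=.
under eq_integral do rewrite -(EFin_RI (d1 _)).
under [RHS]eq_integral do rewrite -(EFin_RI (d2 _)).
by rewrite /RI /Rintegral /= => ->.
Qed.

End RealIntegral.

(** * Integration of complex-valued functions on the line *)

Section ComplexIntegral.
Context {R : realType}.
Implicit Types (a b C s t x : R) (c : R[i]).
Local Notation Re := complex.Re.
Local Notation Im := complex.Im.

Lemma seq_continuous (f : R -> R) :
  (forall (u : nat -> R) l, u @ \oo --> l -> (fun k => f (u k)) @ \oo --> f l) ->
  continuous f.
Proof.
move=> H x; apply/(@cvg_nbhsP R R^o).
exact: (fun u => H u x).
Qed.

Definition scont1 (h : R -> R[i]) : Prop :=
  forall (u : nat -> R) l, u @ \oo --> l -> cvgC (fun k => h (u k)) (h l).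

Lemma scont1_Re h : scont1 h -> continuous (fun s => Re (h s)).
Proof. by move=> ch; apply: seq_continuous => u l /ch []. Qed.

Lemma scont1_Im h : scont1 h -> continuous (fun s => Im (h s)).
Proof. by move=> ch; apply: seq_continuous => u l /ch []. Qed.

Lemma isD_scont1 (h : R -> R[i]) (dh : R -> R[i]) :
  (forall s, isD h s (dh s)) -> scont1 h.
Proof.
move=> hD u l ul; have [d1 d2] := hD l; split.
- apply: (@cvg_comp _ _ _ u (fun s => Re (h s)) _ _ _ ul).
  have : {for l, continuous (fun s => Re (h s))}; last exact.
  by apply: differentiable_continuous; apply/derivable1_diffP.
- apply: (@cvg_comp _ _ _ u (fun s => Im (h s)) _ _ _ ul).
  have : {for l, continuous (fun s => Im (h s))}; last exact.
  by apply: differentiable_continuous; apply/derivable1_diffP.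
Qed.

Definition cls1 C (h : R -> R[i]) : Prop :=
  scont1 h /\ forall s, normc (h s) <= C * wgt s.

Lemma cls1_Re C h : cls1 C h -> rdom C (fun s => Re (h s)).
Proof.
move=> [ch hC]; split; first exact: continuous_measurable_fun (scont1_Re ch).
by move=> s; rewrite (le_trans (Re_le_normc _)).
Qed.

Lemma cls1_Im C h : cls1 C h -> rdom C (fun s => Im (h s)).
Proof.
move=> [ch hC]; split; first exact: continuous_measurable_fun (scont1_Im ch).
by move=> s; rewrite (le_trans (Im_le_normc _)).
Qed.

Definition I1 (h : R -> R[i]) : R[i] :=
  RI (fun s => Re (h s)) +i* RI (fun s => Im (h s)).

Lemma I1_bound C h : cls1 C h -> normc (I1 h) <= 2 * pi * C.
Proof.
move=> hC; rewrite (le_trans (normc_le _)) //= -mulrA mulrDl mul1r [pi * C]mulrC.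
by rewrite lerD // RI_bound //; [exact: cls1_Re|exact: cls1_Im].
Qed.

Lemma cls1D C C' f g : cls1 C f -> cls1 C' g -> cls1 (C + C') (fun s => f s + g s).
Proof.
move=> [cf fC] [cg gC]; split.
  by move=> u l ul; apply: cvgCD; [exact: cf|exact: cg].
by move=> s; rewrite (le_trans (le_normcD _ _)) // mulrDl lerD.
Qed.

Lemma cls1Z c C f : cls1 C f -> cls1 (normc c * C) (fun s => c * f s).
Proof.
move=> [cf fC]; split.
  by move=> u l ul; apply: cvgCM; [exact: cvgC_cst|exact: cf].
by move=> s; rewrite normcM -mulrA ler_wpM2l // normc_ge0.
Qed.

Lemma I1D C C' f g : cls1 C f -> cls1 C' g ->
  I1 (fun s => f s + g s) = I1 f + I1 g.
Proof.
move=> fC gC; apply: complex_ext => /=.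
- by under [X in RI X]eq_fun do rewrite cReD; exact: RID (cls1_Re fC) (cls1_Re gC).
- by under [X in RI X]eq_fun do rewrite cImD; exact: RID (cls1_Im fC) (cls1_Im gC).
Qed.

Lemma I1Z c C f : cls1 C f -> I1 (fun s => c * f s) = c * I1 f.
Proof.
move=> fC; have f1 := cls1_Re fC; have f2 := cls1_Im fC.
case: c => a b; apply: complex_ext => /=.
- under [X in RI X]eq_fun do rewrite cReM /= -mulNr.
  by rewrite (RID (rdomZ a f1) (rdomZ (- b) f2)) (RIZ _ f1) (RIZ _ f2) mulNr.
- under [X in RI X]eq_fun do rewrite cImM /=.
  by rewrite (RID (rdomZ a f2) (rdomZ b f1)) (RIZ _ f1) (RIZ _ f2).
Qed.

Lemma I1_dct C (F : nat -> R -> R[i]) f :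
  (forall k, cls1 C (F k)) -> (forall s, cvgC (F ^~ s) (f s)) ->
  cvgC (fun k => I1 (F k)) (I1 f).
Proof.
move=> FC Ff; split => /=.
- apply: (@RI_dct R C (fun k s => Re (F k s))) => [k|s]; first exact: cls1_Re.
  exact: (Ff s).1.
- apply: (@RI_dct R C (fun k s => Im (F k s))) => [k|s]; first exact: cls1_Im.
  exact: (Ff s).2.
Qed.

Lemma I1_derive0 C C' f F : cls1 C f -> (forall s, isD F s (f s)) ->
  (forall s, normc (F s) <= C' * wgt s) -> I1 f = 0.
Proof.
move=> fC FD FC; apply: complex_ext => /=.
- apply: (@RI_derive0 R C C' _ (fun s => Re (F s))).
  + exact: scont1_Re fC.1.
  + exact: cls1_Re.
  + by move=> s; exact: (FD s).1.
  + by move=> s; rewrite (le_trans (Re_le_normc _)).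
- apply: (@RI_derive0 R C C' _ (fun s => Im (F s))).
  + exact: scont1_Im fC.1.
  + exact: cls1_Im.
  + by move=> s; exact: (FD s).2.
  + by move=> s; rewrite (le_trans (Im_le_normc _)).
Qed.

Lemma I1_affine C f a b : 0 < b -> cls1 C f ->
  I1 (fun s => f (a + b * s)) = (b^-1)%:C * I1 f.
Proof.
move=> b0 fC; apply: complex_ext => /=; rewrite !mul0r ?subr0 ?addr0.
- exact: (RI_affine a b0 (scont1_Re fC.1) (cls1_Re fC)).
- exact: (RI_affine a b0 (scont1_Im fC.1) (cls1_Im fC)).
Qed.

Lemma I1_swap C (g : R -> R -> R[i]) :
  (forall s, scont1 (g s)) -> (forall t, scont1 (g ^~ t)) ->
  (forall s t, normc (g s t) <= C * (wgt s * wgt t)) ->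
  I1 (fun s => I1 (g s)) = I1 (fun t => I1 (g ^~ t)).
Proof.
move=> c1 c2 gC; apply: complex_ext => /=.
- apply: (@RI_swap R C (fun s t => Re (g s t))).
  + by move=> s; exact: scont1_Re.
  + by move=> t; exact: scont1_Re (c2 t).
  + by move=> s t; rewrite (le_trans (Re_le_normc _)).
- apply: (@RI_swap R C (fun s t => Im (g s t))).
  + by move=> s; exact: scont1_Im.
  + by move=> t; exact: scont1_Im (c2 t).
  + by move=> s t; rewrite (le_trans (Im_le_normc _)).
Qed.

Lemma I1_0 : I1 (fun=> 0) = 0.
Proof.
have c0 : cls1 0 (fun=> 0).
  by split; [move=> u l _; exact: cvgC_cst|move=> s; rewrite normc0 mul0r].
by have := I1Z 0 c0; rewrite !mul0r.
Qed.

(** * Derivatives through difference quotients along sequences, and increment bounds *)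

Lemma is_derive_seq (f : R -> R) x d e : 0 < e ->
  (forall h : nat -> R, (forall k, h k != 0 /\ `|h k| < e) -> h @ \oo --> 0 ->
    (fun k => (h k)^-1 * (f (x + h k) - f x)) @ \oo --> d) ->
  is_derive x 1 f d.
Proof.
move=> e0 H.
have key (u : nat -> R) : (forall k, u k != 0) -> u @ \oo --> 0 ->
    (fun k => (u k)^-1 * (f (x + u k) - f x)) @ \oo --> d.
  move=> u0 uc.
  have ev : \forall k \near \oo, `|u k| < e.
    by move/cvgr0Pnorm_lt : uc; apply.
  (* The finitely many terms that are too large are replaced by the admissible value [e / 2], so
     that the hypothesis applies without changing the limit. *)
  pose v k := if `|u k| < e then u k else e / 2.
  have uv : \forall k \near \oo, v k = u k.
    by near=> k; rewrite /v ifT //; near: k.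
  have vc : v @ \oo --> 0.
    by apply: cvg_trans uc; apply: near_eq_cvg; near=> k; apply/esym; near: k.
  have := H v _ vc => /(_ _) K.
  apply: cvg_trans (K _); last first.
    move=> k; rewrite /v; case: ifPn => // _; split; first by rewrite gt_eqF // divr_gt0.
    by rewrite gtr0_norm ?divr_gt0 // ltr_pdivrMr // ltr_pMr // ltr1n.
  apply: near_eq_cvg; near=> k.
  by have -> : v k = u k by near: k.
have dq : (fun h => h^-1 *: (f (h *: (1 : R) + x) - f x)) @ 0^' --> d.
  apply: (@cvg_at_right_left_dnbhs R R^o).
  - apply/cvg_at_rightP => u [u0 uc].
    have := key u (fun k => _) uc => /(_ _) K.
    apply: cvg_trans (K _); last by move=> k; rewrite gt_eqF.
    by apply: near_eq_cvg; apply: filterE => k; rewrite /GRing.scale /= mulr1 [_ + x]addrC.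
  - apply/cvg_at_leftP => u [u0 uc].
    have := key u (fun k => _) uc => /(_ _) K.
    apply: cvg_trans (K _); last by move=> k; rewrite lt_eqF.
    by apply: near_eq_cvg; apply: filterE => k; rewrite /GRing.scale /= mulr1 [_ + x]addrC.
split; first by apply/cvg_ex; exists d.
exact/cvg_lim.
Unshelve. all: by end_near. Qed.

Lemma isD_seq (f : R -> R[i]) x d e : 0 < e ->
  (forall h : nat -> R, (forall k, h k != 0 /\ `|h k| < e) -> h @ \oo --> 0 ->
    cvgC (fun k => ((h k)^-1)%:C * (f (x + h k) - f x)) d) ->
  isD f x d.
Proof.
move=> e0 H; split.
- apply: (is_derive_seq e0) => h h0 hc; have [+ _] := H h h0 hc.
  by under eq_fun do rewrite cReM /= mul0r subr0 cReD cReN.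
- apply: (is_derive_seq e0) => h h0 hc; have [_ +] := H h h0 hc.
  by under eq_fun do rewrite cImM /= mul0r addr0 cImD cImN.
Qed.

Lemma isD_quot_cvg (f : R -> R[i]) x d (h : nat -> R) :
  isD f x d -> (forall k, h k != 0) -> h @ \oo --> 0 ->
  cvgC (fun k => ((h k)^-1)%:C * (f (x + h k) - f x)) d.
Proof.
have real (g : R -> R) l : is_derive x 1 g l -> (forall k, h k != 0) ->
    h @ \oo --> 0 -> (fun k => (h k)^-1 * (g (x + h k) - g x)) @ \oo --> l.
  move=> gd h0 hc.
  have gl : (fun h => h^-1 *: (g (h *: (1 : R) + x) - g x)) @ 0^' --> l.
    by case: gd => gd <-.
  have hd : h @ \oo --> 0^'.
    move=> A [e e0 /= eA]; have := hc => /cvgr0Pnorm_lt /(_ e e0).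
    apply: filterS => k hk /=; apply: eA => //=.
    by rewrite sub0r normrN.
  have := cvg_comp _ _ hd gl; apply: cvg_trans; apply: near_eq_cvg.
  by apply: filterE => k; rewrite /= /GRing.scale /= mulr1 [_ + x]addrC.
move=> [d1 d2] h0 hc; split.
- under eq_fun do rewrite cReM /= mul0r subr0 cReD cReN.
  exact: (real _ _ d1).
- under eq_fun do rewrite cImM /= mul0r addr0 cImD cImN.
  exact: (real _ _ d2).
Unshelve. all: by end_near. Qed.

(* The factor 2 comes from applying the real mean value theorem to the real and
   imaginary parts. *)
Lemma isD_increment (f df : R -> R[i]) a b M : a <= b ->
  (forall t, t \in `]a, b[%R -> isD f t (df t)) ->
  {within `[a, b], continuous (fun t => Re (f t))} ->
  {within `[a, b], continuous (fun t => Im (f t))} ->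
  (forall t, t \in `]a, b[%R -> normc (df t) <= M) ->
  normc (f b - f a) <= 2 * M * (b - a).
Proof.
rewrite le_eqVlt => /orP[/eqP <-|ab] fD c1 c2 fM.
  by rewrite !subrr normc0 mulr0.
have [t1 t1ab e1] := MVT ab (fun t h => (fD t h).1) c1.
have [t2 t2ab e2] := MVT ab (fun t h => (fD t h).2) c2.
rewrite (le_trans (normc_le _)) // cReD cReN cImD cImN e1 e2 !normrM.
rewrite (gtr0_norm (_ : 0 < b - a)) ?subr_gt0 // -mulrDl.
rewrite ler_wpM2r ?subr_ge0 ?(ltW ab) // mulr_natl mulr2n lerD //.
- exact: le_trans (Re_le_normc _) (fM _ t1ab).
- exact: le_trans (Im_le_normc _) (fM _ t2ab).
Qed.

Lemma isD_increment_cc (f df : R -> R[i]) a b M : a <= b ->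
  (forall t, t \in `[a, b]%R -> isD f t (df t)) ->
  (forall t, t \in `[a, b]%R -> normc (df t) <= M) ->
  normc (f b - f a) <= 2 * M * (b - a).
Proof.
move=> ab fD fM; apply: (@isD_increment f df) => //.
- by move=> t /subset_itv_oo_cc; exact: fD.
- by apply: derivable_within_continuous => t /fD [].
- by apply: derivable_within_continuous => t /fD [].
- by move=> t /subset_itv_oo_cc; exact: fM.
Qed.

Lemma isD_increment_ball (f df : R -> R[i]) a b M :
  (forall t, `|t - a| <= `|b - a| -> isD f t (df t)) ->
  (forall t, `|t - a| <= `|b - a| -> normc (df t) <= M) ->
  normc (f b - f a) <= 2 * M * `|b - a|.
Proof.
move=> fD fM.
have [ab|ba] := leP a b.
  have H t : t \in `[a, b]%R -> `|t - a| <= `|b - a|.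
    by rewrite in_itv /= => /andP[h1 h2]; rewrite !ger0_norm ?subr_ge0 // lerD2r.
  rewrite ger0_norm ?subr_ge0 //.
  by apply: (@isD_increment_cc f df) => // t /H; [exact: fD|exact: fM].
have H t : t \in `[b, a]%R -> `|t - a| <= `|b - a|.
  rewrite in_itv /= => /andP[h1 h2]; rewrite !ler0_norm ?subr_le0 //; last exact: ltW.
  by rewrite lerN2 lerD2r.
rewrite normcB ltr0_norm ?subr_lt0 // opprB.
by apply: (@isD_increment_cc f df); [exact: ltW|move=> t /H; exact: fD|move=> t /H; exact: fM].
Qed.

End ComplexIntegral.

(** * Iterated integrals *)

Section IteratedIntegral.
Context {R : realType}.
Local Notation env := (nat -> R).
Implicit Types (l L : seq nat) (e : env) (F G : env -> R[i]) (C s t : R).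
Local Notation Re := complex.Re.
Local Notation Im := complex.Im.

Definition upd e (k : nat) s : env := fun j => if j == k then s else e j.

Lemma upd_eq e k s : upd e k s k = s. Proof. by rewrite /upd eqxx. Qed.

Lemma upd_upd e k s t : upd (upd e k s) k t = upd e k t.
Proof. by apply/funext => j; rewrite /upd; case: eqP. Qed.

Lemma upd_same e k : upd e k (e k) = e.
Proof. by apply/funext => j; rewrite /upd; case: eqP => // ->. Qed.

Lemma upd_comm e k k' s t : k != k' ->
  upd (upd e k s) k' t = upd (upd e k' t) k s.
Proof.
move=> kk'; apply/funext => j; rewrite /upd.
by case: (eqVneq j k') => // ->; rewrite eq_sym (negbTE kk').
Qed.

(* Several real variables are coordinates of one environment [nat -> R]; the
   list says which coordinates are integrated, the others are parameters. *)
Fixpoint Ints l F e : R[i] :=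
  if l is k :: l' then I1 (fun s => Ints l' F (upd e k s)) else F e.

Definition econv (u : nat -> env) e : Prop :=
  forall j, (fun k => u k j) @ \oo --> e j.

Definition scont F : Prop :=
  forall u e, econv u e -> cvgC (fun k => F (u k)) (F e).

Definition wprod l e : R := \prod_(j <- l) wgt (e j).

Definition cls l C F : Prop := scont F /\ forall e, normc (F e) <= C * wprod l e.

Lemma wprod_ge0 l e : 0 <= wprod l e.
Proof. by apply: prodr_ge0 => j _; exact: wgt_ge0. Qed.

Lemma wprod_gt0 l e : 0 < wprod l e.
Proof. by apply: prodr_gt0 => j _; exact: wgt_gt0. Qed.

Lemma prod_normc_le l (h : nat -> R[i]) (c v : nat -> R) :
  (forall j, normc (h j) <= c j * wgt (v j)) ->
  normc (\prod_(j <- l) h j) <= (\prod_(j <- l) c j) * wprod l v.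
Proof.
move=> hc; rewrite normc_prod /wprod -big_split.
by apply: ler_prod => j _; rewrite normc_ge0 hc.
Qed.

Lemma wprod_le1 l e : wprod l e <= 1.
Proof.
rewrite /wprod; elim: l => [|k l IH]; first by rewrite big_nil.
by rewrite big_cons mulr_ile1 ?wgt_ge0 ?wgt_le1 ?wprod_ge0.
Qed.

Lemma wprod_cons k l e : wprod (k :: l) e = wgt (e k) * wprod l e.
Proof. by rewrite /wprod big_cons. Qed.

Lemma wprod_upd k l e s : k \notin l -> wprod l (upd e k s) = wprod l e.
Proof.
move=> kl; apply: eq_big_seq => j jl; rewrite /upd.
by case: eqP => // jk; rewrite -jk jl in kl.
Qed.

Lemma cls_ge0 l C F : cls l C F -> 0 <= C.
Proof.
move=> [_ /(_ (fun=> 0))]; rewrite /wprod big1; last first.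
  by move=> i _; rewrite /wgt expr0n addr0 invr1.
by rewrite mulr1; exact: le_trans (normc_ge0 _).
Qed.

Lemma cls_perm l l' C F : perm_eq l l' -> cls l C F -> cls l' C F.
Proof.
by move=> ll' [cF FC]; split=> // e; rewrite /wprod -(perm_big _ ll').
Qed.

Lemma cls_behead k l C F : cls (k :: l) C F -> cls l C F.
Proof.
move=> FC; have [c b] := FC; split=> // e.
rewrite (le_trans (b e)) // wprod_cons ler_wpM2l ?(cls_ge0 FC) //.
by rewrite ler_piMl ?wprod_ge0 // wgt_le1.
Qed.

Lemma cls_le l C C' F : C <= C' -> cls l C F -> cls l C' F.
Proof.
move=> CC' [cF FC]; split=> // e; rewrite (le_trans (FC e)) //.
by rewrite ler_wpM2r // wprod_ge0.
Qed.

Lemma econv_upd u e k (v : nat -> R) s : econv u e -> v @ \oo --> s ->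
  econv (fun i => upd (u i) k (v i)) (upd e k s).
Proof. by move=> ue vs j; rewrite /upd; case: eqP => _; [exact: vs|exact: ue]. Qed.

Lemma econv_cst e : econv (fun=> e) e. Proof. by move=> j; exact: cvg_cst. Qed.

Lemma cls_section k l C F e : k \notin l -> cls (k :: l) C F ->
  cls1 (C * wprod l e) (fun s => F (upd e k s)).
Proof.
move=> kl [cF FC]; split.
  by move=> u s us; apply: cF; apply: econv_upd => //; exact: econv_cst.
move=> s; rewrite (le_trans (FC _)) // wprod_cons upd_eq wprod_upd //.
by rewrite [wgt s * _]mulrC mulrA.
Qed.

Lemma cls_I1 k l C F : k \notin l -> cls (k :: l) C F ->
  cls l (2 * pi * C) (fun e => I1 (fun s => F (upd e k s))).
Proof.
move=> kl FC; have C0 := cls_ge0 FC; split.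
- move=> u e ue; apply: (@I1_dct R C) => [i|s].
    have [c b] := cls_section (u i) kl FC; split=> // s.
    by rewrite (le_trans (b s)) // ler_wpM2r ?wgt_ge0 // ler_piMr // wprod_le1.
  by apply: FC.1; apply: econv_upd => //; exact: cvg_cst.
- by move=> e; rewrite -mulrA; apply: I1_bound; exact: cls_section.
Qed.

Lemma perm_mid (a b : seq nat) k : perm_eq (a ++ k :: b) (k :: a ++ b).
Proof. by have := perm_catCA a [:: k] b (k :: a ++ b); rewrite /= perm_refl. Qed.

Lemma cls_Ints l l' C F : uniq (l ++ l') -> cls (l ++ l') C F ->
  cls l' ((2 * pi) ^+ size l * C) (Ints l F).
Proof.
elim: l l' => [|k l IH] l' /=; first by rewrite expr0 mul1r.
move=> /andP[kll' ull'] FC.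
have p := perm_mid l l' k.
have u : uniq (l ++ k :: l') by rewrite (perm_uniq p) /= kll'.
rewrite exprS -mulrA; apply: cls_I1.
  by apply: contra kll'; rewrite mem_cat orbC => ->.
by apply: IH => //; apply: cls_perm FC; rewrite perm_sym.
Qed.

Lemma Ints_bound l C F e : uniq l -> cls l C F ->
  normc (Ints l F e) <= (2 * pi) ^+ size l * C.
Proof.
move=> ul FC; have [] := @cls_Ints l [::] C F; rewrite ?cats0 //.
by move=> _ /(_ e); rewrite /wprod big_nil mulr1.
Qed.

Lemma cls_Ints_section k l C F e : k \notin l -> uniq l -> cls (k :: l) C F ->
  cls1 ((2 * pi) ^+ size l * C) (fun s => Ints l F (upd e k s)).
Proof.
move=> kl ul FC; have p : perm_eq (l ++ [:: k]) (k :: l) by rewrite cats1 perm_rcons.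
have FC' : cls (l ++ [:: k]) C F by apply: cls_perm FC; rewrite perm_sym.
have H := cls_Ints _ FC'; have {}H : cls [:: k] ((2 * pi) ^+ size l * C) (Ints l F).
  by apply: H; rewrite (perm_uniq p) /= kl.
have := @cls_section k [::] _ _ e isT H.
by rewrite /wprod big_nil mulr1.
Qed.

Lemma Ints_dct l C (F : nat -> env -> R[i]) f e : uniq l ->
  (forall i, cls l C (F i)) -> (forall e, cvgC (fun i => F i e) (f e)) ->
  cvgC (fun i => Ints l (F i) e) (Ints l f e).
Proof.
elim: l e C F f => [|k l IH] e C F f /=; first by move=> _ _; exact.
move=> /andP[kl ul] FC Ff.
apply: (@I1_dct R ((2 * pi) ^+ size l * C)) => [i|s].
  exact: cls_Ints_section.
by apply: (IH _ C) => // i; exact: cls_behead.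
Qed.

(** Two starting environments are allowed so that a change of the parameters can be compensated by a
    change of the integrand, as when the variables that are not integrated get frozen. *)
Lemma Ints_ext l F G e e' :
  (forall a b, (forall j, j \in l -> a j = b j) ->
     (forall j, j \notin l -> a j = e j /\ b j = e' j) -> F a = G b) ->
  Ints l F e = Ints l G e'.
Proof.
elim: l e e' => [|k l IH] e e' H /=; first by apply: H.
congr I1; apply/funext => s; apply: IH => a b ab ne; apply: H => j.
- rewrite inE; have [jl _|jl] := boolP (j \in l); first exact: ab.
  by rewrite orbF => /eqP jk; have [-> ->] := ne j jl; rewrite /upd jk eqxx.
- rewrite inE negb_or => /andP[jk jl]; have [-> ->] := ne j jl.
  by rewrite /upd (negbTE jk).
Qed.

Lemma IntsD l C C' F G e : uniq l -> cls l C F -> cls l C' G ->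
  Ints l (fun e => F e + G e) e = Ints l F e + Ints l G e.
Proof.
elim: l e C C' => [//|k l IH] e C C' /= /andP[kl ul] FC GC.
rewrite -(I1D (cls_Ints_section e kl ul FC) (cls_Ints_section e kl ul GC)).
by congr I1; apply/funext => s; rewrite (IH _ C C') //;
  [exact: cls_behead FC|exact: cls_behead GC].
Qed.

Lemma IntsZ l C c F e : uniq l -> cls l C F ->
  Ints l (fun e => c * F e) e = c * Ints l F e.
Proof.
elim: l e C => [//|k l IH] e C /= /andP[kl ul] FC.
rewrite -(I1Z c (cls_Ints_section e kl ul FC)).
by congr I1; apply/funext => s; rewrite (IH _ C) //; exact: cls_behead FC.
Qed.

Lemma clsD l C C' F G : cls l C F -> cls l C' G -> cls l (C + C') (fun e => F e + G e).
Proof.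
move=> [cF FC] [cG GC]; split.
  by move=> u e ue; apply: cvgCD; [exact: cF|exact: cG].
by move=> e; rewrite (le_trans (le_normcD _ _)) // mulrDl lerD.
Qed.

Lemma clsZ l C c F : cls l C F -> cls l (normc c * C) (fun e => c * F e).
Proof.
move=> [cF FC]; split.
  by move=> u e ue; apply: cvgCM; [exact: cvgC_cst|exact: cF].
by move=> e; rewrite normcM -mulrA ler_wpM2l // normc_ge0.
Qed.

Lemma Ints_cat l l' F e : Ints (l ++ l') F e = Ints l (Ints l' F) e.
Proof. by elim: l e => [//|k l IH] e /=; congr I1; apply/funext => s. Qed.

Lemma Ints_swap k k' l C F e : uniq [:: k, k' & l] -> cls [:: k, k' & l] C F ->
  Ints [:: k, k' & l] F e = Ints [:: k', k & l] F e.
Proof.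
move=> u FC; have kk' : k != k' by move: u; rewrite /= inE negb_or => /andP[/andP[]].
have p : perm_eq (l ++ [:: k; k']) [:: k, k' & l] by rewrite perm_catC.
have FC' : cls (l ++ [:: k; k']) C F by apply: cls_perm FC; rewrite perm_sym.
have [cG GC] : cls [:: k; k'] ((2 * pi) ^+ size l * C) (Ints l F).
  by apply: cls_Ints => //; rewrite (perm_uniq p).
have sc j e0 : scont1 (fun t => Ints l F (upd e0 j t)).
  by move=> v s vs; apply: cG; apply: econv_upd => //; exact: econv_cst.
rewrite /= (@I1_swap R ((2 * pi) ^+ size l * C)).
- congr I1; apply/funext => t; congr I1; apply/funext => s.
  by rewrite upd_comm.
- by move=> s; exact: sc.
- by move=> t; under eq_fun do rewrite upd_comm //; exact: sc.
- move=> s t; rewrite (le_trans (GC _)) // !wprod_cons /wprod big_nil mulr1.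
  by rewrite upd_eq upd_comm // upd_eq.
Qed.

Lemma Ints_front a k b C F e : uniq (a ++ k :: b) -> cls (a ++ k :: b) C F ->
  Ints (a ++ k :: b) F e = Ints (k :: a ++ b) F e.
Proof.
elim: a e C => [//|x a IH] e C u FC.
have p : perm_eq (x :: a ++ k :: b) [:: x, k & a ++ b].
  by rewrite perm_cons perm_mid.
rewrite cat_cons -(@Ints_swap x k (a ++ b) C).
- rewrite /=; congr I1; apply/funext => s; rewrite (IH _ C) //.
    by move: u => /andP[].
  exact: cls_behead FC.
- by rewrite -(perm_uniq p).
- exact: cls_perm p FC.
Qed.

Lemma Ints_perm l l' C F e : perm_eq l l' -> uniq l -> cls l C F ->
  Ints l F e = Ints l' F e.
Proof.
elim: l' l e C => [|k l' IH] l e C.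
  by move=> /perm_nilP ->.
move=> p ul FC; have kl : k \in l by rewrite (perm_mem p) mem_head.
move: p ul FC; case/splitPr: kl => a b p u FC.
have p' : perm_eq (a ++ b) l'.
  by rewrite -(perm_cons k) (perm_trans _ p) // perm_sym perm_mid.
have u' : uniq (a ++ b).
  by move: u; rewrite (perm_uniq (perm_mid a b k)) => /andP[].
rewrite (Ints_front _ u FC) /=; congr I1; apply/funext => s; apply: (IH _ _ C) => //.
by apply: cls_behead (cls_perm _ FC); exact: perm_mid.
Qed.

Lemma Ints_0 l e : Ints l (fun=> 0) e = 0.
Proof.
elim: l e => [//|k l IH] e /=; rewrite -[RHS](@I1_0 R).
by congr I1; apply/funext => s.
Qed.

(** Fubini moves the variable [k] to the innermost place, where the one-variable integral of a
    derivative already vanishes. *)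
Lemma Ints_derive0 k l C C' F dF e : k \in l -> uniq l -> cls l C dF ->
  (forall e, isD (fun s => F (upd e k s)) (e k) (dF e)) ->
  (forall e, normc (F e) <= C' * wprod l e) -> Ints l dF e = 0.
Proof.
move=> kl; case/splitPr: kl => a b ul dFC FD FC.
have p : perm_eq (a ++ k :: b) ((a ++ b) ++ [:: k]).
  by rewrite -catA perm_cat2l cats1 perm_sym perm_rcons.
rewrite (Ints_perm _ p ul dFC) Ints_cat -[RHS](Ints_0 (a ++ b) e).
congr Ints; apply/funext => e' /=.
have C'0 : 0 <= C'.
  by rewrite -(pmulr_lge0 _ (wprod_gt0 (a ++ k :: b) e)) (le_trans _ (FC e)) ?normc_ge0.
have w D s : 0 <= D -> D * wprod (a ++ k :: b) (upd e' k s) <= D * wgt s.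
  move=> D0; rewrite ler_wpM2l // /wprod (perm_big _ p) big_cat big_seq1 /=.
  by rewrite upd_eq ler_piMl ?wgt_ge0 // wprod_le1.
apply: (@I1_derive0 R C C' _ (fun s => F (upd e' k s))).
- split; last by move=> s; rewrite (le_trans (dFC.2 _)) // w // (cls_ge0 dFC).
  by move=> u s us; apply: dFC.1; apply: econv_upd => //; exact: econv_cst.
- move=> s; have := FD (upd e' k s); rewrite upd_eq.
  by under eq_fun do rewrite upd_upd.
- by move=> s; rewrite (le_trans (FC _)) // w.
Qed.

(** Differentiation under the integral: the increment bound dominates the difference quotients by
    [2 * C'] times the weight, uniformly along any sequence of steps below [eps], and dominated
    convergence does the rest. *)
Lemma Ints_isD l C C' (F dF : R -> env -> R[i]) t0 eps e : 0 < eps -> uniq l ->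
  (forall t, `|t - t0| < eps -> cls l C (F t)) ->
  (forall t e, `|t - t0| < eps -> isD (F ^~ e) t (dF t e)) ->
  (forall t e, `|t - t0| < eps -> normc (dF t e) <= C' * wprod l e) ->
  isD (fun t => Ints l (F t) e) t0 (Ints l (dF t0) e).
Proof.
move=> eps0 ul FC FD dFC; apply: (isD_seq eps0) => h h0 hc.
have t00 : `|t0 - t0| < eps by rewrite subrr normr0.
have th k : `|t0 + h k - t0| < eps by rewrite addrC addKr (h0 k).2.
have FN := clsZ (-1) (FC _ t00).
have -> : (fun k => ((h k)^-1)%:C * (Ints l (F (t0 + h k)) e - Ints l (F t0) e)) =
   (fun k => Ints l (fun e => ((h k)^-1)%:C * (F (t0 + h k) e + -1 * F t0 e)) e).
  apply/funext => k; rewrite (IntsZ _ _ ul (clsD (FC _ (th k)) FN)).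
  by rewrite (IntsD _ ul (FC _ (th k)) FN) (IntsZ _ _ ul (FC _ t00)) mulN1r.
apply: (@Ints_dct l (2 * C')) => // [k|e'].
- split; first exact: (clsZ _ (clsD (FC _ (th k)) FN)).1.
  move=> e'; rewrite mulN1r normcM normcR normfV.
  rewrite ler_pdivrMl ?normr_gt0 ?(h0 k).1 // mulrC.
  have -> : `|h k| = `|t0 + h k - t0| by rewrite addrC addKr.
  have tt t : `|t - t0| <= `|t0 + h k - t0| -> `|t - t0| < eps.
    by move=> H; exact: le_lt_trans H (th k).
  rewrite -[_ * _ * _ in leRHS]mulrA.
  apply: (@isD_increment_ball R (F ^~ e') (fun t => dF t e')) => t /tt tt0.
  + exact: FD.
  + exact: dFC.
- under eq_fun do rewrite mulN1r.
  apply: (@isD_quot_cvg R (F ^~ e')) => // [|k]; first exact: FD.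
  exact: (h0 k).1.
Qed.

Lemma Ints_prod l (g : nat -> R -> R[i]) c C e : uniq l ->
  (forall k, cls1 C (g k)) ->
  Ints l (fun e => c * \prod_(k <- l) g k (e k)) e = c * \prod_(k <- l) I1 (g k).
Proof.
move=> + gC; elim: l c e => [|k l IH] c e /=; first by rewrite !big_nil.
move=> /andP[kl ul].
have -> : (fun s => Ints l (fun e0 => c * \prod_(j <- k :: l) g j (e0 j)) (upd e k s)) =
    (fun s => (c * \prod_(j <- l) I1 (g j)) * g k s).
  apply/funext => s.
  rewrite -[RHS]mulrAC -(IH _ (upd e k s) ul); apply: Ints_ext => a b ab ne.
  rewrite big_cons mulrA; have [-> _] := ne k kl; rewrite upd_eq; congr (_ * _).
  by apply: eq_big_seq => j /ab ->.
by rewrite (I1Z _ (gC k)) big_cons -mulrA [I1 (g k) * _]mulrC.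
Qed.

Lemma Ints_affine l C F (x e : env) b : 0 < b -> uniq l -> cls l C F ->
  Ints l (fun e => F (fun j => if j \in l then x j + b * e j else e j)) e =
  (b^-1 ^+ size l)%:C * Ints l F e.
Proof.
move=> b0; elim: l C e => [|k l IH] C e.
  by move=> _ _; rewrite expr0 mul1r.
move=> /= /andP[kl ul] FC.
have -> : (fun s => Ints l (fun e0 => F (fun j => if j \in k :: l
      then x j + b * e0 j else e0 j)) (upd e k s)) =
    (fun s => (b^-1 ^+ size l)%:C * Ints l F (upd e k (x k + b * s))).
  apply/funext => s; rewrite -(IH C _ ul (cls_behead FC)).
  apply: Ints_ext => a c ac ne; congr F; apply/funext => j.
  rewrite inE; have [jl|jl] := boolP (j \in l); first by rewrite orbT ac.
  rewrite orbF; have [-> ->] := ne j jl; rewrite /upd.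
  by case: eqP => [->|].
have sC := cls_Ints_section e kl ul FC.
rewrite (I1Z _ (C := (2 * pi) ^+ size l * C * (1 + 2 * (1 + x k ^+ 2) / b ^+ 2))).
  by rewrite (I1_affine (x k) b0 sC) mulrA -rmorphM /= exprSr.
have [c1 c2] := sC; split.
  move=> u s us; apply: c1; apply: cvgD; first exact: cvg_cst.
  by apply: cvgMr.
move=> s; rewrite (le_trans (c2 _)) // -[leRHS]mulrA ler_wpM2l ?wgt_affine //.
rewrite mulr_ge0 ?exprn_ge0 ?mulr_ge0 ?pi_ge0 ?(cls_ge0 FC) //.
Qed.

End IteratedIntegral.

(** * The Gaussian and its Fourier transform *)

Section Gaussian.
Context {R : realType}.
Implicit Types (a b s t w : R).
Local Notation Re := complex.Re.
Local Notation Im := complex.Im.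

(** Half of the quadratic term absorbs the linear one, [b * |s| <= b ^+ 2 / (2 * a) + a / 2 * s ^+
    2]; the other half is compared with the weight through [1 + x <= expR x]. *)
Lemma gauss_dom a b : 0 < a ->
  exists C, forall s, expR (- a * s ^+ 2 + b * `|s|) <= C * wgt s.
Proof.
move=> a0; exists (expR (b ^+ 2 / (2 * a)) * (1 + 2 / a)) => s.
have h1 : - a * s ^+ 2 + b * `|s| <= b ^+ 2 / (2 * a) + - (a / 2 * s ^+ 2).
  rewrite -subr_ge0.
  have -> : b ^+ 2 / (2 * a) + - (a / 2 * s ^+ 2) - (- a * s ^+ 2 + b * `|s|) =
     (a * `|s| - b) ^+ 2 / (2 * a).
    by rewrite -[s ^+ 2]real_normK ?num_real //; field; rewrite gt_eqF.
  by rewrite divr_ge0 ?sqr_ge0 // mulr_ge0 // ltW.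
rewrite (le_trans (_ : _ <= expR (b ^+ 2 / (2 * a) + - (a / 2 * s ^+ 2)))) //.
  by rewrite ler_expR.
rewrite expRD -[leRHS]mulrA ler_wpM2l ?expR_ge0 // expRN ler_pdivlMr ?oneDsqr_gt0 //.
rewrite mulrC ler_pdivrMr ?expR_gt0 //.
have h2 : 1 + a / 2 * s ^+ 2 <= expR (a / 2 * s ^+ 2) by exact: expR_ge1Dx.
have a2 : 0 <= 2 / a by rewrite divr_ge0 // ltW.
apply: (@le_trans _ _ ((1 + 2 / a) * (1 + a / 2 * s ^+ 2))); last first.
  by rewrite ler_wpM2l // addr_ge0.
have -> : (1 + 2 / a) * (1 + a / 2 * s ^+ 2) =
  1 + s ^+ 2 + (2 / a + a / 2 * s ^+ 2) by field; rewrite gt_eqF.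
by rewrite lerDl addr_ge0 // mulr_ge0 ?sqr_ge0 // divr_ge0 // ltW.
Qed.

Definition gauss s : R[i] := (expR (- s ^+ 2))%:C.

Lemma normc_gauss s : normc (gauss s) = expR (- s ^+ 2).
Proof. by rewrite normcR ger0_norm // expR_ge0. Qed.

Lemma gauss_le_wgt s : expR (- s ^+ 2) <= wgt s.
Proof.
by rewrite expRN /wgt lef_pV2 ?posrE ?expR_gt0 ?oneDsqr_gt0 // expR_ge1Dx.
Qed.

Lemma isD_gauss s : isD gauss s ((- (2 * s))%:C * gauss s).
Proof.
rewrite -rmorphM; apply: isDR; apply: is_derive_eq.
by rewrite /GRing.scale /=; ring.
Qed.

Lemma scont1_gauss : scont1 gauss.
Proof. exact: isD_scont1 isD_gauss. Qed.

Lemma cls1_gauss : cls1 1 gauss.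
Proof.
split; first exact: scont1_gauss.
by move=> s; rewrite mul1r normc_gauss gauss_le_wgt.
Qed.

Lemma isD_linear (c : R[i]) s : isD (fun t => c * t%:C) s c.
Proof.
rewrite -[X in isD _ _ X]mulr1; apply: isDZ.
by apply: (@isDR _ id); exact: is_derive_id.
Qed.

Lemma isD_wave w s : isD (fun t => cexp ('i * (w * t)%:C)) s
  ('i * w%:C * cexp ('i * (w * s)%:C)).
Proof.
apply: isD_cexp; have := isD_linear ('i * w%:C) s.
by under eq_fun do rewrite -mulrA -rmorphM.
Qed.

Definition cis t : R[i] := cexp ('i * t%:C).

Lemma cisD s t : cis (s + t) = cis s * cis t.
Proof. by rewrite /cis rmorphD mulrDr cexpD. Qed.

Lemma cis0 : cis 0 = 1. Proof. by rewrite /cis mulr0 cexp0. Qed.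

Lemma cis_sum (I : Type) (r : seq I) (f : I -> R) :
  \prod_(i <- r) cis (f i) = cis (\sum_(i <- r) f i).
Proof.
elim: r => [|i r IH]; first by rewrite !big_nil cis0.
by rewrite !big_cons cisD IH.
Qed.

Lemma cvgC_cis (u : nat -> R) t : u @ \oo --> t -> cvgC (fun k => cis (u k)) (cis t).
Proof.
move=> ut; apply: cvgC_cexp; apply: cvgCM; first exact: cvgC_cst.
exact: cvgCR.
Qed.

Lemma normc_wave t : normc (cexp ('i * t%:C)) = 1 :> R.
Proof. by rewrite normc_cexp /= !mul0r mulr0 subr0 expR0. Qed.

Lemma normc_cis t : normc (cis t) = 1. Proof. exact: normc_wave. Qed.

Definition gaussFT w : R[i] := I1 (fun t => gauss t * cexp ('i * (w * t)%:C)).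

(** Differentiating under the integral brings down a factor ['i * t]. As [- 2 * t * gauss t] is the
    derivative of [gauss], integration by parts turns that factor into a multiple of [w]. *)
Lemma gaussFT_deriv w : isD gaussFT w (- (w / 2)%:C * gaussFT w).
Proof.
have [C hC] := gauss_dom 1 (ltr01 : 0 < 1 :> R).
have dom1 s : `|s| * expR (- s ^+ 2) <= C * wgt s.
  have := hC s; rewrite mul1r expRD mulrC mulN1r; apply: le_trans.
  rewrite ler_wpM2r ?expR_ge0 //.
  by rewrite (le_trans _ (expR_ge1Dx _)) // lerDr.
pose F (v : R) (e : nat -> R) : R[i] := gauss (e 0%N) * cexp ('i * (v * e 0%N)%:C).
pose dF (v : R) (e : nat -> R) : R[i] := ('i * (e 0%N)%:C) * F v e.
have sc v : scont (F v).
  move=> u e ue; apply: cvgCM; first exact: scont1_gauss (ue 0%N).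
  apply: cvgC_cexp; apply: cvgCM; first exact: cvgC_cst.
  by apply: cvgCR; apply: cvgMr; exact: ue.
have nF v e : normc (F v e) = expR (- (e 0%N) ^+ 2).
  by rewrite normcM normc_gauss normc_wave mulr1.
have wE e : wprod [:: 0%N] e = wgt (e 0%N) by rewrite /wprod big_seq1.
(* The one-variable integral is read as an iterated integral over the list [[:: 0]], where
   differentiation under the integral is available. *)
have := @Ints_isD R [:: 0%N] 1 C F dF w 1 (fun=> 0) ltr01 isT.
move=> /(_ _ _ _) /=.
have -> : (fun t : R => I1 (fun s => F t (upd (fun=> 0) 0%N s))) = gaussFT.
  by apply/funext => t; congr I1; apply/funext => s; rewrite /F !upd_eq.
have -> : I1 (fun s => dF w (upd (fun=> 0) 0%N s)) = - (w / 2)%:C * gaussFT w.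
  have c0 : cls1 1 (fun t => gauss t * cexp ('i * (w * t)%:C)).
    split; last by move=> s; rewrite normcM normc_wave mulr1 normc_gauss mul1r gauss_le_wgt.
    move=> u l ul; apply: cvgCM; first exact: scont1_gauss.
    by apply: (isD_scont1 (isD_wave w)).
  have c1 : cls1 C (fun t => t%:C * (gauss t * cexp ('i * (w * t)%:C))).
    split.
      move=> u l ul; apply: cvgCM; last exact: c0.1.
      exact: cvgCR.
    by move=> s; rewrite !normcM normc_wave mulr1 normc_gauss normcR.
  set X := gaussFT w; pose Y := I1 (fun t => t%:C * (gauss t * cexp ('i * (w * t)%:C))).
  have : 'i * w%:C * X + (- 2%:C) * Y = 0.
    rewrite -(I1Z _ c0) -(I1Z _ c1) -(I1D (cls1Z _ c0) (cls1Z _ c1)).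
    apply: (@I1_derive0 R _ 1 _ (fun t => gauss t * cexp ('i * (w * t)%:C))).
    - exact: cls1D (cls1Z _ c0) (cls1Z _ c1).
    - move=> s; have := isDM (isD_gauss s) (isD_wave w s).
      by congr isD; rewrite rmorphN rmorphM /=; ring.
    - exact: c0.2.
  move=> XY; have -> : I1 (fun s => dF w (upd (fun=> 0) 0%N s)) = 'i * Y.
    rewrite -(I1Z _ c1); congr I1; apply/funext => s.
    by rewrite /dF /F !upd_eq mulrA.
  have -> : Y = 'i * (w / 2)%:C * X.
    have two : 2%:C != 0 :> R[i] by rewrite eq_complex /= pnatr_eq0.
    apply: (mulfI two); move: XY; rewrite mulNr => /eqP; rewrite subr_eq0 => /eqP <-.
    have e : w%:C = 2%:C * (w / 2)%:C :> R[i].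
      by rewrite -rmorphM; congr (_%:C); field.
    by rewrite e; ring.
  by rewrite !mulrA -expr2 sqr_i mulN1r.
apply.
- move=> t _; split; first exact: sc.
  by move=> e; rewrite nF mul1r wE gauss_le_wgt.
- move=> t e _; have := isDZ (gauss (e 0%N)) (isD_wave (e 0%N) t).
  under eq_fun do rewrite [e 0%N * _]mulrC.
  by rewrite /dF /F [t * _]mulrC mulrCA.
- by move=> t e _; rewrite normcM nF normcM normci mul1r normcR wE.
Qed.

(** The differential equation makes [gaussFT t * expR (t ^+ 2 / 4)] constant; its value at 0 is the
    Gaussian integral. *)
Lemma gaussFTE w : gaussFT w = (Num.sqrt pi * expR (- (w ^+ 2 / 4)))%:C.
Proof.
have g0 : gaussFT 0 = (Num.sqrt pi)%:C.
  rewrite /gaussFT; have -> : (fun t => gauss t * cexp ('i * (0 * t)%:C)) = gauss.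
    by apply/funext => t; rewrite mul0r mulr0 cexp0 mulr1.
  apply: complex_ext => /=; last first.
    have := RIZ 0 (@rdom_wgt R); rewrite !mul0r.
    by under eq_fun do rewrite mul0r.
  by rewrite /RI /Rintegral; have := @integralT_gauss R; rewrite /gauss_fun => ->.
pose E t : R[i] := (expR (t ^+ 2 / 4))%:C.
have ED t : isD E t ((t / 2)%:C * E t).
  rewrite -rmorphM; apply: isDR; apply: is_derive_eq.
  by rewrite /GRing.scale /=; field.
have PD t : isD (fun t => gaussFT t * E t) t 0.
  have := isDM (gaussFT_deriv t) (ED t); congr isD; ring.
have := @isD_increment_ball R (fun t => gaussFT t * E t) (fun=> 0) 0 w 0.
move=> /(_ (fun t _ => PD t)) /(_ (fun t _ => _)).
rewrite mulr0 mul0r => H.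
have /eqP : gaussFT w * E w - gaussFT 0 * E 0 = 0.
  apply/eqP; rewrite -normc_eq0 eq_le normc_ge0 H ?normc0 // => t _.
rewrite subr_eq0 g0 /E expr0n mul0r expR0 mulr1 => /eqP e.
rewrite expRN rmorphM /= -e -mulrA -rmorphM divff ?mulr1 //.
by rewrite gt_eqF // expR_gt0.
Qed.

(** The constant of Fourier inversion per variable: [gaussFT] is again a Gaussian, of twice the
    width, and each of the two Gaussian integrals contributes a factor [Num.sqrt pi]. *)
Lemma I1_gaussFT : I1 gaussFT = (2 * pi)%:C.
Proof.
have -> : gaussFT = (fun w => (Num.sqrt pi)%:C * gauss (0 + 2^-1 * w)).
  apply/funext => w; rewrite gaussFTE rmorphM /gauss add0r exprMn exprVn.
  have e4 : (2 : R) ^+ 2 = 4 by rewrite -natrX.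
  by rewrite e4 [4^-1 * _]mulrC.
have h : 0 < 2^-1 :> R by rewrite invr_gt0.
have ca : cls1 (1 * (1 + 2 * (1 + 0 ^+ 2) / 2^-1 ^+ 2)) (fun w : R => gauss (0 + 2^-1 * w)).
  split.
    move=> u l ul; apply: scont1_gauss; apply: cvgD; first exact: cvg_cst.
    exact: cvgMr.
  by move=> s; rewrite (le_trans (cls1_gauss.2 _)) // -[leRHS]mulrA ler_wpM2l // wgt_affine.
rewrite (I1Z _ ca) (I1_affine 0 h cls1_gauss) invrK.
have -> : I1 gauss = (Num.sqrt pi)%:C.
  have := gaussFTE 0; rewrite expr0n mul0r oppr0 expR0 mulr1 => <-.
  by congr I1; apply/funext => t; rewrite mul0r mulr0 cexp0 mulr1.
by rewrite -!rmorphM; congr (_%:C); rewrite mulrCA -expr2 sqr_sqrtr // pi_ge0.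
Qed.

Lemma cls1_gaussFT : exists C, cls1 C gaussFT.
Proof.
have q : 0 < 4^-1 :> R by rewrite invr_gt0.
have [C hC] := gauss_dom 0 q; exists (Num.sqrt pi * C); split.
  exact: isD_scont1 gaussFT_deriv.
move=> w; rewrite gaussFTE normcR ger0_norm ?mulr_ge0 ?sqrtr_ge0 ?expR_ge0 //.
rewrite -[leRHS]mulrA ler_wpM2l ?sqrtr_ge0 //; have := hC w.
by rewrite mul0r addr0 mulNr mulrC.
Qed.

Lemma I1_gauss_scale b w : 0 < b ->
  I1 (fun t => gauss (b * t) * cis (w * t)) = (b^-1)%:C * gaussFT (w / b).
Proof.
move=> b0; have c0 : cls1 1 (fun t => gauss t * cis (w / b * t)).
  split; last by move=> s; rewrite normcM normc_cis mulr1 normc_gauss mul1r gauss_le_wgt.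
  move=> u l ul; apply: cvgCM; first exact: scont1_gauss.
  by apply: cvgC_cis; exact: cvgMr.
rewrite -(I1_affine 0 b0 c0); congr I1; apply/funext => t.
by rewrite !add0r mulrA divfK // gt_eqF.
Qed.

Lemma cls1_gauss_scale b : 0 < b -> exists C, cls1 C (fun t => gauss (b * t)).
Proof.
move=> b0; exists (1 * (1 + 2 * (1 + 0 ^+ 2) / b ^+ 2)); split.
  by move=> u l ul; apply: scont1_gauss; exact: cvgMr.
move=> s; rewrite -[b * s]add0r (le_trans (cls1_gauss.2 _)) // -[leRHS]mulrA.
by rewrite ler_wpM2l // wgt_affine.
Qed.

End Gaussian.

(** * Fourier transform and inversion *)

Section Fourier.
Context {R : realType} (n : nat).
Local Notation env := (nat -> R).
Local Notation vars := (iota 0 n).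
Implicit Types (F G : env -> R[i]) (e x xi : env) (C M : R).

Definition dot xi e : R := \sum_(j <- vars) xi j * e j.

Definition chi xi e : R[i] := cis (- dot xi e).

Definition FT F xi : R[i] := Ints vars (fun e => F e * chi xi e) (fun=> 0).

Definition local F : Prop :=
  forall a b : env, (forall j, j \in vars -> a j = b j) -> F a = F b.

Lemma normc_chi xi e : normc (chi xi e) = 1. Proof. exact: normc_cis. Qed.

Lemma cvg_sum_seq (I : Type) (r : seq I) (f : I -> nat -> R) (g : I -> R) :
  (forall i, f i @ \oo --> g i) ->
  (fun k => \sum_(i <- r) f i k) @ \oo --> \sum_(i <- r) g i.
Proof.
move=> fg; elim: r => [|i r IH].
  by under eq_fun do rewrite big_nil; rewrite big_nil; exact: cvg_cst.
by under eq_fun do rewrite big_cons; rewrite big_cons; exact: cvgD.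
Qed.

Lemma cvgC_chi (v u : nat -> env) xi e : econv v xi -> econv u e ->
  cvgC (fun k => chi (v k) (u k)) (chi xi e).
Proof.
move=> vx ue; apply: cvgC_cis; apply: cvgN; apply: cvg_sum_seq => j.
by apply: cvgM; [exact: vx|exact: ue].
Qed.

Lemma cls_chi C F xi : cls vars C F -> cls vars C (fun e => F e * chi xi e).
Proof.
move=> [cF FC]; split; last by move=> e; rewrite normcM normc_chi mulr1.
move=> u e ue; apply: cvgCM; first exact: cF.
by apply: cvgC_chi => //; exact: econv_cst.
Qed.

Lemma FT_bound C F xi : cls vars C F -> normc (FT F xi) <= (2 * pi) ^+ n * C.
Proof.
move=> FC; have := Ints_bound (fun=> 0) (iota_uniq 0 n) (cls_chi xi FC).
by rewrite size_iota.
Qed.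

Lemma FTZ C c F xi : cls vars C F -> FT (fun e => c * F e) xi = c * FT F xi.
Proof.
move=> FC; rewrite /FT -(IntsZ c _ (iota_uniq 0 n) (cls_chi xi FC)).
by congr Ints; apply/funext => e; rewrite mulrA.
Qed.

Lemma FTD C C' F G xi : cls vars C F -> cls vars C' G ->
  FT (fun e => F e + G e) xi = FT F xi + FT G xi.
Proof.
move=> FC GC; rewrite /FT.
rewrite -(IntsD _ (iota_uniq 0 n) (cls_chi xi FC) (cls_chi xi GC)).
by congr Ints; apply/funext => e; rewrite mulrDl.
Qed.

Lemma scont_FT C F : cls vars C F ->
  forall v xi, econv v xi -> cvgC (fun k => FT F (v k)) (FT F xi).
Proof.
move=> FC v xi vx; apply: (@Ints_dct R vars C) => [|k|e].
- exact: iota_uniq.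
- exact: cls_chi.
- apply: cvgCM; first exact: cvgC_cst.
  by apply: cvgC_chi => //; exact: econv_cst.
Qed.

Lemma FT_dct C (F : nat -> env -> R[i]) f xi : (forall i, cls vars C (F i)) ->
  (forall e, cvgC (fun i => F i e) (f e)) -> cvgC (fun i => FT (F i) xi) (FT f xi).
Proof.
move=> FC Ff; apply: (@Ints_dct R vars C) => [|k|e].
- exact: iota_uniq.
- exact: cls_chi.
- by apply: cvgCM; [exact: Ff|exact: cvgC_cst].
Qed.

Lemma dot_upd k xi e s : (k < n)%N ->
  dot xi (upd e k s) = xi k * s + \sum_(j <- vars | j != k) xi j * e j.
Proof.
move=> kn; rewrite /dot (bigD1_seq k) ?iota_uniq ?mem_iota //= upd_eq.
by congr (_ + _); apply: eq_bigr => j jk; rewrite /upd (negbTE jk).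
Qed.

Lemma isD_chi k xi e : (k < n)%N ->
  isD (fun s => chi xi (upd e k s)) (e k) (- ('i * (xi k)%:C) * chi xi e).
Proof.
move=> kn.
have -> : (fun s => chi xi (upd e k s)) =
    (fun s => cis (- \sum_(j <- vars | j != k) xi j * e j) * cis (- xi k * s)).
  apply/funext => s; rewrite -cisD /chi dot_upd //; congr cis.
  by rewrite opprD addrC mulNr.
have -> : chi xi e = chi xi (upd e k (e k)) by rewrite upd_same.
rewrite /chi dot_upd // opprD addrC cisD.
have := isDZ (cis (- \sum_(j <- vars | j != k) xi j * e j)) (isD_wave (- xi k) (e k)).
by congr isD; rewrite /cis mulNr rmorphN mulrN; ring.
Qed.

Lemma FT_derive k C C' F dF xi : (k < n)%N -> cls vars C F -> cls vars C' dF ->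
  (forall e, isD (fun s => F (upd e k s)) (e k) (dF e)) ->
  FT dF xi = 'i * (xi k)%:C * FT F xi.
Proof.
move=> kn FC dFC FD; have un := iota_uniq 0 n.
have c1 := cls_chi xi FC; have c2 := cls_chi xi dFC.
have c3 := clsD c2 (clsZ (- ('i * (xi k)%:C)) c1).
have H : Ints vars (fun e => dF e * chi xi e + - ('i * (xi k)%:C) * (F e * chi xi e))
    (fun=> 0) = 0.
  apply: (@Ints_derive0 R k vars _ C (fun e => F e * chi xi e)) => //.
  - by rewrite mem_iota.
  - exact: c3.
  - move=> e; have := isDM (FD e) (isD_chi xi e kn).
    by rewrite upd_same; congr isD; ring.
  - exact: c1.2.
apply/eqP; rewrite -subr_eq0 -mulNr -{}H /FT -(IntsZ _ _ un c1).
by rewrite -(IntsD _ un c2 (clsZ _ c1)).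
Qed.

Lemma iota_shift : iota n n = [seq (n + j)%N | j <- vars].
Proof. by rewrite -iotaDl addn0. Qed.

Lemma wprod_shift e : wprod (iota n n) e = \prod_(j <- vars) wgt (e (n + j)%N).
Proof. by rewrite /wprod iota_shift big_map. Qed.

(* Fubini on the 2n variables [e 0 .. e (2n-1)], the last n of which carry the
   Fourier representation [psi w = int g t exp (i w t) dt]. *)
Lemma FT_mollify g psi Cg C F xi x a M e0 : cls1 Cg g ->
  (forall w, I1 (fun t => g t * cis (w * t)) = psi w) ->
  cls vars C F -> local F ->
  (forall eta, normc (\prod_(j <- vars) g (eta j)) *
     normc (FT F (fun j => xi j - a * eta j)) <= M * wprod vars eta) ->
  normc (Ints vars (fun e => F e * chi xi e *
      \prod_(j <- vars) psi (a * (e j - x j))) e0) <= (2 * pi) ^+ n * M.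
Proof.
move=> gC gpsi FC lF HM; have un := iota_uniq 0 n.
have vn j : j \in vars -> (n + j)%N \notin vars.
  by rewrite !mem_iota /= !add0n => _; rewrite -leqNgt leq_addr.
pose Phi e := F e * chi xi e * \prod_(j <- vars)
  (g (e (n + j)%N) * cis (a * (e j - x j) * e (n + j)%N)).
have c1 : cls (vars ++ iota n n) (C * \prod_(j <- vars) Cg) Phi.
  split.
    move=> u e ue; apply: cvgCM.
      by apply: cvgCM; [exact: FC.1|apply: cvgC_chi => //; exact: econv_cst].
    apply: cvgC_prod => j; apply: cvgCM; first by apply: gC.1; exact: ue.
    apply: cvgC_cis; apply: cvgM; last exact: ue.
    by apply: cvgMr; apply: cvgB; [exact: ue|exact: cvg_cst].
  move=> e; rewrite 2!normcM normc_chi mulr1 /wprod big_cat /= -/(wprod _ _).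
  rewrite -/(wprod (iota n n) e) wprod_shift mulrACA ler_pM ?normc_ge0 //.
    exact: FC.2.
  apply: prod_normc_le => j; rewrite normcM normc_cis mulr1; exact: gC.2.
have u2 : uniq (vars ++ iota n n) by rewrite -iotaD iota_uniq.
have E1 : (fun e => F e * chi xi e * \prod_(j <- vars) psi (a * (e j - x j))) =
    Ints (iota n n) Phi.
  apply/funext => e.
  pose gk k t := g t * cis (a * (e (k - n)%N - x (k - n)%N) * t).
  have gkC k : cls1 Cg (gk k).
    split; last by move=> s; rewrite normcM normc_cis mulr1 gC.2.
    move=> u l ul; apply: cvgCM; first exact: gC.1.
    by apply: cvgC_cis; exact: cvgMr.
  have -> : Ints (iota n n) Phi e =
      Ints (iota n n) (fun e' => F e * chi xi e * \prod_(k <- iota n n) gk k (e' k)) e.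
    apply: Ints_ext => b b' bb' ne.
    have bv j : j \in vars -> b j = e j.
      move=> jv; apply: (ne j _).1; move: jv; rewrite !mem_iota /= add0n => jn.
      by rewrite negb_and -ltnNge jn.
    rewrite /Phi; congr (_ * _ * _).
    - exact: lF.
    - by rewrite /chi /dot; congr (cis (- _)); apply: eq_big_seq => j /bv ->.
    - rewrite iota_shift big_map; apply: eq_big_seq => j jv.
      rewrite /gk addKn (bv j jv) -bb' // mem_iota leq_addr ltn_add2l.
      by move: jv; rewrite mem_iota add0n.
  rewrite (Ints_prod _ _ (iota_uniq n n) gkC); congr (_ * _).
  rewrite iota_shift big_map; apply: eq_bigr => j _.
  by rewrite /gk addKn gpsi.
rewrite E1 -Ints_cat (Ints_perm _ _ u2 c1 (l' := iota n n ++ vars)); last first.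
  by rewrite perm_catC.
rewrite Ints_cat -[X in _ ^+ X](size_iota n n).
apply: Ints_bound; first exact: iota_uniq.
split; first exact: (cls_Ints u2 c1).1.
move=> e.
pose c := \prod_(j <- vars) (g (e (n + j)%N) * cis (- (a * x j * e (n + j)%N))).
(* With the order exchanged the auxiliary variables are frozen: their oscillation shifts the
   frequency to [xi - a * eta], and what is left is the factor [c], whose modulus is that of the
   product of the values of [g]. *)
have -> : Ints vars Phi e = c * FT F (fun j => xi j - a * e (n + j)%N).
  rewrite /FT -(IntsZ _ _ un (cls_chi _ FC)).
  apply: Ints_ext => b b' bb' ne; rewrite /Phi /c (lF b b') // mulrCA -mulrA.
  congr (_ * _); rewrite !big_split /= !cis_sum mulrCA -mulrA.
  have -> : \prod_(j <- vars) g (b (n + j)%N) = \prod_(j <- vars) g (e (n + j)%N).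
    by apply: eq_big_seq => j /vn jv; have [-> _] := ne _ jv.
  congr (_ * _); rewrite /chi -!cisD; congr cis; rewrite /dot -!sumrN -!big_split /=.
  apply: eq_big_seq => j jv; rewrite bb' //; have [-> _] := ne _ (vn _ jv); ring.
rewrite normcM wprod_shift.
have -> : normc c = normc (\prod_(j <- vars) g (e (n + j)%N)).
  by rewrite !normc_prod; apply: eq_bigr => j _; rewrite normcM normc_cis mulr1.
exact: (HM (fun j => e (n + j)%N)).
Qed.

(** An inequality is all that is asked of inversion: it yields injectivity and sup bounds. [F] is
    averaged around [x] against [gaussFT] shrunk by [b]; mollification with [gauss (b * t)], of
    modulus at most 1, bounds the average by [(2 * pi) ^+ n * S], and as [b] tends to 0 the average
    tends to [F x * (2 * pi) ^+ n]. *)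
Lemma FT_inversion_bound C S F : cls vars C F -> local F ->
  (forall xi, normc (FT F xi) <= S * wprod vars xi) -> forall x, normc (F x) <= S.
Proof.
move=> FC lF HS x; have un := iota_uniq 0 n; have C0 := cls_ge0 FC.
have pi2 : 0 < 2 * pi :> R by rewrite mulr_gt0 ?pi_gt0.
have [Cg gC] := @cls1_gaussFT R.
have Cg0 : 0 <= Cg.
  by rewrite -(pmulr_lge0 _ (wgt_gt0 0)) (le_trans _ (gC.2 0)) ?normc_ge0.
pose af b e : env := fun j => if j \in vars then x j + b * e j else e j.
pose P e := \prod_(j <- vars) gaussFT (e j).
have Pb e : normc (P e) <= (\prod_(j <- vars) Cg) * wprod vars e.
  by apply: prod_normc_le => j; exact: gC.2.
have key b : 0 < b ->
    normc (Ints vars (fun e => F (af b e) * P e) x) <= (2 * pi) ^+ n * S.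
  move=> b0; have [Cb bC] := cls1_gauss_scale b0.
  have b1 : b != 0 by rewrite gt_eqF.
  have S0 : 0 <= S.
    by rewrite -(pmulr_lge0 _ (wprod_gt0 vars x)) (le_trans _ (HS x)) ?normc_ge0.
  pose G e := F e * \prod_(j <- vars) gaussFT ((e j - x j) / b).
  (* The constant of [wgt_affine] for the rescaling [s |-> - (x j / b) + b^-1 * s]. *)
  pose K j := 1 + 2 * (1 + (- (x j / b)) ^+ 2) / b^-1 ^+ 2.
  have GC : cls vars (C * \prod_(j <- vars) (Cg * K j)) G.
    split.
      move=> u e ue; apply: cvgCM; first exact: FC.1.
      apply: cvgC_prod => j; apply: gC.1; apply: cvgMl; apply: cvgB; first exact: ue.
      exact: cvg_cst.
    move=> e; rewrite normcM -mulrA ler_pM ?normc_ge0 //.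
      by rewrite (le_trans (FC.2 _)) // ler_piMr // wprod_le1.
    apply: prod_normc_le => j; rewrite (le_trans (gC.2 _)) // -mulrA ler_wpM2l //.
    have -> : (e j - x j) / b = - (x j / b) + b^-1 * e j by rewrite mulrBl; ring.
    by rewrite wgt_affine // invr_gt0.
  have H := @FT_mollify _ _ Cb C F (fun=> 0) x 1 S x bC
    (fun w => I1_gauss_scale w b0) FC lF.
  have -> : (fun e => F (af b e) * P e) =
      (fun e => G (fun j => if j \in vars then x j + b * e j else e j)).
    apply/funext => e; congr (_ * _); apply: eq_big_seq => j jv.
    by rewrite jv addrC addKr mulrC mulKf.
  rewrite (Ints_affine x x b0 un GC) size_iota -(IntsZ _ _ un GC).
  have -> : (fun e => (b^-1 ^+ n)%:C * G e) = (fun e => F e * chi (fun=> 0) e *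
      \prod_(j <- vars) ((b^-1)%:C * gaussFT (1 * (e j - x j) / b))).
    apply/funext => e; rewrite /chi /dot big1 ?oppr0 ?cis0 ?mulr1; last first.
      by move=> j _; rewrite mul0r.
    rewrite big_split /= /G mulrCA; congr (_ * (_ * _)).
      by rewrite big_const_seq count_predT size_iota iter_mulr_1 rmorphXn.
    by apply: eq_bigr => j _; rewrite mul1r.
  apply: H => eta; rewrite -[leRHS]mul1r ler_pM ?normc_ge0 //.
    rewrite normc_prod; apply: prodr_ile1 => j _.
    by rewrite normc_ge0 normc_gauss (le_trans (gauss_le_wgt _)) ?wgt_le1.
  rewrite (le_trans (HS _)) // ler_wpM2l // le_eqVlt; apply/orP; left; apply/eqP.
  by apply: eq_bigr => j _; rewrite /wgt sub0r mul1r sqrrN.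
pose bk (k : nat) : R := k.+1%:R^-1.
have bk0 : bk @ \oo --> (0 : R) by exact: cvg_harmonic.
have lim : cvgC (fun k => Ints vars (fun e => F (af (bk k) e) * P e) x)
    (F x * (2 * pi)%:C ^+ n).
  have -> : F x * (2 * pi)%:C ^+ n = Ints vars (fun e => F x * P e) x.
    rewrite /P (Ints_prod _ _ un (fun=> gC)); congr (_ * _).
    by rewrite I1_gaussFT big_const_seq count_predT size_iota iter_mulr_1.
  apply: (@Ints_dct R vars (C * \prod_(j <- vars) Cg)) => // [k|e].
  - split.
      move=> u e ue; apply: cvgCM; last first.
        by apply: cvgC_prod => j; apply: gC.1; exact: ue.
      apply: FC.1 => j; rewrite /af; case: ifP => _; last exact: ue.
      by apply: cvgD; [exact: cvg_cst|apply: cvgMr; exact: ue].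
    move=> e; rewrite normcM -mulrA ler_pM ?normc_ge0 //.
    by rewrite (le_trans (FC.2 _)) // ler_piMr // wprod_le1.
  - apply: cvgCM; last exact: cvgC_cst.
    rewrite (lF x (af 0 e)); last by move=> j jv; rewrite /af jv mul0r addr0.
    apply: FC.1 => j; rewrite /af; case: ifP => _; last exact: cvg_cst.
    by apply: cvgD; [exact: cvg_cst|apply: cvgMl; exact: bk0].
have := cvgC_le lim (fun k => key (bk k) _).
rewrite normcM normcX normcR gtr0_norm // mulrC ler_pM2l ?exprn_gt0 //.
by apply=> k; rewrite invr_gt0.
Qed.

End Fourier.

(** * Propagation on the Fourier side *)

Section Evolution.
Context {R : realType} (n : nat) (c : R).
Local Notation env := (nat -> R).
Local Notation vars := (iota 0 n).
Local Notation FT := (@FT R n).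
Local Notation chi := (@chi R n).
Variables (U L : R -> env -> R[i]).

Definition nrm2 (xi : env) : R := dot n xi xi.

(** Of the two powers of the weight, one makes the transform integrable, as inversion requires, and
    the other absorbs the symbol [nrm2 xi] when the same is done for [L]. *)
Definition bounded_hat M t : Prop :=
  forall xi, normc (FT (U t) xi) <= M * wprod vars xi ^+ 2.

Hypothesis clsU : forall t, exists C, cls vars C (U t).
Hypothesis clsL : forall t, exists C, cls vars C (L t).
Hypothesis localU : forall t, local n (U t).
Hypothesis localL : forall t, local n (L t).
Hypothesis eqU : forall t e, isD (fun t => U t e) t ('i * c%:C * L t e).
Hypothesis hatL : forall t xi, FT (L t) xi = - (nrm2 xi)%:C * FT (U t) xi.
Hypothesis hatU : forall t, exists M, bounded_hat M t.

Definition propagated xi t : R[i] := cis (c * nrm2 xi * t) * FT (U t) xi.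

Lemma nrm2E (xi : env) : nrm2 xi = \sum_(j <- vars) xi j ^+ 2.
Proof. by rewrite /nrm2 /dot; apply: eq_bigr => j _; rewrite expr2. Qed.

Lemma nrm2_ge0 xi : 0 <= nrm2 xi.
Proof. by rewrite nrm2E; apply: sumr_ge0 => j _; exact: sqr_ge0. Qed.

Lemma sqr_wprod_le1 (l : seq nat) j (e : env) : j \in l -> uniq l ->
  e j ^+ 2 * wprod l e <= 1.
Proof.
move=> jl ul; rewrite /wprod (bigD1_seq j) //= mulrA mulr_ile1 //.
- by rewrite mulr_ge0 ?sqr_ge0 ?wgt_ge0.
- by apply: prodr_ge0 => i _; exact: wgt_ge0.
- by rewrite -(wgtM (e j)) mulrC ler_wpM2l ?wgt_ge0 // lerDr.
- by apply: prodr_ile1 => i _; rewrite wgt_ge0 wgt_le1.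
Qed.

Lemma nrm2_wprod xi : nrm2 xi * wprod vars xi <= n%:R.
Proof.
have -> : n%:R = \sum_(j <- vars) 1 :> R.
  by rewrite big_const_seq count_predT size_iota iter_addr_0.
rewrite nrm2E mulr_suml big_seq [leRHS]big_seq; apply: ler_sum => j jv.
by apply: sqr_wprod_le1 => //; exact: iota_uniq.
Qed.

Lemma bounded_hat_le M M' t : M <= M' -> bounded_hat M t -> bounded_hat M' t.
Proof.
move=> MM' H xi; rewrite (le_trans (H xi)) // ler_wpM2r // exprn_ge0 //.
exact: wprod_ge0.
Qed.

Lemma bounded_hat_ge0 M t : bounded_hat M t -> 0 <= M.
Proof.
move=> /(_ (fun=> 0)) H; rewrite -(pmulr_lge0 _ (exprn_gt0 2 (wprod_gt0 vars (fun=> 0)))).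
by rewrite (le_trans _ H) ?normc_ge0.
Qed.

Lemma bounded_hat_U M t e : bounded_hat M t -> normc (U t e) <= M.
Proof.
move=> MB; have [C UC] := clsU t.
apply: (FT_inversion_bound UC (localU t)) => xi.
rewrite (le_trans (MB xi)) // ler_wpM2l ?(bounded_hat_ge0 MB) //.
by rewrite expr2 ler_piMr ?wprod_ge0 // wprod_le1.
Qed.

Lemma bounded_hat_L M t e : bounded_hat M t -> normc (L t e) <= n%:R * M.
Proof.
move=> MB; have [C LC] := clsL t.
apply: (FT_inversion_bound LC (localL t)) => xi.
rewrite hatL normcM normcN normcR ger0_norm ?nrm2_ge0 //.
have M0 := bounded_hat_ge0 MB; have w0 := wprod_ge0 vars xi.
apply: (@le_trans _ _ (nrm2 xi * (M * wprod vars xi ^+ 2))).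
  by rewrite ler_wpM2l ?nrm2_ge0.
have := nrm2_wprod xi; rewrite expr2 => H.
rewrite [leLHS](_ : _ = (nrm2 xi * wprod vars xi) * (M * wprod vars xi)); last by ring.
by rewrite -[leRHS]mulrA ler_wpM2r ?mulr_ge0.
Qed.

(** Coordinatewise, [p ^+ 2 - (p - d * q) ^+ 2 = d * (2 * p * q - d * q ^+ 2)], which for [d <= 1]
    is at most [d * (p ^+ 2 + 2 * q ^+ 2)] in absolute value. The Gaussian supplies two powers of
    the weight, one of which absorbs [nrm2 eta]. *)
Lemma symbol_bound xi : exists K, forall d eta, 0 <= d <= 1 ->
  normc (\prod_(j <- vars) gauss (eta j)) *
    `|nrm2 xi - nrm2 (fun j => xi j - d * eta j)| <= d * K * wprod vars eta.
Proof.
have h : 0 < 2^-1 :> R by rewrite invr_gt0.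
have [C0 hC] := gauss_dom 0 h.
exists ((\prod_(j <- vars) C0 ^+ 2) * (nrm2 xi + 2 * n%:R)) => d eta /andP[d0 d1].
have w0 := wprod_ge0 vars eta.
have gb : normc (\prod_(j <- vars) gauss (eta j)) <=
    (\prod_(j <- vars) C0 ^+ 2) * wprod vars eta ^+ 2.
  rewrite normc_prod /wprod -prodrXl -big_split; apply: ler_prod => j _.
  rewrite normc_ge0 normc_gauss /= -exprMn.
  have -> : expR (- eta j ^+ 2) = expR (- 2^-1 * eta j ^+ 2) ^+ 2.
    by rewrite -expRM_natl; congr expR; field.
  by rewrite lerXn2r ?nnegrE ?expR_ge0 ?(le_trans _ (hC (eta j)))
    // ?expR_ge0 //; have := hC (eta j); rewrite mul0r addr0.
have sb : `|nrm2 xi - nrm2 (fun j => xi j - d * eta j)| <=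
    d * (nrm2 xi + 2 * nrm2 eta).
  rewrite !nrm2E mulr_sumr -sumrN -!big_split mulr_sumr /=.
  apply: le_trans (ler_norm_sum _ _ _) _; apply: ler_sum => j _.
  set p := xi j; set q := eta j.
  have -> : p ^+ 2 + - (p - d * q) ^+ 2 = d * (2 * p * q - d * q ^+ 2) by ring.
  rewrite normrM ger0_norm // ler_wpM2l // ler_norml.
  have q2 : d * q ^+ 2 <= q ^+ 2 by rewrite ler_piMl // sqr_ge0.
  have q0 : 0 <= d * q ^+ 2 by rewrite mulr_ge0 // sqr_ge0.
  have := sqr_ge0 (p - q); have := sqr_ge0 (p + q).
  by rewrite !expr2 in q2 q0 *; move=> *; apply/andP; split; nra.
have nw := nrm2_wprod eta; have n0 := nrm2_ge0 xi; have n0' := nrm2_ge0 eta.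
apply: le_trans (ler_pM (normc_ge0 _) (normr_ge0 _) gb sb) _.
have P0 : 0 <= \prod_(j <- vars) C0 ^+ 2 by apply: prodr_ge0 => j _; exact: sqr_ge0.
set P := \prod_(j <- vars) C0 ^+ 2 in P0 *.
rewrite [leLHS](_ : _ = (d * P * wprod vars eta) *
  ((nrm2 xi + 2 * nrm2 eta) * wprod vars eta)); last by ring.
rewrite [leRHS](_ : _ = (d * P * wprod vars eta) * (nrm2 xi + 2 * n%:R)); last by ring.
rewrite ler_wpM2l ?mulr_ge0 // mulrDl lerD //.
  by rewrite ler_piMr // wprod_le1.
by rewrite -mulrA ler_wpM2l.
Qed.

(* With the Gaussian factor the integrand is dominated through the supremum of
   [U t] alone, which [bounded_hat] controls uniformly in [t]. *)
Definition mollified d xi t : R[i] :=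
  Ints vars (fun e => cis (c * nrm2 xi * t) * (U t e * chi xi e *
    \prod_(j <- vars) gaussFT (d * (e j - 0)))) (fun=> 0).

Lemma normc_gaussFT_le w : normc (gaussFT w) <= Num.sqrt pi :> R.
Proof.
rewrite gaussFTE normcR ger0_norm ?mulr_ge0 ?sqrtr_ge0 ?expR_ge0 //.
rewrite ler_piMr ?sqrtr_ge0 // expR_le1 oppr_le0 divr_ge0 ?sqr_ge0 //.
Qed.

Lemma normc_prod_gaussFT (v : nat -> R) :
  normc (\prod_(j <- vars) gaussFT (v j)) <= \prod_(j <- vars) Num.sqrt pi.
Proof.
rewrite normc_prod; apply: ler_prod => j _.
by rewrite normc_ge0 normc_gaussFT_le.
Qed.

Lemma gaussFT0 : gaussFT 0 = (Num.sqrt pi)%:C :> R[i].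
Proof. by rewrite gaussFTE expr0n mul0r oppr0 expR0 mulr1. Qed.

Lemma scont1_gaussFT : scont1 (@gaussFT R).
Proof. exact: isD_scont1 (@gaussFT_deriv R). Qed.

Definition mollified_integrand d xi t e : R[i] := cis (c * nrm2 xi * t) *
  (U t e * chi xi e * \prod_(j <- vars) gaussFT (d * (e j - 0))).

Lemma scont_prod_gaussFT (d : R) :
  scont (fun e => \prod_(j <- vars) gaussFT (d * (e j - 0))).
Proof.
move=> u e ue; apply: cvgC_prod => j; apply: scont1_gaussFT.
by apply: cvgMr; apply: cvgB; [exact: ue|exact: cvg_cst].
Qed.

Lemma cls_mollified_integrand C d xi t : cls vars C (U t) ->
  cls vars (C * \prod_(j <- vars) Num.sqrt pi) (mollified_integrand d xi t).
Proof.
move=> UC; split.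
  move=> u e ue; apply: cvgCM; first exact: cvgC_cst.
  apply: cvgCM; last exact: scont_prod_gaussFT.
  by apply: cvgCM; [exact: UC.1|apply: cvgC_chi => //; exact: econv_cst].
move=> e; rewrite 3!normcM normc_cis normc_chi mul1r mulr1 mulrAC.
by rewrite ler_pM ?normc_ge0 ?UC.2 // normc_prod_gaussFT.
Qed.

Lemma mollified_cvg (d : nat -> R) xi t : d @ \oo --> 0 ->
  cvgC (fun k => mollified (d k) xi t)
    ((\prod_(j <- vars) (Num.sqrt pi)%:C) * propagated xi t).
Proof.
move=> d0; have [C UC] := clsU t; have un := iota_uniq 0 n.
have -> : (\prod_(j <- vars) (Num.sqrt pi)%:C) * propagated xi t =
    Ints vars (fun e => cis (c * nrm2 xi * t) * (U t e * chi xi e *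
      \prod_(j <- vars) (Num.sqrt pi)%:C)) (fun=> 0).
  rewrite /propagated /FT mulrA -(IntsZ _ _ un (cls_chi xi UC)).
  by congr Ints; apply/funext => e; ring.
apply: (@Ints_dct R vars (C * \prod_(j <- vars) Num.sqrt pi)
  (fun k => mollified_integrand (d k) xi t)) => // [k|e].
  exact: cls_mollified_integrand.
apply: cvgCM; first exact: cvgC_cst.
apply: cvgCM; first exact: cvgC_cst.
apply: cvgC_prod => j; rewrite -gaussFT0; apply: scont1_gaussFT.
by rewrite -[X in _ --> X](mul0r (e j - 0)); apply: cvgMl.
Qed.

Lemma mollified_time_cvg M a b d xi (u : nat -> R) t : 0 < d ->
  (forall t, a <= t <= b -> bounded_hat M t) -> (forall k, a <= u k <= b) ->
  u @ \oo --> t -> cvgC (fun k => mollified d xi (u k)) (mollified d xi t).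
Proof.
move=> d0 MB uab ut; have [Cg gC] := @cls1_gaussFT R.
pose K : R := 1 + 2 * (1 + 0 ^+ 2) / d ^+ 2.
apply: (@Ints_dct R vars (M * \prod_(j <- vars) (Cg * K))
  (fun k => mollified_integrand d xi (u k)) (mollified_integrand d xi t)) => [|k|e].
- exact: iota_uniq.
- have [C UC] := clsU (u k).
  split; first exact: (cls_mollified_integrand d xi UC).1.
  move=> e; rewrite 3!normcM normc_cis normc_chi mul1r mulr1 -mulrA.
  rewrite ler_pM ?normc_ge0 ?bounded_hat_U //; first exact: MB.
  apply: prod_normc_le => j; rewrite subr0 (le_trans (gC.2 _)) // -[leRHS]mulrA.
  have Cg0 : 0 <= Cg.
    by rewrite -(pmulr_lge0 _ (wgt_gt0 0)) (le_trans _ (gC.2 0)) ?normc_ge0.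
  by rewrite ler_wpM2l // -[d * e j]add0r wgt_affine.
- apply: cvgCM.
    by apply: cvgC_cis; apply: cvgMr.
  apply: cvgCM; last exact: cvgC_cst.
  apply: cvgCM; last exact: cvgC_cst.
  exact: (isD_scont1 (fun t => eqU t e)).
Qed.

(** The phase contributes [nrm2 xi * U] and the equation contributes [L], with the common factor
    ['i * c]. They are kept together because the transform of their sum vanishes at [xi]. *)
Lemma mollified_derive M a b d xi t : 0 < d ->
  (forall t, a <= t <= b -> bounded_hat M t) -> a < t < b ->
  isD (mollified d xi) t (Ints vars (fun e => 'i * c%:C * cis (c * nrm2 xi * t) *
    (((nrm2 xi)%:C * U t e + L t e) * chi xi e *
      \prod_(j <- vars) gaussFT (d * (e j - 0)))) (fun=> 0)).
Proof.
move=> d0 MB /andP[at_ tb]; have [Cg gC] := @cls1_gaussFT R.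
have Cg0 : 0 <= Cg.
  by rewrite -(pmulr_lge0 _ (wgt_gt0 0)) (le_trans _ (gC.2 0)) ?normc_ge0.
pose K : R := 1 + 2 * (1 + 0 ^+ 2) / d ^+ 2.
have pg e : normc (\prod_(j <- vars) gaussFT (d * (e j - 0))) <=
    (\prod_(j <- vars) (Cg * K)) * wprod vars e.
  apply: prod_normc_le => j; rewrite subr0 (le_trans (gC.2 _)) // -[leRHS]mulrA.
  by rewrite ler_wpM2l // -[d * e j]add0r wgt_affine.
have e0 : 0 < Num.min (t - a) (b - t) by rewrite lt_min !subr_gt0 at_.
have near_t s : `|s - t| < Num.min (t - a) (b - t) -> a <= s <= b.
  rewrite lt_min => /andP[]; rewrite !ltr_norml => /andP[s1 _] /andP[_ s2].
  by apply/andP; split; lra.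
apply: (@Ints_isD R vars (M * \prod_(j <- vars) (Cg * K))
  (`|c| * (nrm2 xi * M + n%:R * M) * \prod_(j <- vars) (Cg * K))
  (mollified_integrand d xi) (fun t e => 'i * c%:C * cis (c * nrm2 xi * t) *
    (((nrm2 xi)%:C * U t e + L t e) * chi xi e *
      \prod_(j <- vars) gaussFT (d * (e j - 0)))) t _ (fun=> 0) e0).
- exact: iota_uniq.
- move=> s st; have [C UC] := clsU s.
  split; first exact: (cls_mollified_integrand d xi UC).1.
  move=> e; rewrite 3!normcM normc_cis normc_chi mul1r mulr1 -mulrA.
  by rewrite ler_pM ?normc_ge0 // bounded_hat_U //; exact: MB (near_t _ st).
- move=> s e st.
  have := isDM (isD_wave (c * nrm2 xi) s)
    (isDM (eqU s e) (isD_cst (chi xi e * \prod_(j <- vars) gaussFT (d * (e j - 0))) s)).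
  have -> : (fun t => mollified_integrand d xi t e) = (fun t => cis (c * nrm2 xi * t) *
      (U t e * (chi xi e * \prod_(j <- vars) gaussFT (d * (e j - 0))))).
    by apply/funext => r; rewrite /mollified_integrand -[_ * chi _ _ * _]mulrA.
  by congr isD; rewrite -/(cis _) rmorphM /=; ring.
- move=> s e st; rewrite 2!normcM normcM normci mul1r normcR normc_cis mulr1 -mulrA.
  rewrite [leRHS](_ : _ = `|c| * ((nrm2 xi * M + n%:R * M) *
    (\prod_(j <- vars) (Cg * K) * wprod vars e))); last by ring.
  rewrite ler_wpM2l // normcM [normc (chi _ _ * _)]normcM normc_chi mul1r.
  rewrite ler_pM ?normc_ge0 // (le_trans (le_normcD _ _)) //.
  have Bs := MB _ (near_t _ st).
  rewrite normcM normcR ger0_norm ?nrm2_ge0 // lerD ?bounded_hat_L //.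
  by rewrite ler_wpM2l ?nrm2_ge0 // bounded_hat_U.
Qed.

(** At the frequency [xi - d * eta] the transform of [nrm2 xi * U + L] is that of [U] times the
    difference of the symbols at [xi] and at [xi - d * eta]. By [symbol_bound] the mollified
    derivative is therefore of order [d], uniformly in time. *)
Lemma mollified_increment M a b xi : a < b ->
  (forall t, a <= t <= b -> bounded_hat M t) ->
  exists K, forall d, 0 < d <= 1 ->
    normc (mollified d xi b - mollified d xi a) <= d * K.
Proof.
move=> ab MB; have [K HK] := symbol_bound xi; have un := iota_uniq 0 n.
have M0 : 0 <= M by apply: (@bounded_hat_ge0 M a); apply: MB; rewrite lexx ltW.
exists (2 * (`|c| * ((2 * pi) ^+ n * (K * M))) * (b - a)) => d /andP[d0 d1].
have der_bound t : a < t < b -> normc (Ints vars (fun e => 'i * c%:C *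
    cis (c * nrm2 xi * t) * (((nrm2 xi)%:C * U t e + L t e) * chi xi e *
    \prod_(j <- vars) gaussFT (d * (e j - 0)))) (fun=> 0)) <=
    `|c| * ((2 * pi) ^+ n * (d * K * M)).
  move=> /andP[at_ tb]; have [C UC] := clsU t; have [C' LC] := clsL t.
  have FC := clsD (clsZ (nrm2 xi)%:C UC) LC.
  set C'' := _ + C' in FC.
  have FC2 : cls vars (C'' * \prod_(j <- vars) Num.sqrt pi)
    (fun e => ((nrm2 xi)%:C * U t e + L t e) * chi xi e *
      \prod_(j <- vars) gaussFT (d * (e j - 0))).
    split.
      move=> u e ue; apply: cvgCM; last exact: scont_prod_gaussFT.
      by apply: cvgCM; [exact: FC.1|apply: cvgC_chi => //; exact: econv_cst].
    move=> e; rewrite 2!normcM normc_chi mulr1 mulrAC.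
    by rewrite ler_pM ?normc_ge0 ?FC.2 // normc_prod_gaussFT.
  rewrite (IntsZ _ _ un FC2) 3!normcM normci mul1r normcR normc_cis mulr1.
  rewrite ler_wpM2l //.
  apply: (@FT_mollify R n gauss gaussFT 1 C'' _ xi (fun=> 0) d (d * K * M) (fun=> 0)
    (@cls1_gauss R) (fun w => erefl) FC).
    by move=> p q pq; rewrite (localU t pq) (localL t pq).
  move=> eta; rewrite (FTD _ (clsZ _ UC) LC) (FTZ _ _ UC) hatL -mulrDl.
  rewrite -rmorphN -rmorphD normcM normcR mulrA.
  have Bt : normc (FT (U t) (fun j => xi j - d * eta j)) <= M.
    rewrite (le_trans (MB t _ _)) ?(ltW at_) ?(ltW tb) //.
    by rewrite ler_piMr // exprn_ile1 ?wprod_ge0 ?wprod_le1.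
  rewrite [leRHS](_ : _ = d * K * wprod vars eta * M); last by ring.
  rewrite ler_pM ?mulr_ge0 ?normc_ge0 ?normr_ge0 //.
  by apply: HK; rewrite ltW.
(* The derivative is available only strictly between [a] and [b]; the increment is taken over
   [[a + r k, b - r k]] and the endpoints are recovered by continuity. *)
pose r (k : nat) : R := (b - a) / k.+3%:R.
have r0 k : 0 < r k by rewrite divr_gt0 ?subr_gt0 // ltr0n.
have r2 k : r k <= (b - a) / 2.
  by rewrite ler_wpM2l ?subr_ge0 ?(ltW ab) // lef_pV2 ?posrE ?ltr0n // ler_nat.
have rc : r @ \oo --> 0.
  rewrite -[X in _ --> X](mulr0 (b - a)); apply: cvgMr.
  have := @cvg_harmonic R; rewrite -(cvg_shiftn 2).
  by apply: cvg_trans; apply: near_eq_cvg; apply: filterE => k; rewrite /harmonic /= addn2.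
have ca : cvgC (fun k => mollified d xi (a + r k)) (mollified d xi a).
  apply: (@mollified_time_cvg M a b) => // [k|].
    have := r0 k; have := r2 k; move=> *; apply/andP; split; lra.
  by rewrite -[X in _ --> X]addr0; apply: cvgD => //; exact: cvg_cst.
have cb : cvgC (fun k => mollified d xi (b - r k)) (mollified d xi b).
  apply: (@mollified_time_cvg M a b) => // [k|].
    have := r0 k; have := r2 k; move=> *; apply/andP; split; lra.
  by rewrite -[X in _ --> X]subr0; apply: cvgB => //; exact: cvg_cst.
apply: (cvgC_le (cvgCD cb (cvgCN ca))) => k.
have h0 := r0 k; have h2 := r2 k.
have inab t : t \in `[a + r k, b - r k]%R -> a < t < b.
  by rewrite in_itv /= => /andP[t1 t2]; apply/andP; split; lra.
have le_ab : a + r k <= b - r k by lra.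
have := isD_increment_cc le_ab
  (fun t ht => mollified_derive xi d0 MB (inab t ht))
  (fun t ht => der_bound t (inab t ht)).
move=> H; apply: le_trans H _.
have K0 : 0 <= K.
  have := HK 1 (fun=> 0); rewrite ler01 lexx mul1r => /(_ isT) H.
  have := le_trans (mulr_ge0 (normc_ge0 _) (normr_ge0 _)) H.
  by rewrite pmulr_lge0 ?mul1r // wprod_gt0.
rewrite [leRHS](_ : _ = 2 * (`|c| * ((2 * pi) ^+ n * (d * K * M))) * (b - a)); last by ring.
rewrite ler_wpM2l //; last by lra.
by rewrite ?mulr_ge0 ?exprn_ge0 ?mulr_ge0 ?pi_ge0 // ltW.
Qed.

(** As the width [d] tends to 0, the mollified values tend to a nonzero constant times [propagated],
    while their increment is of order [d]. *)
Lemma propagated_const M a b xi : a <= b ->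
  (forall t, a <= t <= b -> bounded_hat M t) -> propagated xi a = propagated xi b.
Proof.
rewrite le_eqVlt => /orP[/eqP -> //|ab MB].
have [K HK] := mollified_increment xi ab MB.
pose d (k : nat) : R := k.+1%:R^-1.
have d0 : d @ \oo --> (0 : R) by exact: cvg_harmonic.
have := cvgCD (mollified_cvg xi b d0) (cvgCN (mollified_cvg xi a d0)).
rewrite -mulrBr => /cvgC_normc lim.
have lim0 : (fun k => normc (mollified (d k) xi b - mollified (d k) xi a)) @ \oo --> 0.
  have z : (fun k => d k * K) @ \oo --> (0 : R).
    by rewrite -[X in _ --> X](mul0r K); apply: cvgMl.
  apply: (squeeze_cvgr _ (cvg_cst 0) z).
  apply: filterE => k; rewrite normc_ge0 /= HK // invr_gt0 ltr0n /=.
  by rewrite invf_le1 ?ltr0n // ler1n.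
have /eqP : normc ((\prod_(j <- vars) (Num.sqrt pi)%:C) *
    (propagated xi b - propagated xi a)) = 0 by exact: (cvg_unique _ lim lim0).
rewrite normcM mulf_eq0 normc_prod => /orP[|].
  rewrite prodf_seq_eq0 => /hasP[j _ /=].
  rewrite normcR normr_eq0 sqrtr_eq0 => h.
  by have := @pi_gt0 R; rewrite ltNge h.
by rewrite normc_eq0 subr_eq0 => /eqP ->.
Qed.

(** * Times with locally uniform bounds, and the Baire argument *)

Definition good t : Prop := exists2 eps, 0 < eps &
  exists M, forall s, `|s - t| < eps -> bounded_hat M s.

Lemma good_open t : good t -> exists2 eps, 0 < eps &
  forall s, `|s - t| < eps -> good s.
Proof.
move=> [eps e0 [M HM]]; exists (eps / 2); first by rewrite divr_gt0.
move=> s st; exists (eps / 2); first by rewrite divr_gt0.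
exists M => r rs; apply: HM; rewrite (le_lt_trans (ler_distD s _ _)) //.
by rewrite [ltRHS]splitr ltrD.
Qed.

Lemma good_derive xi t : good t -> isD (propagated xi) t 0.
Proof.
move=> [eps e0 [M HM]]; apply: (isD_seq e0) => h h0 hc.
under eq_fun => k.
  have -> : propagated xi (t + h k) = propagated xi t.
    have [tk|tk] := leP t (t + h k).
      apply/esym/(@propagated_const M) => // s /andP[s1 s2]; apply: HM.
      rewrite ger0_norm ?subr_ge0 //; have := (h0 k).2.
      rewrite ger0_norm; last by rewrite lerDl in tk.
      by apply: le_lt_trans; rewrite lerBlDl.
    apply: (@propagated_const M); first exact: ltW.
    move=> s /andP[s1 s2]; apply: HM.
    rewrite ler0_norm ?subr_le0 //; have := (h0 k).2.
    rewrite ltr0_norm; last by rewrite gtrDl in tk.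
    by apply: le_lt_trans; rewrite opprB lerBlDl -lerBlDr opprK.
  rewrite subrr mulr0; over.
exact: cvgC_cst.
Qed.

(** The endpoints may be bad. Inside, [propagated] is constant, so the modulus of the transform is
    the one at the midpoint and the bound there holds on the whole open interval. With the
    individual bounds at [a] and [b] this gives a common bound on the closed interval. *)
Lemma good_interval a b xi : a < b -> (forall t, a < t < b -> good t) ->
  propagated xi a = propagated xi b.
Proof.
move=> ab gd; pose m := (a + b) / 2.
have am : a < m by rewrite /m midf_lt.
have mb : m < b by rewrite /m midf_lt.
have cm y t : a < t < b -> propagated y t = propagated y m.
  move=> /andP[t1 t2]; have [tm|mt] := leP t m.
    have := @isD_increment_cc R (propagated y) (fun=> 0) t m 0 tm.
    move=> /(_ _ _); rewrite mulr0 mul0r => H; apply/esym/eqP.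
    rewrite -subr_eq0 -normc_eq0 eq_le normc_ge0 andbT; apply: H => s.
      rewrite in_itv /= => /andP[s1 s2]; apply: good_derive; apply: gd.
      by rewrite (lt_le_trans t1 s1) (le_lt_trans s2 mb).
    by rewrite normc0.
  have := @isD_increment_cc R (propagated y) (fun=> 0) m t 0 (ltW mt).
  move=> /(_ _ _); rewrite mulr0 mul0r => H; apply/eqP.
  rewrite -subr_eq0 -normc_eq0 eq_le normc_ge0 andbT; apply: H => s.
    rewrite in_itv /= => /andP[s1 s2]; apply: good_derive; apply: gd.
    by rewrite (lt_le_trans am s1) (le_lt_trans s2 t2).
  by rewrite normc0.
have nP y t : normc (propagated y t) = normc (FT (U t) y).
  by rewrite normcM normc_cis mul1r.
have [Ma Ha] := hatU a; have [Mb Hb] := hatU b; have [Mm Hm] := hatU m.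
apply: (@propagated_const (Num.max Mm (Num.max Ma Mb))); first exact: ltW.
move=> t; rewrite !le_eqVlt => /andP[/orP[/eqP <-|at_] /orP[/eqP tb|tb]].
- by apply: bounded_hat_le Ha; rewrite !le_max lexx orbT.
- by apply: bounded_hat_le Ha; rewrite !le_max lexx orbT.
- by rewrite tb; apply: bounded_hat_le Hb; rewrite !le_max lexx !orbT.
- have Hm' : bounded_hat (Num.max Mm (Num.max Ma Mb)) m.
    by apply: bounded_hat_le Hm; rewrite !le_max lexx.
  by move=> y; rewrite -nP cm ?at_ // nP.
Qed.

(** The second condition is what makes tame times a closed set: it is the majorant under which the
    transform passes to the limit in time. *)
Definition tame (N : R) t : Prop :=
  bounded_hat N t /\ forall e, normc (U t e) <= N * wprod vars e.

Lemma tame_exists t : exists N : nat, tame N%:R t.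
Proof.
have [C UC] := clsU t; have [M HM] := hatU t.
have [N _ HN] := nbhs_infty_ger (Num.max C M); exists N.
have := HN N (leqnn N); rewrite /= ge_max => /andP[CN MN]; split.
  exact: bounded_hat_le HM.
by move=> e; exact: (cls_le CN UC).2.
Qed.

Lemma tame_closed N (u : nat -> R) t : u @ \oo --> t ->
  (forall k, tame N (u k)) -> tame N t.
Proof.
move=> ut H; have cU e : cvgC (fun k => U (u k) e) (U t e).
  exact: (isD_scont1 (fun t => eqU t e)).
split=> [xi|e]; last exact: cvgC_le (cU e) (fun k => (H k).2 e).
have lim : cvgC (fun k => FT (U (u k)) xi) (FT (U t) xi).
  apply: (@FT_dct R n N) => // k; have [C UC] := clsU (u k).
  by split; [exact: UC.1|exact: (H k).2].
exact: cvgC_le lim (fun k => (H k).1 xi).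
Qed.

Lemma not_tame_open N t : ~ tame N t -> exists2 eps, 0 < eps &
  forall s, `|s - t| <= eps -> ~ tame N s.
Proof.
move=> nt; apply: contrapT => H; apply: nt.
have /choice[u Hu] : forall k : nat, exists s, `|s - t| <= k.+1%:R^-1 /\ tame N s.
  move=> k; apply: contrapT => Hk; apply: H; exists k.+1%:R^-1.
    by rewrite invr_gt0.
  by move=> s sk ts; apply: Hk; exists s.
apply: (@tame_closed N u) => [|k]; last exact: (Hu k).2.
have l1 : (fun k => t - harmonic k) @ \oo --> t.
  by rewrite -[X in _ --> X]subr0; apply: cvgB; [exact: cvg_cst|exact: cvg_harmonic].
have l2 : (fun k => t + harmonic k) @ \oo --> t.
  by rewrite -[X in _ --> X]addr0; apply: cvgD; [exact: cvg_cst|exact: cvg_harmonic].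
apply: (squeeze_cvgr _ l1 l2); apply: filterE => k.
by rewrite -ler_distl (Hu k).1.
Qed.

(* On a gap of the bad set [propagated] is constant, so a bound at an endpoint
   of the gap extends to the whole gap. *)
Lemma bad_portion r eps N : ~ good r -> 0 < eps ->
  exists2 s, `|s - r| < eps & ~ good s /\ ~ tame N s.
Proof.
move=> br e0; apply: contrapT => H.
have tb s : `|s - r| < eps -> ~ good s -> bounded_hat N s.
  move=> sr bs; apply: contrapT => ns; apply: H; exists s => //; split=> //.
  by case.
apply: (br); exists eps => //; exists N => t tr.
have [gt_|] := pselect (good t); last exact: tb.
have nP y s : normc (propagated y s) = normc (FT (U s) y).
  by rewrite normcM normc_cis mul1r.
suff [a ar [ba aP]] : exists2 a, `|a - r| < eps &
    ~ good a /\ forall y, propagated y a = propagated y t.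
  by move=> y; rewrite -nP -aP nP; exact: tb.
have [rt|tr'] := ltP r t.
  (* [sup S] is the left end of the gap around [t], the last bad time before it. It is itself bad
     because good times form an open set. *)
  pose S := [set s | s <= t /\ ~ good s].
  have rS : S r by split=> //; exact: ltW.
  have supS : has_sup S by split; [exists r|exists t => s []].
  have ubS := sup_upper_bound supS.
  have st : sup S <= t by apply: sup_le_ub => [|s []//]; exists r.
  have bs : ~ good (sup S).
    move=> /good_open[e1 e10 He1]; have [s Ss sS] := sup_adherent e10 supS.
    apply: Ss.2; apply: He1; have := ubS s Ss => ss.
    by rewrite ler0_norm ?subr_le0 // opprB ltrBlDr -ltrBlDl.
  exists (sup S).
    have rs := ubS r rS; rewrite ger0_norm ?subr_ge0 //.
    by apply: le_lt_trans tr; rewrite ger0_norm ?subr_ge0 ?lerD2r // ltW.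
  split=> // y; apply: good_interval => [|s /andP[s1 s2]].
    by rewrite lt_neqAle st andbT; apply/eqP => e; apply: bs; rewrite e.
  apply: contrapT => ns; have := ubS s (conj (ltW s2) ns).
  by rewrite leNgt s1.
pose S := [set s | t <= s /\ ~ good s].
have rS : S r by split.
have infS : has_inf S by split; [exists r|exists t => s []].
have lbS := ge_inf infS.2.
have st : t <= inf S by apply: lb_le_inf => [|s []//]; exists r.
have bs : ~ good (inf S).
  move=> /good_open[e1 e10 He1]; have [s Ss sS] := inf_adherent e10 infS.
  apply: Ss.2; apply: He1; have := lbS s Ss => ss.
  by rewrite ger0_norm ?subr_ge0 // ltrBlDl.
exists (inf S).
  have rs := lbS r rS; rewrite ler0_norm ?subr_le0 //.
  by apply: le_lt_trans tr; rewrite ler0_norm ?subr_le0 // lerN2 lerD2r.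
split=> // y; apply/esym; apply: good_interval => [|s /andP[s1 s2]].
  by rewrite lt_neqAle st andbT; apply/eqP => e; apply: bs; rewrite -e.
apply: contrapT => ns; have := lbS s (conj (ltW s1) ns).
by rewrite leNgt s2.
Qed.

(** Baire category by nested closed intervals centred at bad times: the interval of stage [k + 1]
    avoids the times that are tame with constant [k]. A common point of all intervals is tame with
    some constant [N], against stage [N + 1]. *)
Lemma all_good t : good t.
Proof.
apply: contrapT => bt.
have step (q : nat * (R * R)) : exists q' : R * R,
    ~ good q.2.1 -> 0 < q.2.2 -> [/\ ~ good q'.1, 0 < q'.2,
      q.2.1 - q.2.2 <= q'.1 - q'.2, q'.1 + q'.2 <= q.2.1 + q.2.2 &
      forall r, `|r - q'.1| <= q'.2 -> ~ tame q.1%:R r].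
  case: q => k [s e] /=.
  have [bs|] := pselect (~ good s); last by exists (0, 0).
  have [e0|] := pselect (0 < e); last by exists (0, 0).
  have [s' ss' [bs' nt]] := bad_portion k%:R bs e0.
  have [e1 e10 He1] := not_tame_open nt.
  exists (s', Num.min e1 (e - `|s' - s|)) => /= _ _.
  set m := Num.min _ _.
  have m1 : m <= e1 by rewrite ge_min lexx.
  have m2 : m <= e - `|s' - s| by rewrite ge_min lexx orbT.
  have := ler_norm (s' - s); have := ler_norm (- (s' - s)); rewrite normrN => n1 n2.
  split=> //; [by rewrite lt_min e10 subr_gt0|lra|lra|].
  by move=> r rs; apply: He1; exact: le_trans rs m1.
have [f Hf] := choice step.
pose st := fix st k := if k is k'.+1 then f (k', st k') else (t, 1 : R).
have inv k : ~ good (st k).1 /\ 0 < (st k).2.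
  elim: k => [|k [b0 e0]]; first by split=> //=; exact: ltr01.
  by have [] := Hf (k, st k) b0 e0.
pose lo k := (st k).1 - (st k).2; pose hi k := (st k).1 + (st k).2.
have lohi k : lo k <= hi k by rewrite /lo /hi; have := (inv k).2; lra.
have loS k : lo k <= lo k.+1 by have [] := Hf (k, st k) (inv k).1 (inv k).2.
have hiS k : hi k.+1 <= hi k by have [] := Hf (k, st k) (inv k).1 (inv k).2.
have lom : {homo lo : i j / (i <= j)%N >-> i <= j} by apply/nondecreasing_seqP.
have him : {homo hi : i j / (i <= j)%N >-> j <= i} by apply/nonincreasing_seqP.
have lh i j : lo i <= hi j.
  apply: le_trans (lom i (maxn i j) (leq_maxl _ _)) _.
  by apply: le_trans (lohi _) _; apply: him; exact: leq_maxr.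
have supS : has_sup (range lo).
  by split; [exists (lo 0%N); exists 0%N|exists (hi 0%N) => _ [i _ <-]].
have s1 k : lo k <= sup (range lo).
  by apply: sup_upper_bound => //; exists k.
have s2 k : sup (range lo) <= hi k.
  by apply: sup_le_ub; [exists (lo 0%N); exists 0%N|move=> _ [i _ <-]].
have [N HN] := tame_exists (sup (range lo)).
have [_ _ _ _ H] := Hf (N, st N) (inv N).1 (inv N).2.
apply: (H (sup (range lo))) HN.
by have := s1 N.+1; have := s2 N.+1; rewrite /lo /hi ler_distl /= => -> ->.
Qed.

Lemma propagated_invariant xi s t : propagated xi s = propagated xi t.
Proof.
wlog st : s t / s <= t.
  by move=> H; have [/H|/ltW /H] := leP s t.
move: st; rewrite le_eqVlt => /orP[/eqP -> //|st].
by apply: good_interval => // r _; exact: all_good.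
Qed.

End Evolution.

(** * Schwartz functions *)

Section SchwartzFourier.
Context {R : realType} (n : nat).
Local Notation env := (nat -> R).
Local Notation vars := (iota 0 n).
Implicit Types (f g : 'rV[R]_n -> R[i]) (e xi : env) (s : seq 'I_n) (j : 'I_n).

Definition rv e : 'rV[R]_n := \row_(j < n) e j.

Definition onenv f : env -> R[i] := fun e => f (rv e).

Lemma cvg_rv (u : nat -> env) e : econv u e -> rv (u k) @[k --> \oo] --> rv e.
Proof.
move=> ue A [B Bn sBA].
have : \forall k \near \oo, forall i, forall j, B i j (rv (u k) i j).
  apply: filter_forall => i; apply: filter_forall => j.
  have Bij := Bn i j; rewrite !mxE in Bij.
  have H : \forall k \near \oo, B i j (u k j) := ue j (B i j) Bij.
  by apply: filterS H => k; rewrite mxE.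
by apply: filterS => k Hk; exact: sBA.
Qed.

Lemma scont_onenv f : continuousC f -> scont (onenv f).
Proof.
move=> [c1 c2] u e ue; have uv := cvg_rv ue; split.
- exact: (cvg_comp _ _ uv (c1 (rv e))).
- exact: (cvg_comp _ _ uv (c2 (rv e))).
Qed.

Lemma local_onenv f : local n (onenv f).
Proof.
move=> a b ab; rewrite /onenv; congr f; apply/rowP => j; rewrite !mxE.
by apply: ab; rewrite mem_iota add0n /=.
Qed.

Lemma rv_upd e j (t : R) : rv (upd e j t) = (t - e j) *: delta_mx 0 j + rv e.
Proof.
apply/rowP => i; rewrite !mxE eqxx /= /upd.
have -> : ((i : nat) == j) = (i == j) by [].
by case: eqP => [->|_]; rewrite ?mulr1 ?subrK // mulr0 add0r.
Qed.

Lemma is_derive_rv (G : 'rV[R]_n -> R) e j : derivable G (rv e) (delta_mx 0 j) ->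
  is_derive (e j) 1 (fun t : R => G (rv (upd e j t))) ('D_(delta_mx 0 j) G (rv e)).
Proof.
move=> dG.
have E : (fun h : R => h^-1 *: (((fun t : R => G (rv (upd e j t))) \o shift (e j)) (h *: 1)
    - G (rv (upd e j (e j))))) =
  (fun h : R => h^-1 *: ((G \o shift (rv e)) (h *: delta_mx 0 j) - G (rv e))).
  apply/funext => h /=; congr (_ *: (G _ - G _)); last by rewrite upd_same.
  by rewrite rv_upd /GRing.scale /= mulr1 addrK.
by split; [rewrite /derivable E|rewrite /derive E].
Qed.

Lemma isD_pderiv f e j : derivableC f (rv e) (delta_mx 0 j) ->
  isD (fun t : R => onenv f (upd e j t)) (e j) (onenv (pderiv j f) e).
Proof.
move=> [d1 d2]; split.
- exact: (is_derive_rv (G := fun y => complex.Re (f y))).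
- exact: (is_derive_rv (G := fun y => complex.Im (f y))).
Qed.

Lemma wprod_ord e : wprod vars e = \prod_(i < n) wgt (e i).
Proof. by rewrite /wprod -[in LHS](subn0 n) -/(index_iota 0 n) big_mkord. Qed.

(** The product expands into a sum over subsets [A] of the monomials with exponent 2 on [A], each
    controlled by a Schwartz seminorm. *)
Lemma monomial_sum_bound f s : schwartz f -> exists C, forall e,
  (\prod_(i < n) (1 + e i ^+ 2)) * normc (onenv (pderivs s f) e) <= C.
Proof.
move=> [_ H].
have /choice[M HM] : forall A : {set 'I_n}, exists M : R, forall x,
   `|(monomial (fun i => if i \in A then 2%N else 0%N) x)%:C * pderivs s f x| <= M%:C.
  by move=> A; exact: H.
exists (\sum_(A in {set 'I_n}) M A) => e.
under eq_bigr do rewrite addrC.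
rewrite bigA_distr mulr_suml; apply: ler_sum => A _.
have := HM A (rv e); rewrite normc_normE lecR normcM normcR; apply: le_trans.
rewrite ler_wpM2r ?normc_ge0 // (le_trans _ (ler_norm _)) // /monomial.
rewrite le_eqVlt; apply/orP; left; apply/eqP; apply: eq_bigr => i _.
by rewrite mxE; case: ifP.
Qed.

Lemma cls_pderivs f s : schwartz f -> exists C, cls vars C (onenv (pderivs s f)).
Proof.
move=> Sf; have [C HC] := monomial_sum_bound s Sf; exists C; split.
  by apply: scont_onenv; exact: (Sf.1 s).1.
move=> e; rewrite wprod_ord.
have P0 : 0 < \prod_(i < n) (1 + e i ^+ 2) by apply: prodr_gt0 => i _; exact: oneDsqr_gt0.
rewrite -(ler_pM2l P0) (le_trans (HC e)) // mulrCA -big_split /=.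
rewrite big1 ?mulr1 // => i _; by rewrite mulrC wgtM.
Qed.

Lemma FT_pderivs f s xi : schwartz f ->
  FT n (onenv (pderivs s f)) xi = (\prod_(k <- s) ('i * (xi k)%:C)) * FT n (onenv f) xi.
Proof.
move=> Sf; elim: s => [|j s IH]; first by rewrite big_nil mul1r.
have [C HC] := cls_pderivs s Sf; have [C' HC'] := cls_pderivs (j :: s) Sf.
rewrite big_cons -mulrA -IH; apply: (FT_derive _ _ HC HC'); first exact: ltn_ord.
by move=> e; apply: isD_pderiv; exact: (Sf.1 s).2.
Qed.

(** Since [(1 + x ^+ 2) ^+ 2 <= 2 * (1 + x ^+ 4)], the product expands over subsets [A] into fourth
    powers of the coordinates in [A]; these come from four derivatives in each such direction, hence
    the fourfold list [sA]. *)
Lemma FT_decay f : schwartz f -> exists M, forall xi,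
  normc (FT n (onenv f) xi) <= M * wprod vars xi ^+ 2.
Proof.
move=> Sf.
pose sA (A : {set 'I_n}) := enum A ++ enum A ++ enum A ++ enum A.
have /choice[M HM] : forall A, exists M : R, forall xi,
    normc (FT n (onenv (pderivs (sA A) f)) xi) <= M.
  move=> A; have [C HC] := cls_pderivs (sA A) Sf.
  by exists ((2 * pi) ^+ n * C) => xi; exact: FT_bound.
exists (2 ^+ n * \sum_(A in {set 'I_n}) M A) => xi; rewrite wprod_ord.
have P0 : 0 < \prod_(i < n) (1 + xi i ^+ 2) ^+ 2.
  by apply: prodr_gt0 => i _; rewrite exprn_gt0 // oneDsqr_gt0.
have QW : (\prod_(i < n) (1 + xi i ^+ 2) ^+ 2) * (\prod_(i < n) wgt (xi i)) ^+ 2 = 1.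
  rewrite -prodrXl -big_split /= big1 // => i _.
  by rewrite -exprMn mulrC wgtM expr1n.
rewrite -(ler_pM2l P0) mulrCA QW mulr1.
apply: (@le_trans _ _ ((\prod_(i < n) (2 * (1 + xi i ^+ 4))) *
    normc (FT n (onenv f) xi))).
  rewrite ler_wpM2r ?normc_ge0 //; apply: ler_prod => i _; rewrite exprn_ge0 /=.
    have := sqr_ge0 (1 - xi i ^+ 2); rewrite (_ : xi i ^+ 4 = (xi i ^+ 2) ^+ 2).
      by rewrite !expr2; nra.
    by rewrite -exprM.
  by rewrite ltW // oneDsqr_gt0.
rewrite big_split /= prodr_const card_ord -mulrA ler_wpM2l ?exprn_ge0 //.
under eq_bigr do rewrite addrC.
rewrite bigA_distr mulr_suml; apply: ler_sum => A _.
apply: le_trans (HM A xi); rewrite FT_pderivs // normcM ler_wpM2r ?normc_ge0 //.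
rewrite le_eqVlt; apply/orP; left; apply/eqP.
rewrite -big_mkcond /= normc_prod /sA !big_cat /= -!expr2 -!exprS.
have -> : \prod_(i <- enum A) normc ('i * (xi i)%:C) = \prod_(i in A) `|xi i|.
  by rewrite big_enum /=; apply: eq_bigr => i _; rewrite normcM normci mul1r normcR.
rewrite -prodrXl; apply: eq_bigr => i _.
by rewrite -normrX ger0_norm // exprn_even_ge0.
Qed.

Lemma cls_sum_FT (I : Type) (r : seq I) (F : I -> env -> R[i]) (C : I -> R) :
  (forall i, cls vars (C i) (F i)) ->
  cls vars (\sum_(i <- r) C i) (fun e => \sum_(i <- r) F i e) /\
  forall xi, FT n (fun e => \sum_(i <- r) F i e) xi = \sum_(i <- r) FT n (F i) xi.
Proof.
move=> FC; elim: r => [|i r [IH1 IH2]].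
  split=> [|xi].
    split; first by move=> u e _; rewrite big_nil; under eq_fun do rewrite big_nil; exact: cvgC_cst.
    by move=> e; rewrite !big_nil normc0 mul0r.
  rewrite big_nil /FT -[RHS](@Ints_0 R vars (fun=> 0)); congr Ints.
  by apply/funext => e; rewrite big_nil mul0r.
have E : (fun e => \sum_(k <- i :: r) F k e) = (fun e => F i e + \sum_(k <- r) F k e).
  by apply/funext => e; rewrite big_cons.
rewrite E big_cons; split; first exact: clsD.
by move=> xi; rewrite big_cons -IH2 (FTD _ (FC i) IH1).
Qed.

Lemma laplacian_FT f : schwartz f ->
  (exists C, cls vars C (onenv (laplacian f))) /\
  forall xi, FT n (onenv (laplacian f)) xi = - (nrm2 n xi)%:C * FT n (onenv f) xi.
Proof.
move=> Sf; have /choice[C HC] : forall j : 'I_n, exists C,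
    cls vars C (onenv (pderivs [:: j; j] f)) by move=> j; exact: cls_pderivs.
have [H1 H2] := cls_sum_FT (index_enum 'I_n) HC.
split; first by exists (\sum_(i <- index_enum 'I_n) C i).
move=> xi; rewrite [LHS]H2.
under eq_bigr do rewrite (FT_pderivs _ _ Sf) !big_cons big_nil mulr1.
rewrite -mulr_suml; congr (_ * _).
rewrite nrm2E -[in RHS](subn0 n) -/(index_iota 0 n) big_mkord rmorph_sum -sumrN.
apply: eq_bigr => i _; rewrite mulrACA -expr2 sqr_i mulN1r rmorphXn expr2.
by [].
Qed.

Lemma schwartz_FT_eq0 f : schwartz f -> (forall xi, FT n (onenv f) xi = 0) ->
  forall x, f x = 0.
Proof.
move=> Sf f0 x; have [C HC] := cls_pderivs [::] Sf.
pose e : env := fun k => if insub k is Some i then x 0 i else 0.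
have -> : x = rv e by apply/rowP => i; rewrite mxE /e valK.
apply/eqP; rewrite -normc_eq0 eq_le normc_ge0 andbT.
apply: (FT_inversion_bound HC (@local_onenv f)) => xi.
by rewrite /= f0 normc0 mul0r.
Qed.

End SchwartzFourier.

(** * Evolution of the transform for the free Schrödinger equation *)

Section FreeEvolution.
Context {R : realType} (n : nat) (hbar m : R) (u : 'rV[R]_n -> R -> R[i]).
Hypothesis hbar0 : 0 < hbar.
Hypothesis Su : forall t, schwartz (fun x => u x t).
Hypothesis Eu : free_schrodinger hbar m u.

Lemma schrodinger_isD x t :
  isD (u x) t ('i * (hbar / (2 * m))%:C * laplacian (u ^~ t) x).
Proof.
have [[d1 d2] E] := Eu x t.
have : deriveC (u x) t 1 = 'i * (hbar / (2 * m))%:C * laplacian (u ^~ t) x.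
  have h : hbar%:C != 0 :> R[i] by rewrite eq_complex /= gt_eqF.
  have i0 : 'i * hbar%:C != 0 :> R[i].
    by rewrite mulf_neq0 // eq_complex /= oner_eq0 andbF.
  apply: (mulfI i0); rewrite E.
  have -> : hbar ^+ 2 / (2 * m) = hbar * (hbar / (2 * m)) by rewrite expr2 mulrA.
  rewrite rmorphM; set B := (hbar / (2 * m))%:C; set D := laplacian _ _.
  rewrite [RHS](_ : _ = 'i ^+ 2 * (hbar%:C * B * D)); last by ring.
  by rewrite sqr_i mulN1r.
by move=> <-; split; exact: derivableP.
Qed.

Lemma free_evolution_FT xi s t :
  cis (hbar / (2 * m) * nrm2 n xi * s) * FT n (onenv (u ^~ s)) xi =
  cis (hbar / (2 * m) * nrm2 n xi * t) * FT n (onenv (u ^~ t)) xi.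
Proof.
apply: (@propagated_invariant R n (hbar / (2 * m)) (fun t => onenv (u ^~ t))
  (fun t => onenv (laplacian (u ^~ t)))).
- by move=> r; exact: (cls_pderivs [::] (Su r)).
- by move=> r; exact: (laplacian_FT (Su r)).1.
- by move=> r; exact: local_onenv.
- by move=> r; exact: local_onenv.
- by move=> r e; exact: schrodinger_isD.
- by move=> r y; exact: (laplacian_FT (Su r)).2.
- by move=> r; exact: FT_decay.
Qed.

End FreeEvolution.

(** * Maximum principle and Phragmén–Lindelöf in the logarithmic plane *)

Section PhragmenLindelof.
Context {R : realType}.
Local Notation Re := complex.Re.
Local Notation Im := complex.Im.
Implicit Types (g h : R -> R -> R[i]) (s t phi C D M : R).

(* [g s phi] stands for a function of [w = s + i phi], with complex
   derivative [dg]. *)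
Definition hol g dg : Prop := forall s phi,
  isD (fun t => g t phi) s (dg s phi) /\ isD (g s) phi ('i * dg s phi).

(** Joint continuity is recorded separately: [hol] speaks only of the two partial derivatives,
    whereas attaining a maximum on a rectangle takes both variables at once. *)
Definition cont2 g : Prop := forall (u v : nat -> R) s phi,
  u @ \oo --> s -> v @ \oo --> phi -> cvgC (fun k => g (u k) (v k)) (g s phi).

Lemma hol_cst c : hol (fun _ _ => c) (fun _ _ => 0).
Proof. by move=> s phi; rewrite mulr0; split; exact: isD_cst. Qed.

Definition logz s phi : R[i] := s%:C + 'i * phi%:C.

Lemma hol_logz : hol logz (fun _ _ => 1).
Proof.
move=> s phi; split.
- have := isDD (isD_linear 1 s) (isD_cst ('i * phi%:C) s).
  by rewrite addr0; under eq_fun do rewrite mul1r.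
- have := isDD (isD_cst s%:C phi) (isD_linear 'i phi).
  by rewrite add0r mulr1.
Qed.

Lemma holD g h dg dh : hol g dg -> hol h dh ->
  hol (fun s phi => g s phi + h s phi) (fun s phi => dg s phi + dh s phi).
Proof.
move=> Hg Hh s phi; have [g1 g2] := Hg s phi; have [h1 h2] := Hh s phi.
by rewrite mulrDr; split; exact: isDD.
Qed.

Lemma holM g h dg dh : hol g dg -> hol h dh ->
  hol (fun s phi => g s phi * h s phi)
      (fun s phi => dg s phi * h s phi + g s phi * dh s phi).
Proof.
move=> Hg Hh s phi; have [g1 g2] := Hg s phi; have [h1 h2] := Hh s phi.
split; first exact: isDM.
by have := isDM g2 h2; congr isD; ring.
Qed.

Lemma hol_cexp g dg : hol g dg ->
  hol (fun s phi => cexp (g s phi)) (fun s phi => dg s phi * cexp (g s phi)).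
Proof.
move=> Hg s phi; have [g1 g2] := Hg s phi; rewrite mulrA.
by split; exact: isD_cexp.
Qed.

Lemma cont2_cst c : cont2 (fun _ _ => c).
Proof. by move=> *; exact: cvgC_cst. Qed.

Lemma cont2_logz : cont2 logz.
Proof.
move=> u v s phi us vp; apply: cvgCD; first exact: cvgCR.
by apply: cvgCM; [exact: cvgC_cst|exact: cvgCR].
Qed.

Lemma cont2D g h : cont2 g -> cont2 h -> cont2 (fun s phi => g s phi + h s phi).
Proof. by move=> cg ch u v s phi us vp; apply: cvgCD; [exact: cg|exact: ch]. Qed.

Lemma cont2M g h : cont2 g -> cont2 h -> cont2 (fun s phi => g s phi * h s phi).
Proof. by move=> cg ch u v s phi us vp; apply: cvgCM; [exact: cg|exact: ch]. Qed.

Lemma cont2_cexp g : cont2 g -> cont2 (fun s phi => cexp (g s phi)).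
Proof. by move=> cg u v s phi us vp; apply: cvgC_cexp; exact: cg. Qed.

(* What the maximum principle below needs of a holomorphic function. *)
Definition entire g : Prop :=
  (exists dg, hol g dg /\ exists ddg, hol dg ddg) /\ cont2 g.

Lemma entire_cst c : entire (fun _ _ => c).
Proof.
split; last exact: cont2_cst.
exists (fun _ _ => 0); split; first exact: hol_cst.
by exists (fun _ _ => 0); exact: hol_cst.
Qed.

Lemma entire_logz : entire logz.
Proof.
split; last exact: cont2_logz.
exists (fun _ _ => 1); split; first exact: hol_logz.
by exists (fun _ _ => 0); exact: hol_cst.
Qed.

Lemma entireD g h : entire g -> entire h -> entire (fun s phi => g s phi + h s phi).
Proof.
move=> [[dg [g1 [ddg g2]]] cg] [[dh [h1 [ddh h2]]] ch]; split; last exact: cont2D.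
exists (fun s phi => dg s phi + dh s phi); split; first exact: holD.
by exists (fun s phi => ddg s phi + ddh s phi); exact: holD.
Qed.

Lemma entireM g h : entire g -> entire h -> entire (fun s phi => g s phi * h s phi).
Proof.
move=> [[dg [g1 [ddg g2]]] cg] [[dh [h1 [ddh h2]]] ch]; split; last exact: cont2M.
eexists; split; first exact: (holM g1 h1).
by eexists; exact: (holD (holM g2 h1) (holM g1 h2)).
Qed.

Lemma entire_cexp g : entire g -> entire (fun s phi => cexp (g s phi)).
Proof.
move=> [[dg [g1 [ddg g2]]] cg]; split; last exact: cont2_cexp.
eexists; split; first exact: (hol_cexp g1).
by eexists; exact: (holM g2 (hol_cexp g1)).
Qed.

(** * Maximum principle on rectangles *)

Lemma second_derivative_test (p p1 : R -> R) (x d e : R) : 0 < e ->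
  (forall t, is_derive t 1 p (p1 t)) -> is_derive x 1 p1 d ->
  (forall t, `|t - x| < e -> p t <= p x) -> d <= 0.
Proof.
move=> e0 dp dp1 mx; rewrite leNgt; apply/negP => d0.
have xI : x \in `]x - e, x + e[%R by rewrite in_itv /= ltrBlDr !ltrDl e0.
have p1x : p1 x = 0.
  have le : x - e <= x + e by lra.
  have := @derive1_at_max R p (x - e) (x + e) x le (fun t _ => @ex_derive _ _ _ _ _ _ _ (dp t)) xI.
  move=> H; have {}H : is_derive x 1 p 0.
    apply: H => t; rewrite in_itv /= => /andP[t1 t2]; apply: mx.
    by rewrite ltr_norml; apply/andP; split; lra.
  by rewrite -(derive_val (is_derive:=dp x)) (derive_val (is_derive:=H)).
have q : (fun h : R => h^-1 *: ((p1 \o shift x) (h *: (1 : R)) - p1 x)) @ 0^' --> d.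
  by case: dp1 => + <-.
have [r /= r0 Hr] := cvgr_gt _ q _ d0.
pose y := x + Num.min (r / 2) (e / 2).
have m0 : 0 < Num.min (r / 2) (e / 2) by rewrite lt_min !divr_gt0.
have mr : Num.min (r / 2) (e / 2) < r.
  by rewrite (le_lt_trans (_ : _ <= r / 2)) ?ge_min ?lexx //; lra.
have me : Num.min (r / 2) (e / 2) < e.
  by rewrite (le_lt_trans (_ : _ <= e / 2)) ?ge_min ?lexx ?orbT //; lra.
have xy : x < y by rewrite ltrDl.
have [z zI E] := @MVT R p p1 x y xy (fun t _ => dp t)
  (derivable_within_continuous (fun t _ => @ex_derive _ _ _ _ _ _ _ (dp t))).
move: zI; rewrite in_itv /= => /andP[xz zy].
have zr : `|0 - (z - x)| < r.
  rewrite sub0r normrN gtr0_norm ?subr_gt0 //; rewrite /y in zy; lra.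
have := Hr (z - x) zr; rewrite subr_eq0 gt_eqF // => /(_ isT).
rewrite /= /GRing.scale /= mulr1 subrK p1x subr0 => h.
have p1z : 0 < p1 z by move: h; rewrite pmulr_rgt0 // invr_gt0 subr_gt0.
have : p y <= p x.
  by apply: mx; rewrite /y addrC addKr gtr0_norm.
by rewrite leNgt -subr_gt0 E mulr_gt0 // subr_gt0.
Qed.

Lemma cont2_continuous g :
  cont2 g -> continuous (fun p : R * R => normc (g p.1 p.2)).
Proof.
move=> cg p; apply: contrapT => nc.
have [e e0 He] : exists2 e, 0 < e & forall k : nat, exists q : R * R,
    [/\ `|q.1 - p.1| <= k.+1%:R^-1, `|q.2 - p.2| <= k.+1%:R^-1 &
        e <= `|normc (g p.1 p.2) - normc (g q.1 q.2)|].
  apply: contrapT => H; apply: nc; apply/cvgrPdist_lt => e e0.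
  apply: contrapT => He; apply: H; exists e => // k.
  apply: contrapT => Hq; apply: He.
  have k0 : 0 < k.+1%:R^-1 :> R by rewrite invr_gt0.
  exists (ball p.1 k.+1%:R^-1, ball p.2 k.+1%:R^-1).
    by split=> /=; exact: nbhsx_ballx.
  move=> q [/= q1 q2]; rewrite ltNge; apply/negP => qe; apply: Hq; exists q.
  split=> //; rewrite distrC ltW //.
have /choice[q Hq] := He.
have cv (f : nat -> R) l : (forall k, `|f k - l| <= k.+1%:R^-1) -> f @ \oo --> l.
  move=> fl.
  have l1 : (fun k => l - harmonic k) @ \oo --> l.
    by rewrite -[X in _ --> X]subr0; apply: cvgB; [exact: cvg_cst|exact: cvg_harmonic].
  have l2 : (fun k => l + harmonic k) @ \oo --> l.
    by rewrite -[X in _ --> X]addr0; apply: cvgD; [exact: cvg_cst|exact: cvg_harmonic].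
  apply: (squeeze_cvgr _ l1 l2); apply: filterE => k.
  by rewrite -ler_distl.
have c1 : (fun k => (q k).1) @ \oo --> p.1 by apply: cv => k; have [] := Hq k.
have c2 : (fun k => (q k).2) @ \oo --> p.2 by apply: cv => k; have [] := Hq k.
have := cvgC_normc (cg _ _ _ _ c1 c2) => /cvgrPdist_lt /(_ e e0) [N _ HN].
by have := HN N (leqnn N); have [_ _] := Hq N; rewrite leNgt => /negP h /h.
Qed.

(** At an interior maximum of [|g|^2 + e * s ^+ 2] both pure second derivatives are nonpositive. By
    the Cauchy-Riemann relations the terms in the second derivative of [g] cancel in their sum,
    leaving [4 * |dg|^2 + 2 * e], which is positive. *)
Lemma no_interior_max g dg ddg (e d s phi : R) : hol g dg -> hol dg ddg ->
  0 < e -> 0 < d ->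
  (forall t, `|t - s| < d ->
     normc (g t phi) ^+ 2 + e * t ^+ 2 <= normc (g s phi) ^+ 2 + e * s ^+ 2) ->
  (forall t, `|t - phi| < d -> normc (g s t) ^+ 2 <= normc (g s phi) ^+ 2) -> False.
Proof.
move=> h1 h2 e0 d0 m1 m2.
have der (f df : R -> R[i]) : (forall t, isD f t (df t)) -> forall t,
    is_derive t 1 (fun t => normc (f t) ^+ 2)
      (2 * (Re (f t) * Re (df t) + Im (f t) * Im (df t))).
  move=> fd t; have [d1 d2] := fd t.
  under eq_fun do rewrite normc_sqr.
  by apply: is_derive_eq; rewrite /GRing.scale /=; ring.
have der2 (f df ddf : R -> R[i]) t : isD f t (df t) -> isD df t (ddf t) ->
    is_derive t 1 (fun t => 2 * (Re (f t) * Re (df t) + Im (f t) * Im (df t)))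
      (2 * (normc (df t) ^+ 2 + Re (f t) * Re (ddf t) + Im (f t) * Im (ddf t))).
  move=> [d1 d2] [d3 d4]; apply: is_derive_eq.
  by rewrite normc_sqr /GRing.scale /=; ring.
have A1 := der (fun t => g t phi) (fun t => dg t phi) (fun t => (h1 t phi).1).
have A2 := der2 (fun t => g t phi) (fun t => dg t phi) (fun t => ddg t phi) s
  (h1 s phi).1 (h2 s phi).1.
have B1 := der (g s) (fun t => 'i * dg s t) (fun t => (h1 s t).2).
have B2 := der2 (g s) (fun t => 'i * dg s t) (fun t => 'i * ('i * ddg s t)) phi
  (h1 s phi).2 (isDZ 'i (h2 s phi).2).
have S1 : 2 * (normc (dg s phi) ^+ 2 + Re (g s phi) * Re (ddg s phi) +
    Im (g s phi) * Im (ddg s phi)) + 2 * e <= 0.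
  apply: (@second_derivative_test (fun t => normc (g t phi) ^+ 2 + e * t ^+ 2)
    (fun t => 2 * (Re (g t phi) * Re (dg t phi) + Im (g t phi) * Im (dg t phi)) +
      2 * e * t) s _ d d0) => //.
  - move=> t; have := A1 t => At; apply: is_derive_eq.
    by rewrite /GRing.scale /=; ring.
  - by apply: is_derive_eq; rewrite /GRing.scale /=; ring.
have S2 := @second_derivative_test _ _ phi _ d d0 B1 B2 m2.
move: S1 S2; rewrite normcM normci mul1r !mulrA -expr2 sqr_i mulN1r cReN cImN.
have := sqr_ge0 (normc (dg s phi)).
rewrite !mulrN; set a := normc _ ^+ 2; set b := Re (g _ _) * _.
by set c := Im (g _ _) * _; lra.
Qed.

Lemma maximum_principle g (a b c d M : R) : a < b -> c < d -> entire g ->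
  (forall s, a <= s <= b -> normc (g s c) <= M /\ normc (g s d) <= M) ->
  (forall phi, c <= phi <= d -> normc (g a phi) <= M /\ normc (g b phi) <= M) ->
  forall s phi, a <= s <= b -> c <= phi <= d -> normc (g s phi) <= M.
Proof.
move=> ab cd [[dg [h1 [ddg h2]]] cg] H1 H2 s phi sab pcd.
have M0 : 0 <= M.
  by apply: le_trans (H2 phi pcd).1; exact: normc_ge0.
suff key e : 0 < e -> normc (g s phi) ^+ 2 <= M ^+ 2 + e * (a ^+ 2 + b ^+ 2).
  rewrite -(@ler_pXn2r _ 2) ?nnegrE ?normc_ge0 //.
  have B0 : 0 < 1 + (a ^+ 2 + b ^+ 2) by rewrite ltr_pwDl // addr_ge0 // sqr_ge0.
  apply/ler_addgt0Pr => e e0.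
  apply: le_trans (key (e / (1 + (a ^+ 2 + b ^+ 2))) _) _; first by rewrite divr_gt0.
  rewrite lerD2l -mulrA ler_piMr ?(ltW e0) // mulrC ler_pdivrMr // mul1r.
  by rewrite lerDr.
move=> e0.
pose A : set (R * R) := `[a, b]%classic `*` `[c, d]%classic.
pose v (p : R * R) := normc (g p.1 p.2) ^+ 2 + e * p.1 ^+ 2.
have cv : continuous v.
  move=> p; apply: cvgD.
    by rewrite expr2; under eq_fun do rewrite expr2; apply: cvgM; exact: cont2_continuous.
  apply: cvgMr; rewrite expr2; under eq_fun do rewrite expr2.
  by apply: cvgM; exact: cvg_fst.
have cA : compact A by apply: compact_setX; exact: segment_compact.
have A0 : A !=set0 by exists (s, phi); split=> /=; rewrite in_itv.
have [[s0 p0]] := compact_EVT_max A0 cA (continuous_subspaceT cv).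
rewrite inE => -[/= sI pI] vmax.
move: (sI) (pI); rewrite !in_itv /= => sab0 pcd0.
have vsp : v (s, phi) <= v (s0, p0).
  by apply: vmax; rewrite inE; split; rewrite /= in_itv.
apply: (@le_trans _ _ (v (s0, p0))).
  by apply: le_trans vsp; rewrite /v lerDl mulr_ge0 ?sqr_ge0 // ltW.
rewrite /v /=; have bd : normc (g s0 p0) <= M.
  move: (sab0) (pcd0) => /andP[]; rewrite le_eqVlt => /orP[/eqP <- _|as0].
    by move=> /H2 [].
  rewrite le_eqVlt => /orP[/eqP -> /H2 []//|s0b].
  move=> /andP[]; rewrite le_eqVlt => /orP[/eqP <- _|cp0].
    by have [] := H1 _ sab0.
  rewrite le_eqVlt => /orP[/eqP ->|p0d]; first by have [] := H1 _ sab0.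
  exfalso; pose dd := Num.min (Num.min (s0 - a) (b - s0)) (Num.min (p0 - c) (d - p0)).
  have dd0 : 0 < dd by rewrite !lt_min !subr_gt0 as0 s0b cp0 p0d.
  apply: (no_interior_max (s := s0) (phi := p0) h1 h2 e0 dd0) => t.
    rewrite !lt_min => /andP[/andP[t1 t2] _].
    apply: (vmax (t, p0)); rewrite inE; split=> //=; rewrite in_itv /=.
    by move: t1 t2; rewrite !ltr_norml => /andP[? ?] /andP[? ?]; apply/andP; split; lra.
  rewrite !lt_min => /andP[_ /andP[t1 t2]].
  have : v (s0, t) <= v (s0, p0).
    apply: vmax; rewrite inE; split=> //=; rewrite in_itv /=.
    by move: t1 t2; rewrite !ltr_norml => /andP[? ?] /andP[? ?]; apply/andP; split; lra.
  by rewrite /v /= lerD2r.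
rewrite lerD //; first by rewrite ler_pXn2r ?nnegrE ?normc_ge0.
rewrite ler_wpM2l ?(ltW e0) //; move: sab0 => /andP[? ?].
have [s00|s00] := leP 0 s0.
  by rewrite (le_trans (_ : _ <= b ^+ 2)) ?lerDr ?sqr_ge0 // ler_sqr ?nnegrE //; lra.
rewrite (le_trans (_ : _ <= a ^+ 2)) ?lerDl ?sqr_ge0 //.
by rewrite -sqrrN -[leRHS]sqrrN ler_sqr ?nnegrE; lra.
Qed.

(** * Phragmén-Lindelöf in strips and sectors *)

Lemma ler_mul_expR_small (x C : R) : 0 <= C ->
  (forall e, 0 < e -> x <= C * expR e) -> x <= C.
Proof.
move=> C0 H.
have lim : (fun k => C * expR (harmonic k)) @ \oo --> C.
  rewrite -[X in _ --> X]mulr1 -expR0; apply: cvgMr.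
  apply: (@cvg_comp _ _ _ (fun k => harmonic k : R) expR); first exact: cvg_harmonic.
  exact: continuous_expR.
have <- := cvg_lim (@Rhausdorff R) lim.
apply: limr_ge; first by apply/cvg_ex; exists C.
by apply: filterE => k; apply: H; rewrite invr_gt0.
Qed.

(** In the variable z = exp w this is the modulus of exp ((a - i b) z^2). The exponents
    [a * cos (2 * phi) + b * sin (2 * phi)] are the sinusoidal indicators against which functions of
    order 2 are compared. *)
Lemma normc_cexp_cexp (a b s phi : R) :
  normc (cexp ((a -i* b) * cexp (2%:C * logz s phi))) =
  expR ((a * cos (2 * phi) + b * sin (2 * phi)) * expR (2 * s)).
Proof.
rewrite normc_cexp cReM cexpE /= !(mul0r, mulr0, subr0, addr0, mul1r, add0r, oppr0).
by congr expR; ring.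
Qed.

(** The auxiliary factor has modulus [expR (- (del * expR (rho * s) * cos (rho * (phi - pm))))]. The
    condition [2 < rho] makes it beat the growth on the far right, and the upper bound on [rho]
    keeps the cosine positive on the strip. On the far left the growth bound is already close to
    [C]. *)
Lemma strip_Phragmen_Lindelof g phi1 phi2 rho C D : entire g ->
  phi1 < phi2 -> 2 < rho -> rho * (phi2 - phi1) < pi -> 0 <= C -> 0 <= D ->
  (forall s phi, phi1 <= phi <= phi2 -> normc (g s phi) <= C * expR (D * expR (2 * s))) ->
  (forall s, normc (g s phi1) <= C /\ normc (g s phi2) <= C) ->
  forall s phi, phi1 <= phi <= phi2 -> normc (g s phi) <= C.
Proof.
move=> eg p12 rho2 rhopi C0 D0 gD gC s0 p0 p0I.
apply: ler_mul_expR_small => // e e0.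
pose pm := (phi1 + phi2) / 2.
pose kap := rho * ((phi2 - phi1) / 2).
have rho0 : 0 < rho by lra.
have kap0 : 0 <= kap by rewrite mulr_ge0 ?divr_ge0 // ?subr_ge0 ltW.
have kappi : kap < pi / 2 by rewrite /kap mulrA ltr_pM2r // invr_gt0.
pose q := cos kap.
have q0 : 0 < q by apply: cos_gt0_pihalf; rewrite kappi andbT; have := @pi_gt0 R; lra.
have cosq phi : phi1 <= phi <= phi2 -> q <= cos (rho * (phi - pm)).
  move=> /andP[h1 h2].
  have ab : `|rho * (phi - pm)| <= kap.
    rewrite normrM gtr0_norm // /kap ler_wpM2l ?(ltW rho0) // ler_norml /pm.
    by apply/andP; split; lra.
  have cabs (y : R) : cos `|y| = cos y by case: (ger0P y) => // _; rewrite cosN.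
  rewrite -[cos (rho * _)]cabs /q.
  move: (ab); rewrite le_eqVlt => /orP[/eqP -> //|abl].
  have pi0 := @pi_gt0 R; rewrite ltW // ltr_cos // in_itv /= ?normr_ge0 ?kap0 /=; lra.
(* Half of the allowed loss [e] pays for the auxiliary factor at [s0]; the other half pays for the
   growth bound on the left edge of the rectangle. *)
have [del del0 delE] : exists2 del : R, 0 < del & del * expR (rho * s0) = e / 2.
  exists (e / 2 / expR (rho * s0)); first by rewrite !divr_gt0 // expR_gt0.
  by rewrite divfK // gt_eqF // expR_gt0.
pose F (s phi : R) : R[i] := cexp ((- del)%:C * cexp (rho%:C * (logz s phi + (- ('i * pm%:C))))).
have eF : entire F.
  apply: entire_cexp; apply: entireM; first exact: entire_cst.
  apply: entire_cexp; apply: entireM; first exact: entire_cst.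
  by apply: entireD; [exact: entire_logz|exact: entire_cst].
have nF s phi : normc (F s phi) = expR (- (del * expR (rho * s) * cos (rho * (phi - pm)))).
  rewrite normc_cexp cReM cexpE /= !(mul0r, mulr0, subr0, addr0, mul1r, add0r, oppr0).
  by congr expR; ring.
have nF1 s phi : phi1 <= phi <= phi2 -> normc (F s phi) <= 1.
  move=> pI; rewrite nF expR_le1 oppr_le0 mulr_ge0 //; last first.
    exact: le_trans (ltW q0) (cosq _ pI).
  by rewrite mulr_ge0 ?expR_ge0 ?(ltW del0).
(* The three lower bounds on [S] put [s0] in the rectangle, let the factor win on the right edge,
   and make the growth on the left edge at most [expR (e / 2)]. *)
have [S [S1 S2 S3]] : exists S : R, [/\ `|s0| + 1 <= S,
    D / (del * q * (rho - 2)) <= S & 2 * D / e <= S].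
  exists (Num.max (`|s0| + 1) (Num.max (D / (del * q * (rho - 2))) (2 * D / e))).
  by rewrite !le_max !lexx !orbT.
have S0 : 0 < S by rewrite (lt_le_trans _ S1) // ltr_wpDl.
have big : D * expR (2 * S) <= del * expR (rho * S) * q.
  have -> : rho * S = 2 * S + (rho - 2) * S by ring.
  rewrite expRD.
  have h : D <= del * q * expR ((rho - 2) * S).
    have r2 : 0 < rho - 2 by lra.
    have dq : 0 < del * q by rewrite mulr_gt0.
    move: S2; rewrite ler_pdivrMr ?mulr_gt0 // => h.
    rewrite (le_trans h) // [leLHS](_ : _ = del * q * ((rho - 2) * S)); last by ring.
    rewrite ler_wpM2l ?(ltW dq) // (le_trans _ (expR_ge1Dx _)) //.
    by rewrite lerDr.
  rewrite [leRHS](_ : _ = del * q * expR ((rho - 2) * S) * expR (2 * S)); last by ring.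
  by rewrite ler_wpM2r ?expR_ge0.
have small : D * expR (2 * - S) <= e / 2.
  rewrite mulrN expRN ler_pdivrMr ?expR_gt0 //.
  have h : 1 + 2 * S <= expR (2 * S) by exact: expR_ge1Dx.
  have h3 : D <= e / 2 * S by move: S3; rewrite ler_pdivrMr // => ?; lra.
  apply: le_trans (_ : e / 2 * (1 + 2 * S) <= _); last first.
    by rewrite ler_wpM2l // ltW // divr_gt0.
  have : 0 <= e / 2 * S by rewrite mulr_ge0 // ltW // divr_gt0.
  by rewrite mulrDr mulr1 [2 * S]mulrC mulrA; lra.
have C1 : C <= C * expR (e / 2).
  rewrite ler_peMr // (le_trans _ (expR_ge1Dx _)) // lerDl ltW // divr_gt0 //.
have Ss : - S <= s0 <= S.
  by rewrite -ler_norml (le_trans _ S1) // lerDl.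
have NS : - S < S by lra.
have := @maximum_principle (fun s phi => g s phi * F s phi) (- S) S phi1 phi2
  (C * expR (e / 2)) NS p12 (entireM eg eF) _ _ s0 p0 Ss p0I => /(_ _ _) H.
have {}H : normc (g s0 p0 * F s0 p0) <= C * expR (e / 2).
  apply: H => [s sS|phi pI].
    rewrite !normcM; split; rewrite (le_trans _ C1) //.
      rewrite -[leRHS]mulr1 ler_pM ?normc_ge0 ?(gC s).1 // nF1 //.
      by rewrite lexx ltW.
    rewrite -[leRHS]mulr1 ler_pM ?normc_ge0 ?(gC s).2 // nF1 //.
    by rewrite lexx ltW.
  rewrite !normcM; split.
    rewrite -[leRHS]mulr1 ler_pM ?normc_ge0 ?nF1 // (le_trans (gD _ _ pI)) //.
    by rewrite ler_wpM2l // ler_expR.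
  rewrite (le_trans _ C1) //.
  apply: le_trans (ler_wpM2r (normc_ge0 _) (gD S phi pI)) _.
  rewrite nF -[leLHS]mulrA -expRD ler_piMr // expR_le1 subr_le0 (le_trans big) //.
  rewrite ler_wpM2l ?cosq // mulr_ge0 ?expR_ge0 ?(ltW del0) //.
have F0 : expR (- (e / 2)) <= normc (F s0 p0).
  rewrite nF ler_expR lerN2.
  by rewrite delE ler_piMr ?cos_le1 // ltW // divr_gt0.
rewrite -(ler_pM2r (expR_gt0 (- (e / 2)))) -mulrA -expRD.
have -> : e + - (e / 2) = e / 2 by field.
rewrite (le_trans _ H) // normcM ler_wpM2l ?normc_ge0 //.
Qed.

(** The exponents [h1] and [h2] on the two rays are interpolated by the unique [H] of the form
    [a * cos (2 * p) + b * sin (2 * p)]. Dividing by the function whose modulus is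
    [expR (H phi * expR (2 * s))] leaves a function bounded by [C] on both rays, and the strip
    version applies. *)
Lemma sector_Phragmen_Lindelof g phi1 phi2 C D (h1 h2 : R) : entire g ->
  phi1 < phi2 -> phi2 - phi1 < pi / 2 -> 0 <= C -> 0 <= D ->
  (forall s phi, phi1 <= phi <= phi2 -> normc (g s phi) <= C * expR (D * expR (2 * s))) ->
  (forall s, normc (g s phi1) <= C * expR (h1 * expR (2 * s))) ->
  (forall s, normc (g s phi2) <= C * expR (h2 * expR (2 * s))) ->
  forall s phi, phi1 <= phi <= phi2 ->
    normc (g s phi) <= C * expR ((h1 * sin (2 * (phi2 - phi)) +
      h2 * sin (2 * (phi - phi1))) / sin (2 * (phi2 - phi1)) * expR (2 * s)).
Proof.
move=> eg p12 wpi C0 D0 gD g1 g2 s phi pI.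
have w0 : 0 < phi2 - phi1 by rewrite subr_gt0.
pose sw := sin (2 * (phi2 - phi1)).
have sw0 : 0 < sw by apply: sin_gt0_pi; apply/andP; split; lra.
pose H p := (h1 * sin (2 * (phi2 - p)) + h2 * sin (2 * (p - phi1))) / sw.
pose a := (h1 * sin (2 * phi2) - h2 * sin (2 * phi1)) / sw.
pose b := (h2 * cos (2 * phi1) - h1 * cos (2 * phi2)) / sw.
have HE p : H p = a * cos (2 * p) + b * sin (2 * p).
  by rewrite /H /a /b !mulrBr !sinB; ring.
have H1 : H phi1 = h1.
  by rewrite /H subrr mulr0 sin0 mulr0 addr0 mulfK // gt_eqF.
have H2 : H phi2 = h2.
  by rewrite /H subrr mulr0 sin0 mulr0 add0r mulfK // gt_eqF.
pose F (s phi : R) : R[i] := cexp ((- a -i* (- b)) * cexp (2%:C * logz s phi)).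
have eF : entire F.
  apply: entire_cexp; apply: entireM; first exact: entire_cst.
  by apply: entire_cexp; apply: entireM; [exact: entire_cst|exact: entire_logz].
have nF t p : normc (F t p) = expR (- H p * expR (2 * t)).
  by rewrite normc_cexp_cexp HE; congr expR; ring.
have D'0 : 0 <= D + (`|a| + `|b|) by rewrite addr_ge0 // addr_ge0.
(* The midpoint between 2 and [pi / (phi2 - phi1)], which exceeds 2 because the opening is below
   [pi / 2]. *)
pose rho := (2 + pi / (phi2 - phi1)) / 2.
have pw : 2 < pi / (phi2 - phi1) by rewrite ltr_pdivlMr //; lra.
have rho2 : 2 < rho by rewrite /rho; lra.
have rhopi : rho * (phi2 - phi1) < pi.
  by rewrite -ltr_pdivlMr // /rho; lra.
have := @strip_Phragmen_Lindelof (fun s phi => g s phi * F s phi) phi1 phi2 rho C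
  (D + (`|a| + `|b|)) (entireM eg eF) p12 rho2 rhopi C0 D'0 _ _ s phi pI => /(_ _ _) K.
have {}K : normc (g s phi * F s phi) <= C.
  apply: K => [t p tI|t].
    rewrite normcM mulrDl expRD mulrA ler_pM ?normc_ge0 ?gD // nF ler_expR.
    rewrite ler_wpM2r ?expR_ge0 // HE.
    apply: le_trans (ler_norm _) _; rewrite normrN (le_trans (ler_normD _ _)) //.
    by rewrite lerD // normrM ler_piMr // ler_norml ?cos_geN1 ?cos_le1 ?sin_geN1 ?sin_le1.
  have E p : expR (- H p * expR (2 * t)) = (expR (H p * expR (2 * t)))^-1.
    by rewrite mulNr expRN.
  by rewrite !normcM !nF !E H1 H2 !ler_pdivrMr ?expR_gt0.
move: K; rewrite normcM nF mulNr expRN ler_pdivrMr ?expR_gt0 //.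
Qed.

End PhragmenLindelof.

(** * Hardy's theorem in the logarithmic plane *)

Section LogPlaneHardy.
Context {R : realType}.
Local Notation Re := complex.Re.
Local Notation Im := complex.Im.
Implicit Types (g : R -> R -> R[i]) (s phi C D A B k : R).

Lemma le0_expR_decay (x C a b : R) : 0 <= C -> 0 < a ->
  (forall M, x <= C * expR (b - M * a)) -> x <= 0.
Proof.
move=> C0 a0 H; rewrite leNgt; apply/negP => x0.
have := H ((C / x + b) / a); rewrite divfK ?gt_eqF //.
have -> : b - (C / x + b) = - (C / x) by ring.
rewrite leNgt expRN ltr_pdivrMr ?expR_gt0 // => /negP; apply.
have h : 1 + C / x <= expR (C / x) by exact: expR_ge1Dx.
apply: (@lt_le_trans _ _ (x * (1 + C / x))); last by rewrite ler_pM2l.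
by rewrite mulrDr mulr1 mulrCA divff ?gt_eqF // mulr1 ltrDr.
Qed.

(** A ray on which [g] vanishes satisfies the growth bound with exponent [- M] for every [M].
    Letting [M] grow sends the interpolated exponent to minus infinity off the other ray. *)
Lemma sector_zero_left g phi1 phi2 C D : entire g ->
  phi1 < phi2 -> phi2 - phi1 < pi / 2 -> 0 <= C -> 0 <= D ->
  (forall s phi, phi1 <= phi <= phi2 -> normc (g s phi) <= C * expR (D * expR (2 * s))) ->
  (forall s, g s phi1 = 0) ->
  forall s phi, phi1 <= phi < phi2 -> g s phi = 0.
Proof.
move=> eg p12 wpi C0 D0 gD g0 s phi /andP[pI1 pI2].
have pI : phi1 <= phi <= phi2 by rewrite pI1 ltW.
have b1 M s' : normc (g s' phi1) <= C * expR (- M * expR (2 * s')).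
  by rewrite g0 normc0 mulr_ge0 // expR_ge0.
have b2 s' : normc (g s' phi2) <= C * expR (D * expR (2 * s')).
  by apply: gD; rewrite lexx ltW.
have P M := sector_Phragmen_Lindelof eg p12 wpi C0 D0 gD (b1 M) b2 s pI.
apply/eqP; rewrite -normc_eq0 eq_le normc_ge0 andbT.
pose sw := sin (2 * (phi2 - phi1)).
have sw0 : 0 < sw by apply: sin_gt0_pi; apply/andP; split; lra.
apply: (@le0_expR_decay _ C (sin (2 * (phi2 - phi)) / sw * expR (2 * s))
  (D * sin (2 * (phi - phi1)) / sw * expR (2 * s)) C0) => [|M].
  by rewrite mulr_gt0 ?expR_gt0 // divr_gt0 // sin_gt0_pi //; apply/andP; split; lra.
apply: le_trans (P M) _; rewrite ler_wpM2l // ler_expR -/sw le_eqVlt.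
by apply/orP; left; apply/eqP; ring.
Qed.

Lemma sector_zero_right g phi1 phi2 C D : entire g ->
  phi1 < phi2 -> phi2 - phi1 < pi / 2 -> 0 <= C -> 0 <= D ->
  (forall s phi, phi1 <= phi <= phi2 -> normc (g s phi) <= C * expR (D * expR (2 * s))) ->
  (forall s, g s phi2 = 0) ->
  forall s phi, phi1 < phi <= phi2 -> g s phi = 0.
Proof.
move=> eg p12 wpi C0 D0 gD g0 s phi /andP[pI1 pI2].
have pI : phi1 <= phi <= phi2 by rewrite pI2 ltW.
have b1 s' : normc (g s' phi1) <= C * expR (D * expR (2 * s')).
  by apply: gD; rewrite lexx ltW.
have b2 M s' : normc (g s' phi2) <= C * expR (- M * expR (2 * s')).
  by rewrite g0 normc0 mulr_ge0 // expR_ge0.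
have P M := sector_Phragmen_Lindelof eg p12 wpi C0 D0 gD b1 (b2 M) s pI.
apply/eqP; rewrite -normc_eq0 eq_le normc_ge0 andbT.
pose sw := sin (2 * (phi2 - phi1)).
have sw0 : 0 < sw by apply: sin_gt0_pi; apply/andP; split; lra.
apply: (@le0_expR_decay _ C (sin (2 * (phi - phi1)) / sw * expR (2 * s))
  (D * sin (2 * (phi2 - phi)) / sw * expR (2 * s)) C0) => [|M].
  by rewrite mulr_gt0 ?expR_gt0 // divr_gt0 // sin_gt0_pi //; apply/andP; split; lra.
apply: le_trans (P M) _; rewrite ler_wpM2l // ler_expR -/sw le_eqVlt.
by apply/orP; left; apply/eqP; ring.
Qed.

(** Divided by [cos th ^+ 2], the expression is the quadratic [B * x ^+ 2 - 2 * k * x + A] in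
    [x = tan th]; its minimiser is [k / B], with value [(A * B - k ^+ 2) / B]. *)
Lemma hardy_angle A B k : 0 < B -> 0 < k -> A * B < k ^+ 2 ->
  exists th : R, [/\ 0 < th, th < pi / 2 &
    B * sin th ^+ 2 - k * sin (2 * th) + A * cos th ^+ 2 < 0].
Proof.
move=> B0 k0 kAB; exists (atan (k / B)).
have kB : 0 < k / B by rewrite divr_gt0.
split; first by rewrite -atan0 lt_atan.
  exact: atan_ltpi2.
have c0 : 0 < cos (atan (k / B)) by apply: cos_gt0_pihalf; rewrite atan_gtNpi2 atan_ltpi2.
have := atanK (k / B); rewrite /tan => /(canRL (divfK (lt0r_neq0 c0))).
rewrite mulr_natl mulr2n sinD; set c := cos _ in c0 * => ->.
have -> : B * (k / B * c) ^+ 2 - k * (k / B * c * c + c * (k / B * c)) + A * c ^+ 2 =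
   (A * B - k ^+ 2) / B * c ^+ 2 by field; rewrite gt_eqF.
rewrite pmulr_llt0 ?exprn_gt0 // pmulr_llt0 ?invr_gt0 // subr_lt0 //.
Qed.

Lemma hardy_logz g0 gT A B C k : entire g0 -> entire gT ->
  0 <= A -> 0 < B -> 0 <= C -> 0 < k -> A * B < k ^+ 2 ->
  (forall s phi, normc (g0 s phi) <= C * expR (A * sin phi ^+ 2 * expR (2 * s))) ->
  (forall s phi, normc (gT s phi) <= C * expR (B * sin phi ^+ 2 * expR (2 * s))) ->
  (forall s, gT s 0 = cexp (- 'i * (k * expR (2 * s))%:C) * g0 s 0) ->
  forall s, g0 s 0 = 0.
Proof.
move=> e0 eT A0 B0 C0 k0 kAB g0A gTB gTk.
have pi0 := @pi_gt0 R.
have sin2 (x : R) : sin x ^+ 2 <= 1.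
  by rewrite sin2cos2 lerBlDr lerDl sqr_ge0.
have g0D s phi : normc (g0 s phi) <= C * expR (A * expR (2 * s)).
  rewrite (le_trans (g0A s phi)) // ler_wpM2l // ler_expR ler_wpM2r ?expR_ge0 //.
  by rewrite ler_piMr.
have gTD s phi : normc (gT s phi) <= C * expR (B * expR (2 * s)).
  rewrite (le_trans (gTB s phi)) // ler_wpM2l // ler_expR ler_wpM2r ?expR_ge0 //.
  by rewrite ler_piMr // ltW.
pose W s phi : R[i] := cexp ((0 -i* k) * cexp (2%:C * logz s phi)).
have nW s phi : normc (W s phi) = expR (k * sin (2 * phi) * expR (2 * s)).
  by rewrite normc_cexp_cexp mul0r add0r.
have eW : entire W.
  apply: entire_cexp; apply: entireM; first exact: entire_cst.
  by apply: entire_cexp; apply: entireM; [exact: entire_cst|exact: entire_logz].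
(* [W] continues the multiplier exp (- i k z^2) off the real ray. [Phi] vanishes for [phi = 0],
   hence in every sector from that ray with opening below [pi / 2], which transfers the bound on
   [gT] to [g0]. *)
pose Phi s phi := gT s phi + (-1) * (W s phi * g0 s phi).
have ePhi : entire Phi.
  apply: entireD => //; apply: entireM; first exact: entire_cst.
  exact: entireM.
have D0 : 0 <= A + B + k by lra.
have PhiD s phi : normc (Phi s phi) <= (C + C) * expR ((A + B + k) * expR (2 * s)).
  rewrite (le_trans (le_normcD _ _)) // mulrDl lerD //.
    rewrite (le_trans (gTD s phi)) // ler_wpM2l // ler_expR ler_wpM2r ?expR_ge0 //.
    by rewrite -addrA addrCA lerDl addr_ge0 // ltW.
  rewrite mulN1r normcN normcM nW.
  apply: le_trans (ler_wpM2l (expR_ge0 _) (g0D s phi)) _.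
  rewrite mulrCA -expRD ler_wpM2l // ler_expR -mulrDl ler_wpM2r ?expR_ge0 //.
  have : k * sin (2 * phi) <= k by rewrite ler_piMr ?sin_le1 // ltW.
  by lra.
have Phi0 s : Phi s 0 = 0.
  rewrite /Phi gTk mulN1r; apply/eqP; rewrite subr_eq0; apply/eqP; congr (_ * _).
  rewrite /W /logz mulr0 addr0 -rmorphM cexpR; congr cexp.
  by apply: complex_ext => /=; ring.
have PhiZ s phi : 0 <= phi < pi / 2 -> gT s phi = W s phi * g0 s phi.
  move=> /andP[p0 p1]; apply/eqP; rewrite -subr_eq0 -mulN1r; apply/eqP.
  apply: (@sector_zero_left Phi 0 ((phi + pi / 2) / 2) (C + C) (A + B + k)) => //.
  - by lra.
  - by lra.
  - by rewrite addr_ge0.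
  - by apply/andP; split; lra.
have g0U s phi : 0 <= phi < pi / 2 ->
    normc (g0 s phi) <= C * expR ((B * sin phi ^+ 2 - k * sin (2 * phi)) * expR (2 * s)).
  move=> pI; have := gTB s phi; rewrite (PhiZ s phi pI) normcM nW mulrC.
  by rewrite -ler_pdivlMr ?expR_gt0 // -expRN -[leRHS]mulrA -expRD mulrBl.
have [th [th0 thpi hneg]] := hardy_angle B0 k0 kAB.
pose h1 := B * sin th ^+ 2 - k * sin (2 * th).
pose pm := (th + pi / 2) / 2.
pose psi := 2 * (pm - th).
have psi0 : 0 < sin psi by apply: sin_gt0_pi; rewrite /psi /pm; apply/andP; split; lra.
(* In the sector from [th] to [th + pi / 2 - ep] the interpolated exponent at [pm] has denominator
   [sin (2 * ep)], and it lies below [- M] exactly when [N M ep < 0]. At [ep = 0] the value of [N M]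
   is [sin psi] times the negative quantity of [hardy_angle], whatever [M] is, so a small [ep] works
   for each [M]. *)
pose N M (ep : R) := h1 * sin (psi + 2 * ep) + A * cos (th - ep) ^+ 2 * sin psi + M * sin (2 * ep).
have g0pm s : g0 s pm = 0.
  apply/eqP; rewrite -normc_eq0 eq_le normc_ge0 andbT.
  apply: (@le0_expR_decay _ C (expR (2 * s)) 0 C0) => [|M]; first exact: expR_gt0.
  have Nneg : N M 0 < 0.
    rewrite /N mulr0 addr0 subr0 sin0 mulr0 addr0 -mulrDl pmulr_llt0 //.
  have : \forall ep \near (0 : R)^'+, N M ep < 0.
    apply: (cvgr_lt (N M 0)) => //; apply: cvg_at_right_filter.
    apply: cvgD; first apply: cvgD.
    - apply: cvgMr; apply: continuous_comp; last exact: continuous_sin.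
      by apply: cvgD; [exact: cvg_cst|exact: cvgMr].
    - apply: cvgMl; apply: cvgMr; rewrite expr2; under eq_fun do rewrite expr2.
      have cc : (fun x : R => cos (th - x)) @ 0 --> cos (th - 0).
        apply: (@continuous_comp _ _ _ (fun x : R => th - x)); last exact: continuous_cos.
        by apply: cvgB; [exact: cvg_cst|exact: cvg_id].
      exact: cvgM.
    - apply: cvgMr; apply: continuous_comp; last exact: continuous_sin.
      exact: cvgMr.
  move=> Nep.
  have [ep [ep0 epi Nep0]] : exists ep, [/\ 0 < ep, ep < pi / 4 & N M ep < 0].
    have q4 : 0 < pi / 4 :> R by rewrite divr_gt0.
    near (0 : R)^'+ => ep; exists ep; split; near: ep => //.
    - exact: nbhs_right_gt.
    - exact: nbhs_right_lt.
  have w1 : th < th + pi / 2 - ep by lra.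
  have w2 : th + pi / 2 - ep - th < pi / 2 by lra.
  have thI : 0 <= th < pi / 2 by rewrite thpi ltW.
  have pmI : th <= pm <= th + pi / 2 - ep by rewrite /pm; apply/andP; split; lra.
  have b2 s' := g0A s' (th + pi / 2 - ep).
  have := sector_Phragmen_Lindelof e0 w1 w2 C0 A0 (fun s p _ => g0D s p)
    (fun s => g0U s th thI) b2 s pmI.
  move=> /le_trans; apply; rewrite ler_wpM2l // ler_expR sub0r -[leRHS]mulNr.
  rewrite ler_wpM2r ?expR_ge0 // -/h1.
  have -> : 2 * (th + pi / 2 - ep - th) = pi - 2 * ep by field.
  have -> : 2 * (th + pi / 2 - ep - pm) = pi - (psi + 2 * ep) by rewrite /psi; field.
  have -> : th + pi / 2 - ep = (th - ep) + pi / 2 by ring.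
  have sp (x : R) : sin (pi - x) = sin x.
    by rewrite addrC sinDpi sinN opprK.
  rewrite sinDpihalf !sp -/psi.
  have s2 : 0 < sin (2 * ep) by apply: sin_gt0_pi; apply/andP; split; lra.
  rewrite ler_pdivrMr //; move: Nep0; rewrite /N; lra.
(* The last sector ends at the ray [pm], where [g0] vanishes, and starts at a negative angle, so it
   contains the real ray; its opening is below [pi / 2] because [pm < pi / 2]. *)
move=> s; apply: (@sector_zero_right g0 ((pm - pi / 2) / 2) pm C A) => //.
- by rewrite /pm; lra.
- by rewrite /pm; lra.
- by rewrite /pm; apply/andP; split; lra.
Unshelve. all: by end_near. Qed.

End LogPlaneHardy.

(** * Gaussian decay *)

Section GaussianDecay.
Context {R : realType} (n : nat).
Local Notation env := (nat -> R).
Local Notation vars := (iota 0 n).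
Local Notation Re := complex.Re.
Local Notation Im := complex.Im.
Implicit Types (F G : env -> R[i]) (e om xi : env) (C K a b s phi : R).

(** The majorant is uniform in [phi], but in [s] only on half-lines: the complex frequency has
    modulus proportional to [expR s], which is bounded only for [s <= S]. *)
Definition dominated (H : R -> R -> env -> R[i]) : Prop :=
  (forall s phi, scont (H s phi)) /\
  forall S, exists C, forall s phi e, s <= S -> normc (H s phi e) <= C * wprod vars e.

Lemma cont2_Ints (H : R -> R -> env -> R[i]) : dominated H ->
  (forall e, cont2 (fun s phi => H s phi e)) ->
  cont2 (fun s phi => Ints vars (H s phi) (fun=> 0)).
Proof.
move=> [cH dH] c2 u v s phi us vp.
have [S HS] : exists S, forall k, u k <= S.
  have /cvg_seq_bounded[M [_ HM]] : cvgn u by apply/cvg_ex; exists s.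
  exists (M + 1) => k; apply: le_trans (ler_norm _) _.
  by apply: (HM (M + 1)) => //; rewrite ltrDl.
have [C HC] := dH S.
apply: (@Ints_dct R vars C (fun k => H (u k) (v k))) => [|k|e].
- exact: iota_uniq.
- by split; [exact: cH|move=> e; exact: HC].
- exact: c2.
Qed.

Lemma hol_Ints (H dH : R -> R -> env -> R[i]) : dominated H -> dominated dH ->
  (forall e, hol (fun s phi => H s phi e) (fun s phi => dH s phi e)) ->
  hol (fun s phi => Ints vars (H s phi) (fun=> 0))
      (fun s phi => Ints vars (dH s phi) (fun=> 0)).
Proof.
move=> [cH HH] [cdH HdH] hH s phi.
have [C HC] := HH (s + 1); have [C' HC'] := HdH (s + 1).
have un := iota_uniq 0 n.
split.
  apply: (@Ints_isD R vars C C' (fun t => H t phi) (fun t => dH t phi) s 1) => //.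
  - move=> t ts; split; first exact: cH.
    move=> e; apply: HC; move: ts; rewrite ltr_norml => /andP[_ ts]; lra.
  - by move=> t e _; exact: (hH e t phi).1.
  - move=> t e ts; apply: HC'; move: ts; rewrite ltr_norml => /andP[_ ts]; lra.
have cl : cls vars C' (dH s phi).
  by split; [exact: cdH|move=> e; apply: HC'; lra].
rewrite -(IntsZ 'i _ un cl).
apply: (@Ints_isD R vars C C' (H s) (fun t e => 'i * dH s t e) phi 1) => //.
- move=> t _; split; first exact: cH.
  by move=> e; apply: HC; lra.
- by move=> t e _; exact: (hH e s t).2.
- by move=> t e ts; rewrite normcM normci mul1r; apply: HC'; lra.
Qed.

Definition phase om s phi e : R[i] := cexp (logz s phi) * ('i * (- dot n om e)%:C).

Lemma hol_phase om e : hol (fun s phi => phase om s phi e) (fun s phi => phase om s phi e).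
Proof.
have := holM (hol_cexp hol_logz) (hol_cst ('i * (- dot n om e)%:C)).
by congr hol; apply/funext => s; apply/funext => phi; rewrite mulr0 addr0 mul1r.
Qed.

Lemma cont2_phase om e : cont2 (fun s phi => phase om s phi e).
Proof. by apply: cont2M; [exact: cont2_cexp cont2_logz|exact: cont2_cst]. Qed.

Lemma scont_phase om s phi : scont (phase om s phi).
Proof.
move=> u e ue; apply: cvgCM; first exact: cvgC_cst.
apply: cvgCM; first exact: cvgC_cst.
apply: cvgCR; apply: cvgN; apply: cvg_sum_seq => j.
by apply: cvgMr; exact: ue.
Qed.

Lemma Re_phase om s phi e : Re (phase om s phi e) = expR s * sin phi * dot n om e.
Proof.
by rewrite /phase cReM cexpE /= !(mul0r, mulr0, subr0, addr0, mul1r, add0r); ring.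
Qed.

Lemma normc_phase om s phi e : normc (phase om s phi e) = expR s * `|dot n om e|.
Proof.
rewrite /phase !normcM normc_cexp normci normcR normrN mul1r /=.
by rewrite mul0r mul1r subr0 addr0.
Qed.

(* The Fourier-Laplace transform at the complex frequency [exp (s + i phi) om]. *)
Definition FLT F om s phi : R[i] :=
  Ints vars (fun e => F e * cexp (phase om s phi e)) (fun=> 0).

Definition gaussian_decay K a F : Prop :=
  scont F /\ forall e, normc (F e) <= K * expR (- a * dot n e e).

Lemma gaussian_decay_ge0 K a F : gaussian_decay K a F -> 0 <= K.
Proof.
move=> [_ /(_ (fun=> 0)) h].
by rewrite -(pmulr_lge0 _ (expR_gt0 (- a * dot n (fun=> 0) (fun=> 0)))) (le_trans _ h) ?normc_ge0.
Qed.

Lemma gaussian_cls K a F r om : 0 < a -> gaussian_decay K a F -> 0 <= r ->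
  exists C, forall e, normc (F e) * expR (r * `|dot n om e|) <= C * wprod vars e.
Proof.
move=> a0 FK r0; have K0 := gaussian_decay_ge0 FK.
have /choice[C HC] : forall j, exists C, forall t : R,
    expR (- a * t ^+ 2 + (r * `|om j|) * `|t|) <= C * wgt t.
  by move=> j; exact: gauss_dom.
exists (K * \prod_(j <- vars) C j) => e.
apply: le_trans (ler_wpM2r (expR_ge0 _) (FK.2 e)) _.
rewrite -!mulrA ler_wpM2l // -expRD.
apply: (@le_trans _ _ (\prod_(j <- vars) expR (- a * e j ^+ 2 + (r * `|om j|) * `|e j|))).
  rewrite -expR_sum ler_expR big_split /= /dot.
  rewrite lerD //.
    by rewrite mulr_sumr; apply: ler_sum => j _; rewrite expr2.
  under [leRHS]eq_bigr do rewrite -mulrA -normrM.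
  by rewrite -mulr_sumr ler_wpM2l // ler_norm_sum.
rewrite /wprod -big_split /=; apply: ler_prod => j _.
by rewrite expR_ge0 HC.
Qed.

(** [Q] stands for the polynomial factors 1, z and z + z^2 that appear in the transform and its
    first two derivatives. Its growth and that of the exponential are absorbed together by
    [expR (3 * normc (phase om s phi e))]. *)
Lemma dominated_phase K a F om (Q : R[i] -> R[i]) : 0 < a -> gaussian_decay K a F ->
  (forall u z, cvgC u z -> cvgC (fun k => Q (u k)) (Q z)) ->
  (forall z, normc (Q z) <= 2 * expR (2 * normc z)) ->
  dominated (fun s phi e => F e * (Q (phase om s phi e) * cexp (phase om s phi e))).
Proof.
move=> a0 FK cQ nQ; split.
  move=> s phi u e ue; apply: cvgCM; first exact: FK.1.
  apply: cvgCM; first by apply: cQ; exact: scont_phase.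
  by apply: cvgC_cexp; exact: scont_phase.
move=> S; have r0 : 0 <= 3 * expR S by rewrite mulr_ge0 ?expR_ge0.
have [C HC] := gaussian_cls om a0 FK r0.
exists (2 * C) => s phi e sS.
rewrite -[leRHS]mulrA; apply: le_trans (ler_wpM2l (ler0n _ 2) (HC e)).
rewrite normcM mulrCA ler_wpM2l ?normc_ge0 // normcM normc_cexp.
apply: (@le_trans _ _ (2 * expR (2 * normc (phase om s phi e)) * expR (normc (phase om s phi e)))).
  rewrite ler_pM ?normc_ge0 ?expR_ge0 // ler_expR.
  by rewrite (le_trans (ler_norm _)) // Re_le_normc.
rewrite -mulrA -expRD ler_wpM2l // ler_expR normc_phase.
rewrite [leLHS](_ : _ = 3 * (expR s * `|dot n om e|)); last by ring.
by rewrite -[leRHS]mulrA ler_wpM2l // ler_wpM2r // ler_expR.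
Qed.

Lemma entire_FLT K a F om : 0 < a -> gaussian_decay K a F -> entire (FLT F om).
Proof.
move=> a0 FK.
have le1 (z : R[i]) : 1 <= expR (normc z) by rewrite -expR0 ler_expR normc_ge0.
have lez (z : R[i]) : normc z <= expR (normc z).
  by rewrite (le_trans _ (expR_ge1Dx _)) // lerDr.
have e2 (z : R[i]) : expR (2 * normc z) = expR (normc z) * expR (normc z).
  by rewrite -expRD mulrDl mul1r.
have d0 : dominated (fun s phi e => F e * (1 * cexp (phase om s phi e))).
  apply: (dominated_phase (Q := fun=> 1) _ a0 FK) => [*|z]; first exact: cvgC_cst.
  by rewrite normc1 e2; have := le1 z; nra.
have d1 : dominated (fun s phi e => F e * (phase om s phi e * cexp (phase om s phi e))).
  apply: (dominated_phase (Q := id) _ a0 FK) => [//|z].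
  by rewrite e2; have := le1 z; have := lez z; nra.
have d2 : dominated (fun s phi e => F e * ((phase om s phi e +
    phase om s phi e * phase om s phi e) * cexp (phase om s phi e))).
  apply: (dominated_phase (Q := fun z => z + z * z) _ a0 FK) => [u z uz|z].
    by apply: cvgCD => //; exact: cvgCM.
  rewrite (le_trans (le_normcD _ _)) // normcM e2.
  by have := normc_ge0 z; have := le1 z; have := lez z; nra.
have E0 : FLT F om = (fun s phi =>
    Ints vars (fun e => F e * (1 * cexp (phase om s phi e))) (fun=> 0)).
  apply/funext => s; apply/funext => phi; congr Ints; apply/funext => e.
  by rewrite mul1r.
have hz e : hol (fun s phi => cexp (phase om s phi e))
  (fun s phi => phase om s phi e * cexp (phase om s phi e)) := hol_cexp (hol_phase om e).
split; last first.
  rewrite E0; apply: cont2_Ints => // e; apply: cont2M; first exact: cont2_cst.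
  by apply: cont2M; [exact: cont2_cst|apply: cont2_cexp; exact: cont2_phase].
rewrite E0; eexists; split.
  apply: (hol_Ints d0 d1) => e; have := holM (hol_cst (F e)) (hz e).
  by congr hol; apply/funext => s; apply/funext => phi; rewrite ?mul1r // mul0r add0r.
eexists; apply: (hol_Ints d1 d2) => e.
have := holM (hol_cst (F e)) (holM (hol_phase om e) (hz e)).
by congr hol; apply/funext => s; apply/funext => phi; ring.
Qed.

Lemma FLT_real F om s : FLT F om s 0 = FT n F (fun j => expR s * om j).
Proof.
congr Ints; apply/funext => e; congr (_ * _).
rewrite /phase /chi /cis /logz mulr0 addr0 cexpR mulrCA -rmorphM; congr (cexp ('i * _%:C)).
rewrite mulrN /dot mulr_sumr; congr (- _); apply: eq_bigr => j _; ring.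
Qed.

(** The Gaussian is split: the part [a - b] keeps the integral convergent with a constant
    independent of the frequency. In the part [b] the square is completed, [- b * x ^+ 2 + y * w * x
    <= w ^+ 2 * y ^+ 2 / (4 * b)] in each coordinate, with [y = expR s * sin phi]. *)
Lemma FLT_growth K a b F om : 0 < b -> b < a -> gaussian_decay K a F ->
  exists2 C, 0 <= C & forall s phi,
    normc (FLT F om s phi) <= C * expR (dot n om om / (4 * b) * sin phi ^+ 2 * expR (2 * s)).
Proof.
move=> b0 ba FK; have K0 := gaussian_decay_ge0 FK.
have ab0 : 0 < a - b by rewrite subr_gt0.
have [c Hc] := gauss_dom 0 ab0.
have {}Hc (t : R) : expR (- (a - b) * t ^+ 2) <= c * wgt t.
  by have := Hc t; rewrite mul0r addr0.
have c0 : 0 <= c.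
  by rewrite -(pmulr_lge0 _ (wgt_gt0 0)) (le_trans _ (Hc 0)) ?expR_ge0.
have P0 : 0 <= \prod_(j <- vars) c by apply: prodr_ge0.
exists ((2 * pi) ^+ n * (K * \prod_(j <- vars) c)).
  by rewrite !mulr_ge0 // exprn_ge0 // mulr_ge0 // pi_ge0.
move=> s phi; set E := expR (_ * expR (2 * s)).
have -> : (2 * pi) ^+ n * (K * \prod_(j <- vars) c) * E =
  (2 * pi) ^+ size vars * (K * \prod_(j <- vars) c * E) by rewrite size_iota; ring.
apply: Ints_bound; first exact: iota_uniq.
split.
  move=> u e ue; apply: cvgCM; first exact: FK.1.
  by apply: cvgC_cexp; exact: scont_phase.
move=> e; rewrite normcM normc_cexp Re_phase.
apply: le_trans (ler_wpM2r (expR_ge0 _) (FK.2 e)) _.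
rewrite -!mulrA ler_wpM2l // -expRD.
pose y := expR s * sin phi.
apply: (@le_trans _ _ (\prod_(j <- vars) expR (- (a - b) * e j ^+ 2) * E)).
  rewrite -expR_sum /E -expRD ler_expR.
  have -> : expR (2 * s) = expR s * expR s by rewrite -expRD mulrDl mul1r.
  rewrite mulrA -/y [leRHS](_ : _ = \sum_(j <- vars) (- (a - b) * e j ^+ 2 +
     om j * om j / (4 * b) * y ^+ 2)); last first.
    by rewrite big_split /= -!mulr_suml -/(dot n om om) /y; ring.
  rewrite /dot !mulr_sumr -big_split /=; apply: ler_sum => j _.
  rewrite -subr_ge0 [leRHS](_ : _ = (2 * b * e j - y * om j) ^+ 2 / (4 * b)).
    by rewrite divr_ge0 ?sqr_ge0 // mulr_ge0 // ltW.
  by field; rewrite gt_eqF.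
rewrite mulrCA mulrA [leRHS](_ : _ = \prod_(j <- vars) c * wprod vars e * E); last by ring.
rewrite ler_wpM2r ?expR_ge0 // /wprod -big_split /=; apply: ler_prod => j _.
by rewrite expR_ge0 Hc.
Qed.

Lemma gaussian_uniqueness F0 F1 K0 K1 a b k : (0 < n)%N -> 0 < a -> 0 < b -> 0 < k ->
  gaussian_decay K0 a F0 -> gaussian_decay K1 b F1 ->
  (forall xi, FT n F1 xi = cis (- (k * nrm2 n xi)) * FT n F0 xi) ->
  1 < 16 * (a * b) * k ^+ 2 -> forall xi, FT n F0 xi = 0.
Proof.
move=> n0 a0 b0 k0 F0a F1b F01 abk.
have [C HC] : exists C, cls vars C F0.
  have [C HC] := gaussian_cls (fun=> 0) a0 F0a (lexx 0); exists C.
  by split=> [|e]; [exact: F0a.1|have := HC e; rewrite mul0r expR0 mulr1].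
suff nz xi : 0 < nrm2 n xi -> FT n F0 xi = 0.
  (* The frequency 0 spans no line, so it is reached by continuity. Coordinate 0, present since [n]
     is positive, is pushed away from 0 in the direction of its sign, which keeps [nrm2 n (v i)]
     positive. *)
  move=> xi; pose v (i : nat) : env := fun j => if j == 0%N
    then xi j + (if 0 <= xi j then 1 else -1) * harmonic i else xi j.
  apply: (cvgC_unique (scont_FT HC (v := v) (xi := xi) _)) => [j|].
    rewrite /v; case: eqP => _; last exact: cvg_cst.
    rewrite -[X in _ --> X]addr0; apply: cvgD; first exact: cvg_cst.
    rewrite -[X in _ --> X](mulr0 (if 0 <= xi j then 1 else -1)).
    by apply: cvgMr; exact: cvg_harmonic.
  have -> : (fun i => FT n F0 (v i)) = (fun=> 0); last exact: cvgC_cst.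
  apply/funext => i; apply: nz; rewrite nrm2E.
  rewrite (bigD1_seq 0%N) ?iota_uniq ?mem_iota //= ltr_pwDl //; last first.
    by apply: sumr_ge0 => j _; rewrite sqr_ge0.
  rewrite exprn_even_gt0 //= /v eqxx.
  have h0 : 0 < harmonic i :> R by rewrite invr_gt0.
  case: ifPn => [x0|]; first by rewrite mul1r gt_eqF // ltr_wpDl.
  by rewrite -ltNge => x0; rewrite lt_eqF // mulN1r; lra.
move=> xi0.
set N := nrm2 n xi in xi0 *.
set q := 16 * (a * b) * k ^+ 2 in abk.
have q0 : 0 < q by lra.
(* Both Gaussian rates are shrunk by the same [r < 1], and the strict inequality [1 < q] leaves room
   for it: with [r = (1 + q^-1) / 2] one gets [r ^+ 2 * q = 1 + (q - 1) ^+ 2 / (4 * q)]. *)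
have [r [r0 r1 rq]] : exists r : R, [/\ 0 < r, r < 1 & 1 < r ^+ 2 * q].
  have qi : q^-1 < 1 by rewrite invf_lt1.
  have qi0 : 0 < q^-1 by rewrite invr_gt0.
  exists ((1 + q^-1) / 2); split; [lra|lra|].
  rewrite [ltRHS](_ : _ = 1 + (q - 1) ^+ 2 / (4 * q)); last by field; rewrite gt_eqF.
  by rewrite ltrDl divr_gt0 ?exprn_gt0 ?mulr_gt0 // subr_gt0.
have ra : r * a < a by rewrite gtr_pMl.
have rb : r * b < b by rewrite gtr_pMl.
have [C0 C00 G0] := FLT_growth xi (mulr_gt0 r0 a0) ra F0a.
have [C1 C10 G1] := FLT_growth xi (mulr_gt0 r0 b0) rb F1b.
have E : FT n F0 xi = FLT F0 xi 0 0.
  by rewrite FLT_real expR0; congr FT; apply/funext => j; rewrite mul1r.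
rewrite E; apply: (@hardy_logz R (FLT F0 xi) (FLT F1 xi) (N / (4 * (r * a)))
  (N / (4 * (r * b))) (C0 + C1) (k * N)).
- exact: entire_FLT F0a.
- exact: entire_FLT F1b.
- by rewrite divr_ge0 ?ltW // !mulr_gt0.
- by rewrite divr_gt0 // !mulr_gt0.
- by rewrite addr_ge0.
- by rewrite mulr_gt0.
- have -> : N / (4 * (r * a)) * (N / (4 * (r * b))) = N ^+ 2 * k ^+ 2 / (r ^+ 2 * q).
    by rewrite /q; field; rewrite !gt_eqF.
  rewrite ltr_pdivrMr; last by rewrite mulr_gt0 // exprn_gt0.
  by rewrite exprMn [k ^+ 2 * _]mulrC ltr_pMr // mulr_gt0 // exprn_gt0.
- move=> s phi; rewrite (le_trans (G0 s phi)) // ler_wpM2r ?expR_ge0 //.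
  by rewrite lerDl.
- move=> s phi; rewrite (le_trans (G1 s phi)) // ler_wpM2r ?expR_ge0 //.
  by rewrite lerDr.
- move=> s; rewrite !FLT_real F01; congr (_ * _).
  have -> : nrm2 n (fun j => expR s * xi j) = N * expR (2 * s).
    rewrite /N !nrm2E mulr_suml; apply: eq_bigr => j _.
    by rewrite exprMn mulrC; congr (_ * _); rewrite expr2 -expRD mulrDl mul1r.
  by rewrite /cis mulNr rmorphN mulrN mulrA.
Qed.

End GaussianDecay.

(** * From Gaussian bounds at two times to the vanishing of the solution *)

Lemma gaussian_decay_onenv (R : realType) n (f : 'rV[R]_n -> R[i]) (K a : R) :
  schwartz f -> (forall x, `|f x| <= (K * expR (- a * enorm x ^+ 2))%:C) ->
  gaussian_decay n K a (onenv f).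
Proof.
move=> Sf fK; split; first by apply: scont_onenv; exact: (Sf.1 [::]).1.
move=> e; have := fK (rv n e); rewrite normc_normE lecR /enorm sqr_sqrtr; last first.
  by apply: sumr_ge0 => i _; exact: sqr_ge0.
have -> : dot n e e = \sum_(i < n) e i * e i.
  by rewrite /dot -[in LHS](subn0 n) -/(index_iota 0 n) big_mkord.
by under eq_bigr do rewrite mxE expr2.
Qed.

Theorem corollary4p1 (R : realType) (n : nat) (hbar m : R)
    (u : 'rV[R]_n -> R -> R[i]) (T alpha beta K : R) :
  (1 <= n)%N -> 0 < hbar -> 0 < m ->
  (forall t : R, schwartz (fun x => u x t)) ->
  free_schrodinger hbar m u ->
  0 < alpha -> 0 < beta -> 0 < K ->
  (forall x : 'rV[R]_n,
     `|u x 0| <= (K * expR (- alpha * enorm x ^+ 2))%:C) ->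
  (forall x : 'rV[R]_n,
     `|u x T| <= (K * expR (- beta * enorm x ^+ 2))%:C) ->
  1 < alpha * beta * (2 * hbar * T / m) ^+ 2 ->
  forall (x : 'rV[R]_n) (t : R), u x t = 0.
Proof.
move=> n0 hb0 m0 Su Eu a0 b0 K0 ua ub abT.
have FTev := free_evolution_FT hb0 Su Eu.
pose c := hbar / (2 * m).
have c0 : 0 < c by rewrite divr_gt0 // mulr_gt0.
have cisN (r : R) : cis (- r) * cis r = 1 by rewrite -cisD addNr cis0.
have cis_ne0 (r : R) : cis r != 0.
  by apply/negP => /eqP z; have := cisN r; rewrite z mulr0 => /esym/eqP; rewrite oner_eq0.
have D0 := gaussian_decay_onenv (Su 0) ua.
have DT := gaussian_decay_onenv (Su T) ub.
(* The 16 collects the two factors 4 in the growth rates [nrm2 xi / (4 * alpha)] and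
   [nrm2 xi / (4 * beta)]. *)
have key : 1 < 16 * (alpha * beta) * (c * T) ^+ 2.
  move: abT; rewrite (_ : alpha * beta * _ = 16 * (alpha * beta) * (c * T) ^+ 2) //.
  by rewrite /c; field; rewrite gt_eqF.
have ev s t xi : FT n (onenv (u ^~ t)) xi =
    cis (- (c * (t - s) * nrm2 n xi)) * FT n (onenv (u ^~ s)) xi.
  rewrite -[LHS]mul1r -(cisN (c * nrm2 n xi * t)) -mulrA -(FTev xi s t) mulrA -cisD.
  by congr (cis _ * _); rewrite /c; ring.
have zero s t : (forall xi, FT n (onenv (u ^~ s)) xi = 0) ->
    forall xi, FT n (onenv (u ^~ t)) xi = 0.
  by move=> z xi; rewrite (ev s t) z mulr0.
suff [s Hs] : exists s, forall xi, FT n (onenv (u ^~ s)) xi = 0.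
  move=> x t; exact: (schwartz_FT_eq0 (Su t) (zero s t Hs)).
(* The phase constant has to be positive: for [T < 0] the two times exchange roles, and [T = 0]
   contradicts [key]. *)
have [T0|T0|T0] := ltgtP 0 T.
- exists 0; apply: (gaussian_uniqueness n0 a0 b0 _ D0 DT _ key).
  + exact: mulr_gt0.
  + by move=> xi; rewrite (ev 0 T) subr0.
- exists T; apply: (gaussian_uniqueness (k := - (c * T)) n0 b0 a0 _ DT D0).
  + by rewrite oppr_gt0 pmulr_rlt0.
  + by move=> xi; rewrite (ev T 0) sub0r mulrN.
  + by rewrite sqrrN [beta * _]mulrC.
- by move: key; rewrite -T0 mulr0 expr0n mulr0 ltr10.
Qed.
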